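(* Let $k$ be a field of characteristic zero, let $n\geq 4$, let $R=k[x_1,\ldots,x_n]$ be the standard graded polynomial ring, write $w=x_{n-1}$, $u=x_n$, and let $$f=2w^{n-1}u+\sum_{i=1}^{n-2}x_i\,w^{i-1}u^{n-i}\in R.$$ Then the Rees algebra $\mathscr{R}(J_f)$ is Cohen-Macaulay.
   Context: $J_f=(\partial f/\partial x_1,\ldots,\partial f/\partial x_n)\subset R$ is the Jacobian ideal of $f$. For an ideal $I\subset R$, the Rees algebra is $\mathscr{R}(I)=\bigoplus_{i\geq 0}I^it^i\subset R[t]$, with $t$ an indeterminate. *)

(* Defs.v *)
From HB Require Import structures.
From mathcomp Require Import all_boot all_order all_algebra.
From mathcomp Require Import generic_quotient ring_quotient ring.
From mathcomp Require Import boolp.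

Set Implicit Arguments.
Unset Strict Implicit.
Unset Printing Implicit Defensive.

Import GRing.Theory.

Local Open Scope ring_scope.
Local Open Scope quotient_scope.

Section Ideals.
Variable A : comNzRingType.
Implicit Types (G I J P : {pred A}) (s : seq A).

Definition ideal_gen G : {pred A} := fun x =>
  `[< exists2 s : seq (A * A),
        forall p, p \in s -> p.2 \in G & x = \sum_(p <- s) p.1 * p.2 >].

Definition ideal_mul I J : {pred A} :=
  ideal_gen (fun z => `[< exists x y, [/\ x \in I, y \in J & z = x * y] >]).

Definition ideal_exp I (i : nat) : {pred A} := iter i (ideal_mul I) predT.

(* [idealr_closed] includes properness. *)
Definition is_prime_ideal P : Prop := idealr_closed P /\ prime_idealr_closed P.

Definition is_maximal_ideal I : Prop :=
  idealr_closed I /\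
  forall J, idealr_closed J -> {subset I <= J} -> {subset J <= I}.

Definition proper_subset I J : Prop :=
  {subset I <= J} /\ exists2 x, x \in J & x \notin I.

(* The unit ideal, which is not [idealr_closed], is generated by [:: 1]. *)
Definition noetherian : Prop :=
  forall I, idealr_closed I -> exists s, I =i ideal_gen [pred y in s].

(* C 0, ..., C d is a strictly increasing chain of primes, of length d. *)
Definition prime_chain (d : nat) (C : nat -> {pred A}) : Prop :=
  (forall i, (i <= d)%N -> is_prime_ideal (C i)) /\
  (forall i, (i < d)%N -> proper_subset (C i) (C i.+1)).

Definition krull_dim_eq (d : nat) : Prop :=
  (exists C, prime_chain d C) /\
  (forall e C, prime_chain e C -> (e <= d)%N).

(* s`_i is a nonzerodivisor on A / (s`_0, ..., s`_(i-1)), and A / (s) != 0. *)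
Definition regular_seq s : Prop :=
  (forall i, (i < size s)%N -> forall x,
     x * s`_i \in ideal_gen [pred y in take i s] -> x \in ideal_gen [pred y in take i s]) /\
  1 \notin ideal_gen [pred y in s].

Definition depth_eq I (d : nat) : Prop :=
  (exists s, [/\ regular_seq s, {subset s <= I} & size s = d]) /\
  (forall s, regular_seq s -> {subset s <= I} -> (size s <= d)%N).

(* A is local, with maximal ideal I. *)
Definition is_local I : Prop :=
  is_maximal_ideal I /\ forall J, is_maximal_ideal J -> J =i I.

Definition local_cohen_macaulay : Prop :=
  noetherian /\
  exists I, is_local I /\ exists2 d, depth_eq I d & krull_dim_eq d.

End Ideals.

Arguments noetherian A : clear implicits.
Arguments krull_dim_eq A d : clear implicits.
Arguments local_cohen_macaulay A : clear implicits.

(* Fractions a / s with s outside P; a / s = b / t when u a t = u b s for some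
   u outside P, as A need not be a domain. *)
Module Localization.
Section Localization.
Variables (A : comNzRingType) (P : prime_idealr A).

Inductive ratio := Ratio { frac :> A * A; _ : frac.2 \notin (P : {pred A}) }.
HB.instance Definition _ := [isSub for frac].
HB.instance Definition _ := [Choice of ratio by <:].

Implicit Types x y z : ratio.

Lemma denP x : x.2 \notin (P : {pred A}). Proof. by case: x. Qed.

Lemma notin1 : 1 \notin (P : {pred A}). Proof. by rewrite idealr1. Qed.

Lemma notinM (a b : A) : a \notin (P : {pred A}) -> b \notin (P : {pred A}) ->
  a * b \notin (P : {pred A}).
Proof. by move=> aP bP; rewrite prime_idealrM negb_or aP bP. Qed.

Definition equivl x y : bool :=
  `[< exists2 u, u \notin (P : {pred A}) & u * (x.1 * y.2) = u * (y.1 * x.2) >].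

Lemma equivl_refl : reflexive equivl.
Proof. by move=> x; apply/asboolP; exists 1 => //; exact: notin1. Qed.

Lemma equivl_sym : symmetric equivl.
Proof.
by move=> x y; apply/asboolP/asboolP => -[u uP e]; exists u.
Qed.

Lemma equivl_trans : transitive equivl.
Proof.
move=> y x z /asboolP[u uP e] /asboolP[v vP e']; apply/asboolP.
exists (u * v * y.2); first by rewrite !notinM ?denP.
transitivity (v * z.2 * (u * (x.1 * y.2))); first by ring.
rewrite e; transitivity (u * x.2 * (v * (y.1 * z.2))); first by ring.
by rewrite e'; ring.
Qed.

Canonical equivl_equiv := EquivRel equivl equivl_refl equivl_sym equivl_trans.

Definition type := {eq_quot equivl}.
HB.instance Definition _ : EqQuotient _ equivl type := EqQuotient.on type.
HB.instance Definition _ := Choice.on type.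

Lemma eq_piP x y : reflect
  (exists2 u, u \notin (P : {pred A}) & u * (x.1 * y.2) = u * (y.1 * x.2))
  (x == y %[mod type]).
Proof. by rewrite eqmodE; exact: asboolP. Qed.

Lemma eq_pi x y : x.1 * y.2 = y.1 * x.2 -> \pi_type x = \pi_type y.
Proof. by move=> e; apply/eqP/eq_piP; exists 1; rewrite ?notin1 ?e. Qed.

Lemma repr_pi x : exists2 u, u \notin (P : {pred A}) &
  u * ((repr (\pi_type x)).1 * x.2) = u * (x.1 * (repr (\pi_type x)).2).
Proof. by apply/eq_piP; rewrite reprK. Qed.

Definition ofrac (a : A) := Ratio (notin1 : (a, 1).2 \notin (P : {pred A})).

Definition addl x y : ratio :=
  Ratio (notinM (denP x) (denP y)
           : (x.1 * y.2 + y.1 * x.2, x.2 * y.2).2 \notin (P : {pred A})).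
Definition oppl x : ratio :=
  Ratio (denP x : (- x.1, x.2).2 \notin (P : {pred A})).
Definition mull x y : ratio :=
  Ratio (notinM (denP x) (denP y)
           : (x.1 * y.1, x.2 * y.2).2 \notin (P : {pred A})).

Definition add := lift_op2 type addl.
Definition opp := lift_op1 type oppl.
Definition mul := lift_op2 type mull.
Definition embed := lift_embed type ofrac.
Canonical embed_pi_morph := PiEmbed embed.

Lemma pi_add : {morph \pi : x y / addl x y >-> add x y}.
Proof.
move=> x y; unlock add; apply/eqP/eq_piP => /=.
have [u uP e] := repr_pi x; have [v vP e'] := repr_pi y.
move: (repr (\pi x)) (repr (\pi y)) e e' => x' y' e e'.
exists (u * v); first exact: notinM.
transitivity ((u * (x.1 * x'.2)) * (v * y.2 * y'.2)
  + (v * (y.1 * y'.2)) * (u * x.2 * x'.2)); first by ring.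
by rewrite -e -e'; ring.
Qed.
Canonical pi_add_morph := PiMorph2 pi_add.

Lemma pi_opp : {morph \pi : x / oppl x >-> opp x}.
Proof.
move=> x; unlock opp; apply/eqP/eq_piP => /=.
have [u uP e] := repr_pi x; exists u => //.
by rewrite !mulNr !mulrN e.
Qed.
Canonical pi_opp_morph := PiMorph1 pi_opp.

Lemma pi_mul : {morph \pi : x y / mull x y >-> mul x y}.
Proof.
move=> x y; unlock mul; apply/eqP/eq_piP => /=.
have [u uP e] := repr_pi x; have [v vP e'] := repr_pi y.
move: (repr (\pi x)) (repr (\pi y)) e e' => x' y' e e'.
exists (u * v); first exact: notinM.
transitivity ((u * (x.1 * x'.2)) * (v * (y.1 * y'.2))); first by ring.
by rewrite -e -e'; ring.
Qed.
Canonical pi_mul_morph := PiMorph2 pi_mul.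

Lemma addA : associative add.
Proof.
elim/quotW=> x; elim/quotW=> y; elim/quotW=> z; rewrite !piE.
by apply: eq_pi => /=; ring.
Qed.

Lemma addC : commutative add.
Proof.
elim/quotW=> x; elim/quotW=> y; rewrite !piE.
by apply: eq_pi => /=; ring.
Qed.

Lemma add0 : left_id (embed 0) add.
Proof. by elim/quotW=> x; rewrite !piE; apply: eq_pi => /=; ring. Qed.

Lemma addN : left_inverse (embed 0) opp add.
Proof. by elim/quotW=> x; rewrite !piE; apply: eq_pi => /=; ring. Qed.

HB.instance Definition _ := GRing.isZmodule.Build type addA addC add0 addN.

Lemma mulA : associative mul.
Proof.
elim/quotW=> x; elim/quotW=> y; elim/quotW=> z; rewrite !piE.
by apply: eq_pi => /=; ring.
Qed.

Lemma mulC : commutative mul.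
Proof.
elim/quotW=> x; elim/quotW=> y; rewrite !piE.
by apply: eq_pi => /=; ring.
Qed.

Lemma mul1 : left_id (embed 1) mul.
Proof. by elim/quotW=> x; rewrite !piE; apply: eq_pi => /=; ring. Qed.

Lemma mulDl : left_distributive mul add.
Proof.
elim/quotW=> x; elim/quotW=> y; elim/quotW=> z; rewrite !piE.
by apply: eq_pi => /=; ring.
Qed.

Lemma one_neq0 : embed 1 != embed 0.
Proof.
rewrite !piE; apply/asboolP => -[u uP] /=; rewrite !mulr1 mulr0 => u0.
by move: uP; rewrite u0 idealr0.
Qed.

HB.instance Definition _ :=
  GRing.Zmodule_isComNzRing.Build type mulA mulC mul1 mulDl one_neq0.

End Localization.
End Localization.
HB.export Localization.

Definition localization (A : comNzRingType) (P : prime_idealr A) :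
  comNzRingType := Localization.type P.

(* A maximal ideal is prime, so m below ranges over all maximal ideals. *)
Definition cohen_macaulay (A : comNzRingType) : Prop :=
  noetherian A /\
  forall m : prime_idealr A,
    is_maximal_ideal m -> local_cohen_macaulay (localization m).

Section Rees.
Variables (R : comNzRingType) (I : {pred R}).

(* {poly R} stands for R[t]: the sum of the I^i t^i inside R[t]. *)
Definition in_rees : {pred {poly R}} :=
  fun p => `[< forall i, p`_i \in ideal_exp I i >].

Lemma ideal_gen_add G :
  {in ideal_gen G &, forall x y : R, x + y \in ideal_gen G}.
Proof.
move=> x y /asboolP[s sG ->] /asboolP[t tG ->]; apply/asboolP.
exists (s ++ t); last by rewrite big_cat.
by move=> p; rewrite mem_cat => /orP[/sG|/tG].
Qed.

Lemma ideal_gen_mul G (a x : R) : x \in ideal_gen G -> a * x \in ideal_gen G.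
Proof.
move=> /asboolP[s sG ->]; apply/asboolP.
exists [seq (a * p.1, p.2) | p <- s].
  by move=> _ /mapP[p /sG pG ->].
by rewrite big_map mulr_sumr; apply: eq_bigr => p _; rewrite /= mulrA.
Qed.

Lemma ideal_gen0 G : (0 : R) \in ideal_gen G.
Proof. by apply/asboolP; exists [::]; rewrite ?big_nil. Qed.

Lemma ideal_gen_sub (G : {pred R}) : {subset G <= ideal_gen G}.
Proof.
move=> x xG; apply/asboolP; exists [:: (1, x)].
  by move=> p; rewrite inE => /eqP->.
by rewrite big_seq1 mul1r.
Qed.

Lemma ideal_exp_add i :
  {in ideal_exp I i &, forall x y, x + y \in ideal_exp I i}.
Proof. by case: i => [//|i]; exact: ideal_gen_add. Qed.

Lemma ideal_exp_mul i a x : x \in ideal_exp I i -> a * x \in ideal_exp I i.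
Proof. by case: i => [//|i]; exact: ideal_gen_mul. Qed.

Lemma ideal_exp0 i : 0 \in ideal_exp I i.
Proof. by case: i => [//|i]; exact: ideal_gen0. Qed.

Lemma ideal_exp_sum i (T : Type) (r : seq T) (Q : pred T) (F : T -> R) :
  (forall t, Q t -> F t \in ideal_exp I i) ->
  \sum_(t <- r | Q t) F t \in ideal_exp I i.
Proof.
move=> FI; elim/big_rec: _ => [|t x /FI]; first exact: ideal_exp0.
exact: ideal_exp_add.
Qed.

Lemma ideal_expD i j x y : x \in ideal_exp I i -> y \in ideal_exp I j ->
  x * y \in ideal_exp I (i + j).
Proof.
elim: i x y => [|i IHi] x y; first by move=> _ yI; exact: ideal_exp_mul.
move=> /asboolP[s sG ->] yI; rewrite mulr_suml big_seq.
apply: ideal_exp_sum => p /sG/asboolP[a [b [aI bI ->]]].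
rewrite [_ * _ * y](_ : _ = p.1 * (a * (b * y))); last by ring.
apply: ideal_exp_mul; apply: ideal_gen_sub; apply/asboolP.
by exists a, (b * y); split => //; exact: IHi.
Qed.

Lemma in_rees_subring : subring_closed in_rees.
Proof.
split=> [|p q /asboolP pI /asboolP qI|p q /asboolP pI /asboolP qI];
  apply/asboolP => i.
- by rewrite coef1; case: i => [//|i]; exact: (ideal_exp0 i.+1).
- rewrite coefB -mulN1r; apply: ideal_exp_add => //; exact: ideal_exp_mul.
- rewrite coefM; apply: ideal_exp_sum => j _.
  by have := ideal_expD (pI j) (qI (i - j)%N); rewrite subnKC // -ltnS.
Qed.

HB.instance Definition _ :=
  GRing.isSubringClosed.Build {poly R} in_rees in_rees_subring.

Record rees_type := Rees { rees_val :> {poly R}; _ : rees_val \in in_rees }.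
HB.instance Definition _ := [isSub for rees_val].
HB.instance Definition _ := [Choice of rees_type by <:].
HB.instance Definition _ := [SubChoice_isSubComNzRing of rees_type by <:].

Definition rees_algebra : comNzRingType := rees_type.

End Rees.

(* Imported only here because mpoly shadows [symmetric] and [[in _]]. *)
From mathcomp Require Import mpoly.

Definition jacobian_ideal (k : fieldType) (n : nat) (f : {mpoly k[n]}) :
  {pred {mpoly k[n]}} := ideal_gen [pred g | [exists i, g == mderiv i f]].

(* The variables x_1, ..., x_n, numbered from 1 (and 0 outside that range). *)
Definition xvar (k : fieldType) (n i : nat) : {mpoly k[n]} :=
  if i is j.+1 then oapp (fun l : 'I_n => 'X_l) 0 (insub j) else 0.

Definition fpoly (k : fieldType) (n : nat) : {mpoly k[n]} :=
  let w := xvar k n n.-1 in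
  let u := xvar k n n in
  2 * w ^+ n.-1 * u
  + \sum_(1 <= i < n.-1) xvar k n i * w ^+ i.-1 * u ^+ (n - i).

(* Main.v *)
Require Import Defs.
From HB Require Import structures.
From mathcomp Require Import all_boot all_order all_algebra.
From mathcomp Require Import generic_quotient ring_quotient ring zify.
From mathcomp Require Import boolp.
From mathcomp Require Import mpoly.

(** Write [n = m + 3], so that the partial derivatives of the form [F] are the
    monomials [w^i u^(m+2-i)] for [i <= m], together with [F_w] and [F_u]. With
    [t] the Rees variable, put [z_j = w^(m-j) u^(j+2) t]. The elements [u], [w],
    [z_0, ..., z_m] satisfy the determinantal relations [u z_j = w z_(j+1)] and
    [z_j z_l = z_0 z_(j+l)] of a rational normal scroll, and the remaining
    generators [F_w t], [F_u t] of the Rees algebra enter two more relations,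
    which come from expressing [u F_w] and [(n-1) u F_u - w F_w] through the
    monomials above. Thus the Rees algebra is the coordinate ring of a scroll,
    with further variables adjoined, modulo two quadrics. The scroll is
    Cohen-Macaulay and the quadrics lower the dimension by two, whence the
    theorem.

    The proof makes this explicit by a Noether normalization. In a suitable
    choice of [m + 4] parameters, where [F_w t], [F_u t] and [x_(n-2)] are
    shifted by multiples of [w], [u] and [z_0], the scroll is free over the
    polynomials in [v = u + z_0] and [w], with basis [z_0, ..., z_(m-1), 1], and
    two combinations of the quadrics have leading forms proportional to
    [(v + w)^2] and [(v - w)^2] for a filtration in which [v] and [w] have
    degree [m] and [z_j] has degree [m - j]. Characteristic zero makes the
    coefficients that occur invertible. Hence the [4 (m + 1)] elements
    [eps * (v + w)^a * (v - w)^b], with [eps] in that basis and [a], [b] at most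
    one, span the Rees algebra over the parameters ([rees_span]).

    They are also independent ([gS_free]). With [y = z_m] inverted, the quadrics
    are solved for two of the parameters, since their coefficients there are
    [- y] times nonzero constants. The solution is congruent to the identity
    modulo the quadrics, and it extends to a morphism from [R[t]] to a field
    that is the inclusion on the scroll. It therefore carries a dependence
    relation to a combination of the [4 (m + 1)] elements that lies, up to a
    power of [y], in the ideal of the quadrics of the scroll, and comparing
    leading forms ([gmon_reduced_free]) makes its coefficients zero.

    It remains that a ring [A] which is finite and free over a polynomial ring
    [P] over a field is Cohen-Macaulay ([free_over_mpoly_cohen_macaulay]). Let
    [q] be the contraction to [P] of a maximal ideal of [A]. The localization of
    [P] at [q] is regular, and a regular sequence generating its maximal ideal,
    of length [h] say, remains regular in [A] ([free_cohen_macaulay]); so the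
    depth is at least [h]. Conversely a regular sequence produces a chain of
    primes of the same length ([regular_seq_chain]), and a chain of primes in
    [A] contracts to one below [q] ([free_incomparable]), of length at most [h]:
    modulo [q] there are [dim P - h] algebraically independent elements, each
    step down the chain gains one ([alg_indep_proper]), and counting monomials
    bounds their number by [dim P] ([alg_indep_leq]). *)

Set Implicit Arguments.
Unset Strict Implicit.
Unset Printing Implicit Defensive.

Import GRing.Theory.

Local Open Scope ring_scope.

(** * Ideals and primes *)

Section Ideals.
Variable A : comNzRingType.
Implicit Types (I J P : {pred A}) (s : seq A).

(** Unlike [idealr_closed], this allows the unit ideal. *)
Definition is_ideal I : Prop :=
  [/\ 0 \in I, {in I &, forall x y, x + y \in I}
    & forall a x, x \in I -> a * x \in I].

Lemma is_ideal_gen G : is_ideal (@ideal_gen A G).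
Proof.
split; [exact: ideal_gen0 | exact: ideal_gen_add | exact: ideal_gen_mul].
Qed.

Lemma idealr_is_ideal I : idealr_closed I -> is_ideal I.
Proof.
move=> [I0 _ IL]; split=> // [x y xI yI|a x xI].
  by have := IL 1 x y xI yI; rewrite mul1r.
by have := IL a x 0 xI I0; rewrite addr0.
Qed.

Lemma is_ideal_idealr I : is_ideal I -> 1 \notin I -> idealr_closed I.
Proof. by move=> [I0 ID IM] I1; split=> // a x y xI yI; exact/ID/yI/IM. Qed.

Lemma ideal_sum I (T : Type) (r : seq T) (Q : pred T) (F : T -> A) :
  is_ideal I -> (forall t, Q t -> F t \in I) ->
  \sum_(t <- r | Q t) F t \in I.
Proof. by move=> [I0 ID _] FI; apply: (big_ind (fun x => x \in I)). Qed.

Lemma ideal_opp I x : is_ideal I -> x \in I -> - x \in I.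
Proof. by move=> [_ _ IM] xI; rewrite -mulN1r; exact: IM. Qed.

Lemma ideal_gen_min (G : {pred A}) I :
  is_ideal I -> {subset G <= I} -> {subset ideal_gen G <= I}.
Proof.
move=> Iid GI x /asboolP[s sG ->]; rewrite big_seq.
by apply: ideal_sum => // p /sG/GI pI; case: Iid => _ _; exact.
Qed.

Lemma ideal_gen_mono (G H : {pred A}) :
  {subset G <= H} -> {subset ideal_gen G <= ideal_gen H}.
Proof.
move=> GH; apply: ideal_gen_min; first exact: is_ideal_gen.
by move=> x /GH; exact: ideal_gen_sub.
Qed.

Lemma ideal_gen_seqP s x : reflect
  (exists c : nat -> A, x = \sum_(i < size s) c i * s`_i)
  (x \in ideal_gen [pred y in s]).
Proof.
apply: (iffP idP) => [|[c ->]]; last first.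
  apply: ideal_sum => [|i _]; first exact: is_ideal_gen.
  by apply/ideal_gen_mul/ideal_gen_sub; rewrite inE mem_nth.
suff: {subset ideal_gen [pred y in s] <=
    (fun x => `[< exists c : nat -> A, x = \sum_(i < size s) c i * s`_i >])}.
  by move=> h /h/asboolP.
apply: ideal_gen_min => [|y ys]; last first.
  apply/asboolP; exists (fun i => (i == index y s)%:R).
  have iy : (index y s < size s)%N by rewrite index_mem.
  rewrite (bigD1 (Ordinal iy)) //= eqxx mul1r nth_index // big1 ?addr0 //.
  by move=> i /eqP ne; case: eqP => [e|_]; rewrite ?mul0r //; case: ne; apply/val_inj.
split=> [|x1 x2 /asboolP[c1 ->] /asboolP[c2 ->]|a x1 /asboolP[c1 ->]]; apply/asboolP.
- by exists (fun=> 0); rewrite big1 // => i _; rewrite mul0r.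
- exists (fun i => c1 i + c2 i); rewrite -big_split.
  by apply: eq_bigr => i _; rewrite mulrDl.
- exists (fun i => a * c1 i); rewrite mulr_sumr.
  by apply: eq_bigr => i _; rewrite mulrA.
Qed.

Lemma prime_idealP P x y : is_prime_ideal P ->
  x * y \in P -> x \notin P -> y \in P.
Proof. by move=> [_ PM] /PM /orP[->|]. Qed.

Lemma prime_is_ideal P : is_prime_ideal P -> is_ideal P.
Proof. by case=> /idealr_is_ideal. Qed.

Lemma prime_notin1 P : is_prime_ideal P -> 1 \notin P.
Proof. by case=> -[]. Qed.

Lemma prime_notinM P x y : is_prime_ideal P ->
  x \notin P -> y \notin P -> x * y \notin P.
Proof. by move=> pP xP yP; apply: contra yP => /prime_idealP; exact. Qed.

Lemma prime_notinX P x n : is_prime_ideal P -> x \notin P -> x ^+ n \notin P.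
Proof.
move=> pP xP; elim: n => [|n IH]; first by rewrite expr0 prime_notin1.
by rewrite exprS prime_notinM.
Qed.

Lemma prime_notin_prod P (T : Type) (r : seq T) (F : T -> A) :
  is_prime_ideal P -> (forall t, F t \notin P) -> \prod_(t <- r) F t \notin P.
Proof.
move=> pP FP; elim/big_ind: _ => // [|x y]; first exact: prime_notin1.
exact: prime_notinM.
Qed.

End Ideals.

Lemma prime_preim (A B : comNzRingType) (f : {rmorphism A -> B}) (Q : {pred B}) :
  is_prime_ideal Q -> is_prime_ideal [pred a | f a \in Q].
Proof.
move=> pQ; have [Q0 QD QM] := prime_is_ideal pQ; split.
  apply: is_ideal_idealr; last by rewrite inE rmorph1 prime_notin1.
  by split=> [|x y|a x]; rewrite !inE ?rmorph0 ?rmorphD ?rmorphM //; [exact: QD | exact: QM].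
move=> x y; rewrite !inE rmorphM => xy.
by have [//|xQ] := boolP (f x \in Q); exact: prime_idealP xy xQ.
Qed.

Lemma ideal_gen_map (A B : comNzRingType) (f : {rmorphism A -> B}) s x :
  x \in ideal_gen [pred y in s] -> f x \in ideal_gen [pred y in map f s].
Proof.
move=> /ideal_gen_seqP[c ->]; rewrite rmorph_sum.
apply: ideal_sum => [|i _]; first exact: is_ideal_gen.
by rewrite rmorphM; apply/ideal_gen_mul/ideal_gen_sub; rewrite inE map_f ?mem_nth.
Qed.

(** * Noetherian rings *)

Section Noetherian.
Variable A : comNzRingType.
Hypothesis noethA : noetherian A.
Implicit Types (I P : {pred A}) (s : seq A).

Lemma noetherian_fg I : is_ideal I ->
  exists s, I =i ideal_gen [pred y in s].
Proof.
move=> idI; have [I1|I1] := boolP (1 \in I); last first.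
  by apply: noethA; exact: is_ideal_idealr.
exists [:: 1] => x; case: idI => _ _ IM.
rewrite -[x]mulr1 IM // ideal_gen_mul //.
by apply: ideal_gen_sub; rewrite !inE.
Qed.

Lemma ideal_gen_mkseq_mono (a : nat -> A) M N : (M <= N)%N ->
  {subset ideal_gen [pred y in mkseq a M] <= ideal_gen [pred y in mkseq a N]}.
Proof.
move=> MN; apply: ideal_gen_mono => x; rewrite !inE => /mapP[j].
rewrite mem_iota => /= jM ->; apply/mapP; exists j => //.
by rewrite mem_iota /=; apply: leq_trans MN.
Qed.

(** The union of the ideals generated by the initial segments is finitely
    generated, so these ideals stop growing. *)
Lemma noetherian_seq (a : nat -> A) :
  exists N, a N \in ideal_gen [pred y in mkseq a N].
Proof.
pose U : {pred A} := fun x => `[< exists N, x \in ideal_gen [pred y in mkseq a N] >].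
have idU : is_ideal U.
  split=> [|x y /asboolP[M xM] /asboolP[N yN]|b x /asboolP[M xM]]; apply/asboolP.
  - by exists 0%N; exact: ideal_gen0.
  - by exists (maxn M N); apply: ideal_gen_add;
      [move: xM | move: yN]; apply: ideal_gen_mkseq_mono; rewrite leq_max leqnn ?orbT.
  - by exists M; exact: ideal_gen_mul.
have [s sE] := noetherian_fg idU.
have [N sN] : exists N, {subset s <= ideal_gen [pred z in mkseq a N]}.
  have : {subset s <= U} by move=> y ys; rewrite sE; exact: ideal_gen_sub.
  elim: s {sE} => [|y s IH] sU; first by exists 0%N.
  have [|N tN] := IH; first by move=> z zs; apply: sU; rewrite inE zs orbT.
  have /asboolP[M yM] := sU y (mem_head _ _).
  exists (maxn M N) => z; rewrite inE => /orP[/eqP->|/tN];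
    [move: yM|]; apply: ideal_gen_mkseq_mono; rewrite leq_max leqnn ?orbT //.
exists N; have : a N \in U.
  apply/asboolP; exists N.+1; apply: ideal_gen_sub.
  by apply/mapP; exists N; rewrite // mem_iota /=.
by rewrite sE; apply: ideal_gen_min => [|y]; [exact: is_ideal_gen | exact: sN].
Qed.

(** An ideal that is maximal among those containing [I] and missing the
    multiplicative set [S] is prime. *)
Lemma prime_avoiding I (S : {pred A}) :
  is_ideal I -> 1 \in S -> {in S &, forall x y, x * y \in S} ->
  (forall x, x \in I -> x \notin S) ->
  exists P, [/\ is_prime_ideal P, {subset I <= P} & forall x, x \in P -> x \notin S].
Proof.
move=> idI S1 SM IS.
pose J s := ideal_gen [pred x | (x \in I) || (x \in s)].
have idJ s : is_ideal (J s) by exact: is_ideal_gen.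
have IJ s : {subset I <= J s} by move=> x xI; apply: ideal_gen_sub; rewrite inE xI.
pose good s := forall x, x \in J s -> x \notin S.
have Jcons s u x : x \in J (u :: s) -> exists2 i, i \in J s & exists c, x = i + c * u.
  pose K : {pred A} := fun x => `[< exists2 i, i \in J s & exists c, x = i + c * u >].
  have idK : is_ideal K.
    split=> [|y z|b y].
    - apply/asboolP; exists 0; first exact: ideal_gen0.
      by exists 0; rewrite mul0r addr0.
    - move=> /asboolP[i iJ [c ->]] /asboolP[i' iJ' [c' ->]].
      apply/asboolP; exists (i + i'); first exact: ideal_gen_add.
      by exists (c + c'); ring.
    - move=> /asboolP[i iJ [c ->]]; apply/asboolP; exists (b * i).
        exact: ideal_gen_mul.
      by exists (b * c); ring.
  suff : {subset J (u :: s) <= K} by move=> JK /JK/asboolP.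
  apply: ideal_gen_min => // y; rewrite inE => /orP[yI|].
    apply/asboolP; exists y; first exact: IJ.
    by exists 0; rewrite mul0r addr0.
  rewrite inE => /orP[/eqP->|ys]; apply/asboolP.
    by exists 0; [exact: ideal_gen0 | exists 1; rewrite mul1r add0r].
  exists y; last by exists 0; rewrite mul0r addr0.
  by apply: ideal_gen_sub; rewrite inE ys orbT.
have good0 : good [::].
  move=> x xJ; apply: IS; apply: ideal_gen_min xJ => // y.
  by rewrite inE orbF.
have [s gs smax] : exists2 s, good s & forall a, good (a :: s) -> a \in J s.
  apply: contrapT => nos.
  have nxtP s : good s -> exists a, good (a :: s) /\ a \notin J s.
    move=> gs; apply: contrapT => noa; apply: nos; exists s => // a ga.
    by have [//|aJ] := boolP (a \in J s); case: noa; exists a.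
  pose nxt s := if pselect (good s) is left gs then projT1 (cid (nxtP s gs)) else 0.
  have nxtE s : good s -> good (nxt s :: s) /\ nxt s \notin J s.
    by move=> gs; rewrite /nxt; case: pselect => // gs'; case: cid.
  pose L := fix L n := if n is n'.+1 then nxt (L n') :: L n' else [::].
  have gL n : good (L n) by elim: n => //= n /nxtE[].
  have [N hN] := noetherian_seq (fun n => nxt (L n)).
  have LE : forall i, (i < N)%N -> nxt (L i) \in L N.
    elim: N {hN} => // N IH i; rewrite ltnS leq_eqVlt => /orP[/eqP->|/IH iL] /=.
      exact: mem_head.
    by rewrite inE iL orbT.
  case: (nxtE _ (gL N)) => _ /negP; apply; move: hN.
  apply: ideal_gen_mono => y; rewrite inE => /mapP[i].
  by rewrite mem_iota /= => iN ->; rewrite inE LE ?orbT.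
exists (J s); split=> //; split=> [|x y xy].
  by apply: is_ideal_idealr => //; apply/negP => /gs; rewrite S1.
have bad u : u \notin J s -> exists2 z, z \in J (u :: s) & z \in S.
  move=> uJ; apply: contrapT => noz; have /negP := uJ; apply; apply: smax => z zJ.
  by apply/negP => zS; apply: noz; exists z.
apply: contrapT => /negP; rewrite negb_or => /andP[/bad[z zJ zS] /bad[z' zJ' zS']].
have [i iJ [c zE]] := Jcons _ _ _ zJ; have [i' iJ' [c' zE']] := Jcons _ _ _ zJ'.
have /gs/negP[] : z * z' \in J s; last exact: SM.
rewrite zE zE' (_ : _ * _ = (i' + c' * y) * i + (c * x * i' + c * c' * (x * y))); last by ring.
by apply: ideal_gen_add; last apply: ideal_gen_add; exact: ideal_gen_mul.
Qed.

(** A regular sequence can be followed by primes: going down from a prime over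
    [t_0, ..., t_i], a prime over [t_0, ..., t_(i-1)] that misses all [x t_i^j]
    with [x] outside the given prime is strictly smaller. *)
Lemma regular_seq_chain s : regular_seq s -> exists C : nat -> {pred A}, prime_chain (size s) C.
Proof.
move=> [reg prop].
suff chain k P : (k <= size s)%N -> is_prime_ideal P ->
    {subset ideal_gen [pred y in take k s] <= P} ->
    exists C : nat -> {pred A}, prime_chain k C /\ C k = P.
  have [||||P [pP sP _]] :=
    @prime_avoiding (ideal_gen [pred y in s]) (pred1 1).
  - exact: is_ideal_gen.
  - by rewrite inE.
  - by move=> x y; rewrite !inE => /eqP-> /eqP->; rewrite mulr1.
  - by move=> x xs; rewrite inE; apply: contra prop => /eqP<-.
  have [||C [CP _]] := chain (size s) P _ pP => //.
    by rewrite take_size.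
  by exists C.
elim: k P => [|k IH] P ks pP sP.
  by exists (fun=> P); split=> //; split=> // i _.
have idP := prime_is_ideal pP.
set t := s`_k.
have tP : t \in P.
  by apply/sP/ideal_gen_sub; rewrite inE (take_nth 0) // mem_rcons mem_head.
pose S : {pred A} := fun z => `[< exists x j, x \notin P /\ z = x * t ^+ j >].
have regt j x : x * t ^+ j \in ideal_gen [pred y in take k s] ->
    x \in ideal_gen [pred y in take k s].
  elim: j x => [|j IHj] x; first by rewrite expr0 mulr1.
  by rewrite exprS mulrA => /IHj; exact: reg.
have sPk : {subset ideal_gen [pred y in take k s] <= P}.
  move=> x xs; apply: sP; move: xs; apply: ideal_gen_mono => y.
  by rewrite !inE (take_nth 0) // mem_rcons inE => ->; rewrite orbT.
have [||||Q [pQ sQ QS]] := @prime_avoiding (ideal_gen [pred y in take k s]) S.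
- exact: is_ideal_gen.
- by apply/asboolP; exists 1, 0%N; rewrite mulr1 prime_notin1.
- move=> _ _ /asboolP[x [i [xP ->]]] /asboolP[y [j [yP ->]]].
  apply/asboolP; exists (x * y), (i + j)%N; split; first exact: prime_notinM.
  by rewrite exprD; ring.
- move=> z zs; apply/negP => /asboolP[x [j [xP xE]]].
  by case/negP: xP; apply/sPk/(regt j); rewrite -xE.
have QP : {subset Q <= P}.
  move=> x /QS xS; have [//|xP] := boolP (x \in P); case/negP: xS.
  by apply/asboolP; exists x, 0%N; rewrite mulr1.
have tQ : t \notin Q.
  apply: contraL (tP) => /QS/negP[]; apply/asboolP; exists 1, 1%N.
  by rewrite mul1r prime_notin1.
have [C [[Cp Cs] CQ]] := IH Q (ltnW ks) pQ sQ.
exists (fun i => if (i <= k)%N then C i else P); rewrite ltnn; split=> //.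
split=> i ik; first by case: ifP => // /Cp.
case: (ltngtP i k) ik => [ik _|ki|-> _]; first exact: Cs.
  by rewrite ltnS leqNgt ki.
by rewrite CQ; split=> //; exists t.
Qed.

End Noetherian.

(** The length of [s] is both the dimension and the depth, as each regular
    sequence gives a chain of primes of the same length. *)
Lemma local_cohen_macaulay_intro (L : comNzRingType) (M : {pred L}) (s : seq L) :
  noetherian L -> is_local M -> regular_seq s -> {subset s <= M} ->
  (forall e C, prime_chain e (C : nat -> {pred L}) -> (e <= size s)%N) ->
  local_cohen_macaulay L.
Proof.
move=> nL locM rs sM ub; split=> //; exists M; split=> //; exists (size s); last first.
  by split=> //; exact: regular_seq_chain.
split; first by exists s.
by move=> t /(regular_seq_chain nL)[C /ub].
Qed.

Lemma noetherian_surj (A B : comNzRingType) (f : {rmorphism A -> B}) :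
  noetherian A -> (forall b, exists a, f a = b) -> noetherian B.
Proof.
move=> nA fs I /idealr_is_ideal[I0 ID IM].
have [|s sE] := noetherian_fg nA (I := [pred a | f a \in I]).
  split=> [|x y|a x]; rewrite !inE ?rmorph0 ?rmorphD ?rmorphM //; [exact: ID | exact: IM].
exists (map f s) => b; have [a <-] := fs b; apply/idP/idP => [aI|].
  by apply: ideal_gen_map; rewrite -sE.
apply: ideal_gen_min => // y; rewrite inE => /mapP[x xs ->].
by have : x \in [pred a | f a \in I] by rewrite sE; exact: ideal_gen_sub.
Qed.

(** Hilbert's basis theorem. In an ideal that is not finitely generated, pick
    successively elements of least degree outside the ideal of the previous
    ones. A relation between their leading coefficients lowers a degree. *)
Lemma noetherian_poly (A : comNzRingType) : noetherian A -> noetherian {poly A}.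
Proof.
move=> nA I /idealr_is_ideal idI; apply: contrapT => nofg.
have nxtP (s : seq {poly A}) : exists f : {poly A}, {subset s <= I} ->
    [/\ f \in I, f \notin ideal_gen [pred y in s]
      & forall g, g \in I -> g \notin ideal_gen [pred y in s] -> (size f <= size g)%N].
  have [sI|nsI] := pselect {subset s <= I}; last by exists 0.
  have exn : exists n, `[< exists2 f : {poly A}, size f = n &
      f \in I /\ f \notin ideal_gen [pred y in s] >].
    apply: contrapT => non; apply: nofg; exists s => f; apply/idP/idP => [fI|].
      apply: contrapT => /negP fs; apply: non; exists (size f); apply/asboolP.
      by exists f.
    exact: ideal_gen_min.
  have [k /asboolP[f fk [fI fs]] kmin] := ex_minnP exn.
  by exists f => _; split=> // g gI gs; rewrite fk; apply: kmin; apply/asboolP; exists g.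
pose nxt s := projT1 (cid (nxtP s)).
pose L := fix L n := if n is n'.+1 then rcons (L n') (nxt (L n')) else [::].
pose f n := nxt (L n).
have LE n : L n = mkseq f n by elim: n => //= n IH; rewrite mkseqS -IH.
have LI n : {subset L n <= I}.
  elim: n => //= n IH g; rewrite mem_rcons inE => /orP[/eqP->|/IH//].
  by rewrite /nxt; case: cid => h /= /(_ IH)[].
have fP n : [/\ f n \in I, f n \notin ideal_gen [pred y in L n] & forall g,
    g \in I -> g \notin ideal_gen [pred y in L n] -> (size (f n) <= size g)%N].
  by rewrite /f /nxt; case: cid => h /= /(_ (@LI n)).
have [N /ideal_gen_seqP[c]] := noetherian_seq nA (fun n => lead_coef (f n)).
rewrite size_mkseq => cE.
have [fI fN fmin] := fP N.
have sf (i : 'I_N) : (size (f i) <= size (f N))%N.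
  have [_ _] := fP i; apply=> //; apply: contra fN; rewrite !LE.
  by apply: ideal_gen_mkseq_mono; exact: ltnW.
pose r := \sum_(i < N) (c i *: 'X^(size (f N) - size (f i))) * f i.
pose g := f N - r.
have fNi (i : 'I_N) : f i \in L N.
  by rewrite LE; apply/mapP; exists (val i); rewrite // mem_iota /=.
have rL : r \in ideal_gen [pred y in L N].
  apply: ideal_sum => [|i _]; first exact: is_ideal_gen.
  by apply/ideal_gen_mul/ideal_gen_sub; exact: fNi.
have gI : g \in I.
  case: (idI) => _ ID _; apply: ID => //; apply: ideal_opp => //.
  by move: rL; apply: ideal_gen_min => // y; exact: LI.
have gL : g \notin ideal_gen [pred y in L N].
  by apply: contra fN => gL; rewrite -[f N](subrK r) ideal_gen_add.
have := fmin g gI gL; rewrite leqNgt => /negP; apply.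
have fN0 : f N != 0 by apply: contra fN => /eqP->; exact: ideal_gen0.
have sN : (0 < size (f N))%N by rewrite size_poly_gt0.
rewrite -(prednK sN) ltnS; apply/leq_sizeP => j; rewrite leq_eqVlt => /orP[/eqP<-|jN].
  rewrite coefB -lead_coefE cE coef_sum.
  apply/eqP; rewrite subr_eq0; apply/eqP/eq_bigr => i _.
  rewrite nth_mkseq // -scalerAl coefZ coefXnM ltnNge.
  have [f0|f0] := eqVneq (f i) 0.
    by rewrite f0 lead_coef0 size_poly0 subn0 coef0 if_same !mulr0.
  have si : (0 < size (f i))%N by rewrite size_poly_gt0.
  have := sf i; rewrite lead_coefE => sfi.
  have -> : (size (f N) - size (f i) <= (size (f N)).-1)%N by lia.
  by congr (_ * _`_ _); lia.
have jN' : (size (f N) <= j)%N by rewrite -(prednK sN).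
rewrite coefB coef_sum nth_default // big1 ?subr0 // => i _.
rewrite -scalerAl coefZ coefXnM; have := sf i => sfi.
case: ifP => _; rewrite ?mulr0 // nth_default ?mulr0 //.
by rewrite leq_subRL ?subnK // (leq_trans (leq_subr _ _)).
Qed.

(** * Localization at a prime ideal *)

Section Localize.
Variables (A : comNzRingType) (m : prime_idealr A).
Local Notation L := (localization m).
Local Notation mP := (m : {pred A}).

Local Notation lpi := (\pi_(Localization.type m))%qT.

Definition locmap (a : A) : L := lpi (Localization.ofrac m a).

Lemma prime_idealr_prime : is_prime_ideal mP.
Proof.
split; last exact: prime_idealr_closed_subproof.
split; [exact: idealr0 | by rewrite idealr1 |].
by move=> a u v uI vI; rewrite rpredD ?idealMr.
Qed.

Lemma locmap_is_zmod_morphism : zmod_morphism locmap.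
Proof.
move=> a b; rewrite /locmap -[RHS]/(Localization.add (lpi (Localization.ofrac m a))
  (Localization.opp (lpi (Localization.ofrac m b)))).
rewrite -Localization.pi_opp -Localization.pi_add.
by apply: Localization.eq_pi => /=; ring.
Qed.
HB.instance Definition _ :=
  GRing.isZmodMorphism.Build A L locmap locmap_is_zmod_morphism.

Lemma locmap_is_monoid_morphism : monoid_morphism locmap.
Proof.
split=> [|a b]; first by rewrite /locmap -[RHS]/(Localization.embed m 1) piE.
rewrite /locmap -[RHS]/(Localization.mul (lpi (Localization.ofrac m a))
  (lpi (Localization.ofrac m b))) -Localization.pi_mul.
by apply: Localization.eq_pi => /=; ring.
Qed.
HB.instance Definition _ :=
  GRing.isMonoidMorphism.Build A L locmap locmap_is_monoid_morphism.

Lemma locmap_eq0 a : locmap a = 0 -> exists2 s, s \notin mP & s * a = 0.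
Proof.
rewrite -(rmorph0 locmap) => /eqP/Localization.eq_piP[s sm] /=.
by rewrite !mulr1 mulr0; exists s.
Qed.

Lemma locmap_unit s : s \notin mP -> exists t, t * locmap s = 1.
Proof.
move=> sm; pose x := @Localization.Ratio A m (1, s) sm; exists (lpi x).
rewrite -[LHS]/(Localization.mul (lpi x) (lpi (Localization.ofrac m s))).
rewrite -Localization.pi_mul -(rmorph1 locmap).
by apply: Localization.eq_pi => /=; ring.
Qed.

Lemma locmap_surj x : exists a s, s \notin mP /\ locmap s * x = locmap a.
Proof.
elim/quotW: x => [[[a s] sm]]; exists a, s; split=> //.
set x := Localization.Ratio sm.
rewrite -[LHS]/(Localization.mul (lpi (Localization.ofrac m s)) (lpi x)).
by rewrite -Localization.pi_mul; apply: Localization.eq_pi => /=; ring.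
Qed.

End Localize.

Section LocalRing.
Variables (A : comNzRingType) (m : prime_idealr A).
Local Notation L := (localization m).
Local Notation mP := (m : {pred A}).
Local Notation j := (locmap m).

Lemma noetherian_localization : noetherian A -> noetherian L.
Proof.
move=> nA J /idealr_is_ideal idJ; case: (idJ) => J0 JD JM.
have [|s sE] := noetherian_fg nA (I := [pred a | j a \in J]).
  split=> [|x y|a x]; rewrite !inE ?rmorph0 ?rmorphD ?rmorphM //; [exact: JD | exact: JM].
exists (map j s) => x; apply/idP/idP => [xJ|]; last first.
  apply: ideal_gen_min => // y; rewrite inE => /mapP[z zs ->].
  by have : z \in [pred a | j a \in J] by rewrite sE; exact: ideal_gen_sub.
have [a [u [um ux]]] := locmap_surj x; have [t tu] := locmap_unit um.
rewrite -[x]mul1r -tu -mulrA ux; apply/ideal_gen_mul/ideal_gen_map.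
by rewrite -sE inE -ux JM.
Qed.

Definition loc_ideal (I : {pred A}) : {pred L} := fun x =>
  `[< exists a s, [/\ a \in I, s \notin mP & j s * x = j a] >].

Lemma is_ideal_loc_ideal I : is_ideal I -> is_ideal (loc_ideal I).
Proof.
have pm := prime_idealr_prime m; move=> [I0 ID IM].
split=> [|x y|x y].
- apply/asboolP; exists 0, 1; rewrite prime_notin1 //.
  by split=> //; rewrite mulr0 rmorph0.
- move=> /asboolP[a [s [aI sm sx]]] /asboolP[b [t [bI tm ty]]]; apply/asboolP.
  exists (t * a + s * b), (s * t); split; [| exact: prime_notinM |].
    by apply: ID; exact: IM.
  by rewrite rmorphM rmorphD !rmorphM /= -sx -ty; ring.
- move=> /asboolP[a [s [aI sm sy]]]; apply/asboolP.
  have [b [t [tm tx]]] := locmap_surj x.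
  exists (b * a), (t * s); split; [exact: IM | exact: prime_notinM |].
  by rewrite !rmorphM /= -sy -tx; ring.
Qed.

Lemma loc_ideal_map (I : {pred A}) a : a \in I -> j a \in loc_ideal I.
Proof.
move=> aI; apply/asboolP; exists a, 1; split=> //; last by rewrite rmorph1 mul1r.
exact: prime_notin1 (prime_idealr_prime m).
Qed.

Lemma loc_ideal_contract (I : {pred A}) x : is_ideal I -> j x \in loc_ideal I ->
  exists2 s, s \notin mP & s * x \in I.
Proof.
move=> [_ _ IM] /asboolP[a [s [aI sm]]]; rewrite -rmorphM => /eqP.
rewrite -subr_eq0 -rmorphB => /eqP/locmap_eq0[u um].
rewrite mulrBr => /eqP; rewrite subr_eq0 mulrA => /eqP us.
by exists (u * s); rewrite ?us ?IM // prime_notinM //; exact: prime_idealr_prime.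
Qed.

Lemma loc_ideal_gen_contract (s : seq A) x :
  j x \in ideal_gen [pred y in map j s] ->
  exists2 v, v \notin mP & v * x \in ideal_gen [pred y in s].
Proof.
move=> xs; apply: loc_ideal_contract; first exact: is_ideal_gen.
move: xs; apply: ideal_gen_min => [|y].
  exact/is_ideal_loc_ideal/is_ideal_gen.
by rewrite inE => /mapP[z zs ->]; apply/loc_ideal_map/ideal_gen_sub.
Qed.

Definition loc_max : {pred L} := loc_ideal mP.

Lemma loc_max_unit x : x \notin loc_max -> exists t, t * x = 1.
Proof.
move=> /asboolP xm; have [a [s [sm sx]]] := locmap_surj x.
have am : a \notin mP by apply/negP => am; apply: xm; exists a, s.
by have [t ta] := locmap_unit am; exists (t * j s); rewrite -mulrA sx.
Qed.

Lemma loc_max_ideal : is_ideal loc_max.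
Proof. exact/is_ideal_loc_ideal/prime_is_ideal/prime_idealr_prime. Qed.

Lemma loc_max1 : 1 \notin loc_max.
Proof.
have pm := prime_idealr_prime m; apply/negP; rewrite -(rmorph1 j).
move=> /(loc_ideal_contract (prime_is_ideal pm))[s sm].
by rewrite mulr1; apply/negP.
Qed.

Lemma is_local_localization : is_local loc_max.
Proof.
have proper J : idealr_closed J -> {subset J <= loc_max}.
  move=> /[dup] Jcl /idealr_is_ideal[_ _ JM] x xJ.
  apply: contrapT => /negP /loc_max_unit[t tx].
  by case: Jcl => _ /negP + _; apply; rewrite -tx; exact: JM.
have maxcl : idealr_closed loc_max.
  by apply: is_ideal_idealr; [exact: loc_max_ideal | exact: loc_max1].
split; first by split=> // J Jcl _; exact: proper.
move=> J [Jcl Jmax] x; apply/idP/idP; first exact: proper.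
by apply: Jmax => //; exact: proper.
Qed.

(** Primes of the localization are determined by their contractions, which lie
    below [m]. *)
Lemma loc_prime_chain e (C : nat -> {pred L}) : prime_chain e C ->
  prime_chain e (fun i => [pred a | j a \in C i]) /\
  {subset [pred a | j a \in C e] <= mP}.
Proof.
move=> [Cp Cs]; split; last first.
  move=> a; rewrite inE => aC; apply: contrapT => /negP /locmap_unit[t ta].
  have pC := Cp e (leqnn e); case: (prime_is_ideal pC) => _ _ CM.
  by case/negP: (prime_notin1 pC); rewrite -ta CM.
split=> i ie; first exact/prime_preim/Cp.
have [CC [x xC xnC]] := Cs i ie; split=> [a|]; first exact: CC.
have [a [s [sm sx]]] := locmap_surj x; exists a; rewrite inE -sx.
  by case: (prime_is_ideal (Cp _ ie)) => _ _; apply.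
apply: contra xnC => sxC; have [t ts] := locmap_unit sm.
rewrite -[x]mul1r -ts -mulrA.
by case: (prime_is_ideal (Cp _ (ltnW ie))) => _ _; apply.
Qed.

End LocalRing.

(** * Finite free extensions of a ring with regular localizations *)

(** Regularity of [p] in the localization at [q], with denominators cleared. *)
Definition locally_regular (P : comNzRingType) (q : {pred P}) (p : seq P) :=
  forall i, (i < size p)%N -> forall x, x * p`_i \in ideal_gen [pred y in take i p] ->
  exists2 s, s \notin q & s * x \in ideal_gen [pred y in take i p].

Section FreeExtension.
Variables (P A : comNzRingType) (f : {rmorphism P -> A}) (N : nat) (g : 'I_N -> A).
Hypothesis gspan : forall a, exists c, a = \sum_l f (c l) * g l.
Hypothesis gfree : forall c, \sum_l f (c l) * g l = 0 -> forall l, c l = 0.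

(** Freeness lets the coordinates of a relation be read off one by one; this is
    how regular sequences are transported to [A]. *)
Lemma free_ideal_gen (s : seq P) c :
  \sum_l f (c l) * g l \in ideal_gen [pred y in map f s] ->
  forall l, c l \in ideal_gen [pred y in s].
Proof.
move=> /ideal_gen_seqP[b]; rewrite size_map => bE l.
have [d dE] : exists d, forall i, b i = \sum_l f (d i l) * g l.
  exists (fun i => projT1 (cid (gspan (b i)))) => i; by case: cid.
suff -> : c l = \sum_(i < size s) d i l * s`_i by apply/ideal_gen_seqP; exists (d^~ l).
apply/eqP; rewrite -subr_eq0; apply/eqP; move: l.
apply: (gfree (c := fun l => c l - _)).
under eq_bigr do rewrite rmorphB mulrBl.
rewrite sumrB bE; apply/eqP; rewrite subr_eq0; apply/eqP.
under [RHS]eq_bigr do rewrite rmorph_sum mulr_suml.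
rewrite exchange_big /=; apply: eq_bigr => i _.
rewrite (nth_map 0) // dE mulr_suml; apply: eq_bigr => l _.
by rewrite rmorphM; ring.
Qed.

(** Cayley-Hamilton for the multiplication by [z] on the free module [A]. *)
Lemma free_integral z : exists2 h : {poly P}, h \is monic & (map_poly f h).[z] = 0.
Proof.
have [c cE] : exists c, forall i, z * g i = \sum_l f (c i l) * g l.
  exists (fun i => projT1 (cid (gspan (z * g i)))) => i; by case: cid.
pose U := \matrix_(i, l) c i l.
exists (char_poly U); first exact: char_poly_monic.
have detE : (map_poly f (char_poly U)).[z] = \det (z%:M - map_mx f U).
  rewrite map_char_poly /char_poly -[LHS]/(horner_eval z _) -det_map_mx.
  congr (\det _); apply/matrixP => i l; rewrite !mxE.
  by rewrite rmorphB rmorphMn /= /horner_eval hornerX hornerC.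
pose G := \col_l g l.
have MG : (z%:M - map_mx f U) *m G = 0.
  rewrite mulmxBl mul_scalar_mx; apply/matrixP => i l; rewrite !mxE cE.
  by apply/eqP; rewrite subr_eq0; apply/eqP/eq_bigr => x _; rewrite !mxE.
have dG : \det (z%:M - map_mx f U) *: G = 0.
  by rewrite -mul_scalar_mx -mul_adj_mx -mulmxA MG mulmx0.
have [d dE] := gspan 1.
rewrite detE -[LHS]mulr1 dE mulr_sumr big1 // => l _.
have /matrixP/(_ l 0) := dG; rewrite !mxE => e.
by rewrite mulrCA e mulr0.
Qed.

(** Incomparability: if [z] lies in [Q] but not in [Q'], dividing its integral
    equation modulo [Q'] by a power of [z] makes the constant term an element
    of [Q] outside [Q']. *)
Lemma free_incomparable (Q' Q : {pred A}) :
  is_prime_ideal Q' -> is_prime_ideal Q -> proper_subset Q' Q ->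
  proper_subset [pred a | f a \in Q'] [pred a | f a \in Q].
Proof.
move=> pQ' pQ [Q'Q [z zQ zQ']]; split=> [a|]; first by rewrite !inE; exact: Q'Q.
apply: contrapT => noa.
have {}noa a : f a \in Q -> f a \in Q'.
  move=> aQ; apply: contrapT => /negP aQ'; apply: noa; by exists a.
have [h hm hz] := free_integral z.
have [Q0 QD QM] := prime_is_ideal pQ; have [Q'0 Q'D Q'M] := prime_is_ideal pQ'.
suff : forall n (h : {poly P}), size h = n.+1 -> h \is monic ->
    (map_poly f h).[z] \in Q' -> False.
  move=> /(_ (size h).-1 h); apply=> //; last by rewrite hz.
  by rewrite prednK // size_poly_gt0 monic_neq0.
elim=> [|n IH] {h hm hz} h sh hm hz.
  have h1 : h = 1.
    by have := monicP hm; rewrite lead_coefE sh => h0;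
      rewrite (size1_polyC (eq_leq sh)) h0.
  by case/negP: (prime_notin1 pQ'); move: hz; rewrite h1 rmorph1 hornerC.
have hE : h = (\poly_(i < n.+1) h`_i.+1) * 'X + (h`_0)%:P.
  apply/polyP => i; rewrite coefD coefMX coefC; case: i => [|i] /=.
    by rewrite add0r.
  rewrite addr0 coef_poly; case: ltnP => // ni; rewrite nth_default // sh; lia.
set h' := \poly_(i < _) _ in hE.
have sh' : size h' = n.+1.
  by rewrite size_poly_eq //; move: (monicP hm); rewrite lead_coefE sh /= => ->; rewrite oner_neq0.
have hE' : (map_poly f h).[z] = (map_poly f h').[z] * z + f h`_0.
  by rewrite {1}hE rmorphD rmorphM /= map_polyX map_polyC !hornerE.
have h0 : f h`_0 \in Q'.
  apply: noa; rewrite (_ : f _ = (map_poly f h).[z] - (map_poly f h').[z] * z); last by rewrite hE'; ring.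
  by apply: QD; [exact: Q'Q | apply: ideal_opp; [exact: prime_is_ideal | exact: QM]].
apply: (IH h' sh').
  by rewrite monicE lead_coefE sh' coef_poly ltnSn; move: (monicP hm); rewrite lead_coefE sh => ->.
apply: prime_idealP zQ' => //; rewrite mulrC.
rewrite (_ : _ * z = (map_poly f h).[z] - f h`_0); last by rewrite hE'; ring.
by apply: Q'D => //; apply: ideal_opp => //; exact: prime_is_ideal.
Qed.

(** Let [q] be the contraction of the maximal ideal [m]. The image in the
    localization at [m] of a regular sequence of [P] at [q] is regular because
    [A] is free over [P], and chains of primes below [m] contract, without
    losing length, to chains below [q]. *)
Lemma free_cohen_macaulay : noetherian A ->
  (forall q : {pred P}, is_prime_ideal q -> exists p : seq P,
    [/\ {subset p <= q}, locally_regular q p & forall e C,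
        prime_chain e C -> {subset C e <= q} -> (e <= size p)%N]) ->
  cohen_macaulay A.
Proof.
move=> nA regP; split=> // m _.
have pm := prime_idealr_prime m; have [m0 mD mM] := prime_is_ideal pm.
pose q : {pred P} := [pred a | f a \in (m : {pred A})].
have [p [pq preg pchain]] := regP q (prime_preim f pm).
pose M := @loc_max A m; pose s := map (locmap m) (map f p).
have sm : {subset s <= M}.
  by move=> _ /mapP[_ /mapP[a /pq aq ->] ->]; exact: loc_ideal_map.
apply: (@local_cohen_macaulay_intro _ M s) => //.
- exact: noetherian_localization.
- exact: is_local_localization.
- split; last first.
    apply: contra (loc_max1 m); apply: ideal_gen_min => //.
    exact: loc_max_ideal.
  move=> i; rewrite /s !size_map => ip x; rewrite -!map_take => xs.
  have [a [u [um ux]]] := locmap_surj x.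
  have [t tu] := locmap_unit um.
  have : locmap m (a * f p`_i) \in ideal_gen [pred y in map (locmap m) (map f (take i p))].
    rewrite rmorphM /= -ux -mulrA; apply: ideal_gen_mul.
    by move: xs; rewrite (nth_map 0) ?size_map // (nth_map 0).
  move=> /loc_ideal_gen_contract[v vm].
  have [c cE] := gspan (v * a).
  rewrite mulrA cE mulr_suml.
  under eq_bigr do rewrite mulrAC -rmorphM.
  move=> /free_ideal_gen cp.
  have {}cp l : exists t, t \notin q /\ t * c l \in ideal_gen [pred y in take i p].
    by have [w wq wc] := preg i ip (c l) (cp l); exists w.
  pose w l := projT1 (cid (cp l)); pose W := \prod_l w l.
  have wP l : w l \notin q /\ w l * c l \in ideal_gen [pred y in take i p].
    by rewrite /w; case: cid.
  have Wq : W \notin q.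
    by apply: prime_notin_prod => [|l]; [exact: prime_preim | have [] := wP l].
  have Wva : f W * (v * a) \in ideal_gen [pred y in map f (take i p)].
    rewrite cE mulr_sumr; apply: ideal_sum => [|l _]; first exact: is_ideal_gen.
    rewrite mulrA mulrC -rmorphM; apply/ideal_gen_mul/ideal_gen_map.
    rewrite /W (bigD1 l) //= mulrAC; rewrite mulrC; apply: ideal_gen_mul.
    by have [] := wP l.
  have Wvm : f W * v \notin (m : {pred A}) by exact: prime_notinM.
  have [t' tW] := locmap_unit Wvm.
  rewrite -[x]mul1r -tu -mulrA ux -[locmap m a]mul1r -tW -mulrA -rmorphM -mulrA.
  by do 2 apply: ideal_gen_mul; exact: ideal_gen_map.
- rewrite /s !size_map => e C /loc_prime_chain[[Cp Cs] Cm].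
  apply: (pchain e (fun i => [pred b | f b \in [pred a | locmap m a \in C i]])).
    split=> i ie; first exact/prime_preim/Cp.
    by apply: free_incomparable; [exact/Cp/ltnW | exact: Cp | exact: Cs].
  by move=> b; exact: Cm.
Qed.

End FreeExtension.

(** * Algebraic independence and chains of primes in polynomial rings *)

Section MpolyMorphisms.
Variable R : comNzRingType.

Lemma mpoly_rmorph_eq n (S : comNzRingType) (f g : {rmorphism {mpoly R[n]} -> S}) :
  (forall c, f c%:MP = g c%:MP) -> (forall i, f 'X_i = g 'X_i) -> f =1 g.
Proof.
move=> fgC fgX; apply: mpolyind => [|c m p _ _ IH]; first by rewrite !rmorph0.
rewrite !rmorphD IH -mul_mpolyC !rmorphM fgC mpolyXE_id !rmorph_prod.
by congr (_ * _ + _); apply: eq_bigr => i _; rewrite !rmorphXn fgX.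
Qed.

Local Notation widen := (widen_ord (leqnSn _)).

Lemma muniX_widen n (i : 'I_n) : muni 'X_(widen i) = ('X_i)%:P :> {poly {mpoly R[n]}}.
Proof.
rewrite muniE msuppX big_seq1 mcoeffX eqxx scale1r mnmE /=.
rewrite [X in 'X^X](_ : _ = 0%N); last first.
  by case: eqP => // /(congr1 val) /=; have := ltn_ord i; lia.
rewrite expr0 alg_polyC; congr ('X_[_])%:P; apply/mnmP => l; rewrite !mnmE.
by rewrite -val_eqE.
Qed.

Lemma muniX_max n : muni 'X_(@ord_max n) = 'X :> {poly {mpoly R[n]}}.
Proof.
rewrite muniE msuppX big_seq1 mcoeffX eqxx scale1r mnmE eqxx expr1.
rewrite [X in 'X_[X]](_ : _ = 0%MM) ?mpolyX0 ?scale1r //.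
apply/mnmP => l; rewrite !mnmE; case: eqP => // /(congr1 val) /=.
by have := ltn_ord l; lia.
Qed.

Lemma widen_or_max n (i : 'I_n.+1) : (exists l, i = widen l) \/ i = ord_max.
Proof.
have [li|] := ltnP i n; [left; exists (Ordinal li) | right]; apply/val_inj => //=.
by have := ltn_ord i; lia.
Qed.

(** [muni] and [of_muni] identify polynomials in [n + 1] variables with
    polynomials in the last variable over those in the first [n]. *)
Definition of_muni n (p : {poly {mpoly R[n]}}) : {mpoly R[n.+1]} :=
  (map_poly (@mwiden n R) p).['X_ord_max].

Lemma of_muni_is_zmod n : zmod_morphism (@of_muni n).
Proof. by move=> p q; rewrite /of_muni rmorphB hornerD hornerN. Qed.
HB.instance Definition _ n :=
  GRing.isZmodMorphism.Build _ _ (@of_muni n) (@of_muni_is_zmod n).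
Lemma of_muni_is_monoid n : monoid_morphism (@of_muni n).
Proof. by split=> [|p q]; rewrite /of_muni ?rmorph1 ?hornerC // rmorphM hornerM. Qed.
HB.instance Definition _ n :=
  GRing.isMonoidMorphism.Build _ _ (@of_muni n) (@of_muni_is_monoid n).

Lemma muniK n : cancel (@muni n R) (@of_muni n).
Proof.
apply: (mpoly_rmorph_eq (f := @of_muni n \o @muni n R) (g := idfun)) => [c|i] /=.
  by rewrite muniC /of_muni map_polyC /= hornerC mwidenC.
have [[l ->]|->] := widen_or_max i.
  rewrite muniX_widen /of_muni map_polyC /= hornerC mwidenX; congr 'X_[_].
  exact: mnmwiden1.
by rewrite muniX_max /of_muni map_polyX hornerX.
Qed.

Lemma of_muniK n : cancel (@of_muni n) (@muni n R).
Proof.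
have mw c : muni (mwiden c) = c%:P :> {poly {mpoly R[n]}}.
  move: c; apply: (mpoly_rmorph_eq (f := @muni n R \o @mwiden n R) (g := polyC)) => [c|i] /=.
    by rewrite mwidenC muniC.
  by rewrite mwidenX mnmwiden1 muniX_widen.
elim/poly_ind => [|p c IH]; first by rewrite !rmorph0.
rewrite 2!rmorphD 2!rmorphM /= IH /of_muni map_polyX map_polyC /= hornerX hornerC.
by rewrite muniX_max mw.
Qed.

Lemma mmap_muni n (S : comNzRingType) (j : {rmorphism R -> S}) (y : 'I_n.+1 -> S) F :
  mmap j y F = (map_poly (mmap j (y \o (fun i : 'I_n => widen i))) (muni F)).[y ord_max].
Proof.
pose h := mmap j (y \o (fun i : 'I_n => widen i)).
move: F; apply: (mpoly_rmorph_eq (f := mmap j y)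
  (g := horner_eval (y ord_max) \o map_poly h \o @muni n R)) => [c|i] /=.
  by rewrite mmapC muniC map_polyC /= /horner_eval hornerC /h mmapC.
rewrite mmapX mmap1U /horner_eval; have [[l ->]|->] := widen_or_max i.
  by rewrite muniX_widen map_polyC /= hornerC /h mmapX mmap1U.
by rewrite muniX_max map_polyX hornerX.
Qed.

End MpolyMorphisms.

Section AlgIndep.
Variables (k : fieldType) (B : comNzRingType) (j : {rmorphism k -> B}).

Definition alg_indep (q : {pred B}) t (y : 'I_t -> B) :=
  forall F : {mpoly k[t]}, mmap j y F \in q -> F = 0.

Definition snoc_ord (T : Type) t (y : 'I_t -> T) (z : T) : 'I_t.+1 -> T :=
  fun i => if unlift ord_max i is Some l then y l else z.

Lemma snoc_ord_widen (T : Type) t (y : 'I_t -> T) z l :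
  snoc_ord y z (widen_ord (leqnSn t) l) = y l.
Proof.
rewrite /snoc_ord (_ : widen_ord _ l = lift ord_max l) ?liftK //.
by apply/val_inj; rewrite /= /bump leqNgt ltn_ord.
Qed.

Lemma snoc_ord_max (T : Type) t (y : 'I_t -> T) z : snoc_ord y z ord_max = z.
Proof. by rewrite /snoc_ord unlift_none. Qed.

Lemma mmap_snoc t (y : 'I_t -> B) z F :
  mmap j (snoc_ord y z) F = (map_poly (mmap j y) (muni F)).[z].
Proof.
rewrite mmap_muni snoc_ord_max; congr (_.[_]).
apply/polyP => i; rewrite !coef_map_id0 ?mmap0 //.
by rewrite /mmap; apply: eq_bigr => m _; congr (_ * _); apply: mmap1_eq => l; rewrite /= snoc_ord_widen.
Qed.

(** Passing to a smaller prime gains an independent element: in a relation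
    [\sum_i c_i(y) z^i = 0] modulo [q'], divided by a power of [z], the
    coefficient [c_0(y)] lies in [q]. *)
Lemma alg_indep_proper (q' q : {pred B}) t (y : 'I_t -> B) :
  is_prime_ideal q' -> is_prime_ideal q -> proper_subset q' q ->
  alg_indep q y -> exists y' : 'I_t.+1 -> B, alg_indep q' y'.
Proof.
move=> pq' pq [q'q [z zq zq']] yind; exists (snoc_ord y z) => F.
have [q0 qD qM] := prime_is_ideal pq.
rewrite mmap_snoc => Fq; rewrite -[F]muniK (_ : muni F = 0) ?rmorph0 //.
move: (muni F) Fq; elim/poly_ind => // H c IH.
rewrite rmorphD rmorphM /= map_polyX map_polyC /= !hornerE => Hc.
have c0 : c = 0.
  apply: yind; rewrite -[mmap _ _ _](addKr ((map_poly (mmap j y) H).[z] * z)).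
  by apply: qD; [apply: ideal_opp; [exact: prime_is_ideal | exact: qM] | exact: q'q].
rewrite c0 addr0 IH ?mul0r //.
by move: Hc; rewrite c0 mmap0 addr0 mulrC => /prime_idealP; apply.
Qed.

Lemma alg_indep_chain (q : {pred B}) t (y : 'I_t -> B) e (C : nat -> {pred B}) :
  is_prime_ideal q -> alg_indep q y -> prime_chain e C -> {subset C e <= q} ->
  exists y' : 'I_(t + e) -> B, alg_indep (C 0%N) y'.
Proof.
move=> pq yind [Cp Cs] Cq.
suff : forall i, (i <= e)%N -> exists y' : 'I_(t + i) -> B, alg_indep (C (e - i)%N) y'.
  by move=> /(_ e (leqnn e)); rewrite subnn.
elim=> [_|i IH ie].
  by rewrite addn0 subn0; exists y => F FC; apply: yind; exact: Cq.
have [y' y'ind] := IH (ltnW ie); rewrite addnS.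
apply: alg_indep_proper y'ind; [exact/Cp/leq_subr | exact/Cp/leq_subr |].
by have := Cs (e - i.+1)%N; rewrite subnSK //; apply; lia.
Qed.

End AlgIndep.

(** Counting: were [t > d], the [N^t] products of the [y_i] with exponents below
    [N] would have degree [O(N)], hence live in a space of dimension [O(N^d)]. *)
Lemma alg_indep_leq (k : fieldType) d (q : {pred {mpoly k[d]}}) t
    (y : 'I_t -> {mpoly k[d]}) : 0 \in q ->
  alg_indep (@mpolyC d k) q y -> (t <= d)%N.
Proof.
move=> q0 yind; rewrite leqNgt; apply/negP => dt.
pose D := \max_(i < t) msize (y i).
pose N := ((t * D).+1 ^ d).+1.
pose b := (t * D * N).+1.
pose M (c : {ffun 'I_t -> 'I_N}) : {mpoly k[d]} := \prod_i y i ^+ c i.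
have size_prod (r : seq 'I_t) (c : {ffun 'I_t -> 'I_N}) :
    (msize (\prod_(i <- r) y i ^+ c i) <= (size r * D * N).+1)%N.
  have leM p p' a a' : (msize p <= a.+1)%N -> (msize p' <= a'.+1)%N ->
      (msize (p * p' : {mpoly k[d]}) <= (a + a').+1)%N.
    move=> pa pa'; have [->|p0] := eqVneq p 0; first by rewrite mul0r msize0.
    have [->|p'0] := eqVneq p' 0; first by rewrite mulr0 msize0.
    rewrite msizeM //; move: pa pa'.
    by move: (msize p) (msize p') => u v; lia.
  elim: r => [|i r IH]; first by rewrite big_nil msize1.
  rewrite big_cons /= mulSn mulnDl; apply: (leM) => //.
  have : (msize (y i ^+ c i) <= (c i * D).+1)%N.
    elim: (nat_of_ord (c i)) => [|n IHn]; first by rewrite expr0 msize1.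
    rewrite exprS mulSn; apply: (leM) => //; apply: leqW.
    by rewrite /D; apply: leq_bigmax.
  move=> /leq_trans; apply; rewrite ltnS mulnC leq_mul2l; apply/orP; right.
  exact/ltnW/ltn_ord.
have lebN : (b ^ d < N ^ t)%N.
  have -> : t = (t - d.+1 + d.+1)%N by rewrite subnK.
  rewrite expnD; apply: (@leq_trans (N ^ d.+1)); last first.
    by rewrite leq_pmull // expn_gt0.
  apply: (@leq_ltn_trans (((t * D).+1 * N) ^ d)).
    have le1 : (b <= (t * D).+1 * N)%N by rewrite /b mulSn -add1n leq_add2r.
    by elim: {+}d => // e IHe; rewrite !expnS leq_mul.
  by rewrite expnMn expnS ltn_pmul2r ?expn_gt0.
pose mo (e : {ffun 'I_d -> 'I_b}) := [multinom (e i : nat) | i < d].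
pose W := \matrix_(r < #|{ffun 'I_t -> 'I_N}|, c < #|{ffun 'I_d -> 'I_b}|)
  (M (enum_val r))@_(mo (enum_val c)).
have : (0 < \rank (kermx W))%N.
  rewrite mxrank_ker subn_gt0; apply: leq_ltn_trans (rank_leq_col W) _.
  by rewrite !card_ffun !card_ord.
rewrite lt0n mxrank_eq0 => /rowV0Pn[v /sub_kermxP vW v0].
pose F : {mpoly k[t]} :=
  \sum_r v 0 r *: 'X_[[multinom (enum_val r i : nat) | i < t]].
have mF : mmap (@mpolyC d k) y F = \sum_r v 0 r *: M (enum_val r).
  rewrite raddf_sum; apply: eq_bigr => r _; rewrite /= mmapZ mmapX mul_mpolyC.
  by congr (_ *: _); apply: eq_bigr => i _; rewrite mnmE.
have F0 : F = 0.
  apply: yind; rewrite mF (_ : \sum_r _ = 0) //.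
  apply/mpolyP => m; rewrite mcoeff0 raddf_sum /=.
  have [mb|nmb] := boolP [forall i, m i < b]%N.
    pose e : {ffun 'I_d -> 'I_b} := [ffun i => Ordinal (forallP mb i)].
    have -> : m = mo e by apply/mnmP => i; rewrite mnmE ffunE.
    have /matrixP/(_ 0 (enum_rank e)) := vW; rewrite !mxE => e0.
    rewrite -[RHS]e0; apply: eq_bigr => r _.
    by rewrite mcoeffZ mxE enum_rankK.
  rewrite big1 // => r _; rewrite mcoeffZ memN_msupp_eq0 ?mulr0 //.
  apply: msize_mdeg_ge; move: nmb; rewrite negb_forall => /existsP[i].
  rewrite -leqNgt => bi; apply: (@leq_trans b).
    by have := size_prod (enum 'I_t) (enum_val r); rewrite big_enum size_enum_ord.
  by apply: leq_trans bi _; rewrite mdegE (bigD1 i) //= leq_addr.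
case/eqP: v0; apply/rowP => r; rewrite mxE.
have := congr1 (mcoeff [multinom (enum_val r i : nat) | i < t]) F0.
rewrite mcoeff0 raddf_sum /= (bigD1 r) //= mcoeffZ mcoeffX eqxx mulr1.
rewrite big1 ?addr0 // => r' rr'; rewrite mcoeffZ mcoeffX.
case: eqP => [/mnmP er|]; last by rewrite mulr0.
case/eqP: rr'; apply: enum_val_inj; apply/ffunP => i; apply/val_inj => /=.
by have := er i; rewrite !mnmE.
Qed.

(** * Regular sequences at the primes of a polynomial ring *)

Section RegularAt.
Variables (k : fieldType) (B : comNzRingType) (j : {rmorphism k -> B}).

(** The localization of [B] at [q] has its maximal ideal generated by a regular
    sequence, and the length of that sequence complements to [d] the number of
    algebraically independent elements modulo [q]. The generation by the
    sequence is what makes the induction on the number of variables work. *)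
Definition regular_at d (q : {pred B}) : Prop :=
  exists p : seq B, [/\ {subset p <= q}, locally_regular q p,
    forall y, y \in q -> exists2 s, s \notin q & s * y \in ideal_gen [pred z in p]
    & exists e (y : 'I_e -> B), (size p + e = d)%N /\ alg_indep j q y].

End RegularAt.

Lemma regular_at_iso (k : fieldType) (B B' : comNzRingType) (j : {rmorphism k -> B})
    (j' : {rmorphism k -> B'}) (f : {rmorphism B -> B'}) (g : {rmorphism B' -> B}) :
  cancel f g -> cancel g f -> (forall c, f (j c) = j' c) ->
  forall d q, regular_at j d [pred b | f b \in q] -> regular_at j' d q.
Proof.
move=> fK gK fj d q [p [pq preg pgen [e [y [pe yind]]]]].
have genf (s : seq B) x : g x \in ideal_gen [pred z in s] -> x \in ideal_gen [pred z in map f s].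
  by move=> xs; rewrite -[x]gK; exact: ideal_gen_map.
exists (map f p); split.
- by move=> _ /mapP[b /pq bq ->].
- move=> i; rewrite size_map => ip x; rewrite (nth_map 0) // -map_take => xp.
  have [|s sq sx] := preg i ip (g x).
    have := ideal_gen_map g xp; rewrite -map_comp map_id_in => [|b _]; last exact: fK.
    by rewrite rmorphM /= fK.
  by exists (f s) => //; apply: genf; rewrite rmorphM /= fK.
- move=> x xq; have [|s sq sx] := pgen (g x); first by rewrite inE /= gK.
  by exists (f s) => //; apply: genf; rewrite rmorphM /= fK.
exists e, (f \o y); rewrite size_map; split=> // F Fq; apply: yind.
rewrite inE (_ : f _ = mmap j' (f \o y) F) //.
move: F {Fq}; apply: (mpoly_rmorph_eq (f := f \o mmap j y) (g := mmap j' (f \o y))) => [c|i] /=.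
  by rewrite !mmapC fj.
by rewrite !mmapX !mmap1U.
Qed.

Section PolyIdeals.
Variable B : comNzRingType.

Lemma poly_ideal_genP (s : seq B) (f : {poly B}) :
  f \in ideal_gen [pred y in map polyC s] <->
  forall n, f`_n \in ideal_gen [pred y in s].
Proof.
split=> [|fs]; last first.
  rewrite -[f]coefK poly_def; apply: ideal_sum => [|i _]; first exact: is_ideal_gen.
  by rewrite -mul_polyC mulrC; apply/ideal_gen_mul/ideal_gen_map.
pose K : {pred {poly B}} := fun f => `[< forall n, f`_n \in ideal_gen [pred y in s] >].
suff : {subset ideal_gen [pred y in map polyC s] <= K} by move=> h /h/asboolP.
apply: ideal_gen_min => [|y]; last first.
  rewrite inE => /mapP[b bs ->]; apply/asboolP => n; rewrite coefC.
  by case: ifP => _; [exact: ideal_gen_sub | exact: ideal_gen0].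
split=> [|x y /asboolP xK /asboolP yK|a x /asboolP xK]; apply/asboolP => n.
- by rewrite coef0 ideal_gen0.
- by rewrite coefD ideal_gen_add.
- rewrite coefM; apply: ideal_sum => [|i _]; first exact: is_ideal_gen.
  exact: ideal_gen_mul.
Qed.

Variables (r : {pred B}) (pr : is_prime_ideal r).

Lemma common_denominator (I : {pred B}) (f : {poly B}) : is_ideal I ->
  (forall n, exists2 s, s \notin r & s * f`_n \in I) ->
  exists2 s, s \notin r & forall n, s * f`_n \in I.
Proof.
move=> [I0 ID IM] fI; pose s n := projT1 (cid2 (fI n)).
have sr n : s n \notin r by rewrite /s; case: cid2.
have sI n : s n * f`_n \in I by rewrite /s; case: cid2.
exists (\prod_(i < size f) s i).
  exact: (prime_notin_prod _ pr (F := fun i : 'I_(size f) => s i)).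
move=> n; have [nf|nf] := ltnP n (size f); last by rewrite nth_default // mulr0.
by rewrite (bigD1 (Ordinal nf)) //= mulrAC mulrC IM.
Qed.

(** A descent on the size of [g]: the leading coefficient of [g] lies in [r]
    because that of [g * f] does, so the leading term can be dropped. *)
Lemma poly_prime_ext (f g : {poly B}) : lead_coef f \notin r ->
  (forall n, (g * f)`_n \in r) -> forall n, g`_n \in r.
Proof.
move=> lf; have [r0 rD rM] := prime_is_ideal pr.
have [m] := ubnP (size g); elim: m g => // m IH g gm gf.
have [->|g0] := eqVneq g 0; first by move=> n; rewrite coef0.
have lg : lead_coef g \in r.
  have := gf (size g + size f).-2; rewrite -mul_lead_coef.
  by rewrite mulrC => /(prime_idealP pr)/(_ lf).
pose g' := g - (lead_coef g)%:P * 'X^((size g).-1).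
have g'E n : g'`_n = if n == (size g).-1 then 0 else g`_n.
  rewrite coefB coefCM coefXn; case: eqP => [->|]; last by rewrite mulr0 subr0.
  by rewrite mulr1 lead_coefE subrr.
have sg : (0 < size g)%N by rewrite size_poly_gt0.
have sg' : (size g' < m)%N.
  rewrite -ltnS; apply: leq_trans gm; rewrite ltnS -(prednK sg) ltnS.
  apply/leq_sizeP => n; rewrite g'E leq_eqVlt eq_sym => /orP[->//|gn].
  by rewrite gtn_eqF // nth_default // -(prednK sg).
have {IH sg'} := IH g' sg' => IH n.
have := IH _ n; rewrite g'E; case: eqP => [-> _|_]; first by rewrite -lead_coefE.
apply=> i; rewrite mulrBl coefB; apply: rD => //; apply: ideal_opp; first exact: prime_is_ideal.
by rewrite -mulrA coefCM mulrC rM.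
Qed.

End PolyIdeals.

Section RegularPoly.
Variables (k : fieldType) (B : idomainType) (j : {rmorphism k -> B}) (d : nat).
Hypothesis regB : forall q : {pred B}, is_prime_ideal q -> regular_at j d q.

(** Let [r] be the contraction of [q] to [B]. If [q] is extended from [r], the
    sequence for [r] serves and ['X] is a new independent element. Otherwise [q]
    contains a polynomial [h] of least degree with leading coefficient outside
    [r]; pseudo-division by [h] shows that [h] completes the sequence. *)
Lemma regular_at_poly (q : {pred {poly B}}) : is_prime_ideal q ->
  regular_at (polyC \o j) d.+1 q.
Proof.
move=> pq; have [q0 qD qM] := prime_is_ideal pq.
pose r : {pred B} := [pred b | b%:P \in q].
have pr : is_prime_ideal r by exact: (prime_preim (@polyC B)).
have idr := prime_is_ideal pr; have [r0 rD rM] := idr.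
have rq (f : {poly B}) : (forall n, f`_n \in r) -> f \in q.
  move=> fr; rewrite -[f]coefK poly_def; apply: ideal_sum => // i _.
  by rewrite -mul_polyC mulrC; apply: qM; exact: fr.
have [p [pr' preg pgen [e [y [pe yind]]]]] := regB pr.
have psub : {subset ideal_gen [pred z in p] <= r}.
  by apply: ideal_gen_min => // z; rewrite inE; exact: pr'.
have pCq : {subset map polyC p <= q} by move=> _ /mapP[b /pr' br ->].
(* The sequence of [r] remains regular, and generates the extension of [r]. *)
have pCreg i x : (i < size p)%N ->
    x * (map polyC p)`_i \in ideal_gen [pred z in take i (map polyC p)] ->
    exists2 s, s \notin q & s * x \in ideal_gen [pred z in take i (map polyC p)].
  move=> ip; rewrite (nth_map 0) // -map_take => /poly_ideal_genP xp.
  have [|s sr sx] := @common_denominator _ r pr _ x (is_ideal_gen [pred z in take i p]).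
    by move=> n; apply: preg => //; have := xp n; rewrite coefMC.
  exists s%:P; first exact: sr.
  by apply/poly_ideal_genP => n; rewrite coefCM.
have pCgen (x : {poly B}) : (forall n, x`_n \in r) ->
    exists2 s, s \notin r & s%:P * x \in ideal_gen [pred z in map polyC p].
  move=> xr; have [|s sr sx] := @common_denominator _ r pr _ x (is_ideal_gen [pred z in p]).
    by move=> n; exact: pgen.
  by exists s => //; apply/poly_ideal_genP => n; rewrite coefCM.
have mmapC' t (y' : 'I_t -> B) F :
    mmap (polyC \o j) (fun i => (y' i)%:P) F = (mmap j y' F)%:P.
  rewrite /mmap rmorph_sum; apply: eq_bigr => m _; rewrite rmorphM rmorph_prod.
  by congr (_ * _); apply: eq_bigr => i _; rewrite rmorphXn.
have [qr|] := pselect (forall f, f \in q -> forall n, f`_n \in r).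
  exists (map polyC p); split=> //.
  - by move=> i; rewrite size_map => ip x; exact: pCreg.
  - by move=> f /qr/pCgen[s sr sf]; exists s%:P.
  exists e.+1, (snoc_ord (fun i => (y i)%:P) 'X); rewrite size_map addnS pe; split=> // F.
  rewrite mmap_snoc => /qr Fr; rewrite -[F]muniK (_ : muni F = 0) ?rmorph0 //.
  apply/polyP => n; rewrite coef0; apply: yind; move: (Fr n).
  rewrite (_ : _.['X] = map_poly (mmap j y) (muni F)) ?coef_map_id0 ?mmap0 //.
  rewrite -[RHS]comp_polyXr /comp_poly; congr (_.[_]).
  by apply/polyP => i; rewrite !coef_map_id0 ?mmap0 //=; exact: mmapC'.
move=> /existsNP[f /not_implyP[fq /existsNP[n /negP fn]]].
(* Terms with top coefficient in [r] can be dropped. *)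
have drop (g : {poly B}) i : g \in q -> g`_i \notin r ->
    exists g' : {poly B}, [/\ g' \in q, lead_coef g' \notin r & (size g' <= size g)%N].
  have [m] := ubnP (size g); elim: m g => // m IH g gm gq gi.
  have [lg|lg] := boolP (lead_coef g \in r); last by exists g.
  have g0 : g != 0 by apply: contraNneq gi => ->; rewrite coef0.
  pose g' := g - (lead_coef g)%:P * 'X^((size g).-1).
  have g'E l : g'`_l = if l == (size g).-1 then 0 else g`_l.
    rewrite coefB coefCM coefXn; case: eqP => [->|]; last by rewrite mulr0 subr0.
    by rewrite mulr1 lead_coefE subrr.
  have sg : (0 < size g)%N by rewrite size_poly_gt0.
  have sg' : (size g' < size g)%N.
    rewrite -(prednK sg) ltnS.
    apply/leq_sizeP => l; rewrite g'E leq_eqVlt eq_sym => /orP[->//|gn].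
    by rewrite gtn_eqF // nth_default // -(prednK sg).
  have sgm : (size g' < m)%N by apply: leq_trans sg' _; rewrite -ltnS.
  have [||h [hq hr hs]] := IH g' sgm.
  - apply: qD => //; apply: ideal_opp; first exact: prime_is_ideal.
    by rewrite mulrC qM.
  - by rewrite g'E; case: eqP gi => // ->; rewrite -lead_coefE lg.
  by exists h; split=> //; apply: leq_trans hs (ltnW sg').
have [h [hq hr hmin]] : exists h : {poly B}, [/\ h \in q, lead_coef h \notin r
    & forall g : {poly B}, g \in q -> (size g < size h)%N -> forall i, g`_i \in r].
  have exm : exists m, `[< exists h : {poly B}, [/\ h \in q, lead_coef h \notin r & size h = m] >].
    by have [g [gq gr _]] := drop _ _ fq fn; exists (size g); apply/asboolP; exists g.
  have [m /asboolP[h [hq hr hm]] mmin] := ex_minnP exm.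
  exists h; split=> // g gq gh i; apply: contrapT => /negP gi.
  have [g' [gq' gr' gs']] := drop _ _ gq gi.
  have /mmin : `[< exists h : {poly B}, [/\ h \in q, lead_coef h \notin r & size h = size g'] >].
    by apply/asboolP; exists g'.
  by rewrite -hm leqNgt (leq_ltn_trans gs' gh).
exists (rcons (map polyC p) h); split.
- by move=> z; rewrite mem_rcons inE => /orP[/eqP->|/pCq].
- move=> i; rewrite size_rcons size_map ltnS => ip x.
  rewrite nth_rcons size_map -cats1 takel_cat ?size_map //.
  case: ltngtP ip => // [ip _|-> _]; first exact: pCreg.
  rewrite -(size_map polyC) take_size => /poly_ideal_genP xh.
  have [|s sr sx] := pCgen x; last by exists s%:P.
  by apply: poly_prime_ext hr _ => // l; exact/psub.
- move=> z zq; pose R := (z %% h)%R.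
  have zE := Pdiv.WeakIdomain.divp_eq z h.
  have h0 : h != 0 by apply: contraNneq hr => ->; rewrite lead_coef0.
  have Rr : forall l, R`_l \in r.
    apply: hmin; last by rewrite Pdiv.CommonIdomain.ltn_modpN0.
    rewrite /R -[z %% h](addKr (z %/ h * h)) -zE; apply: qD.
      by apply: ideal_opp; [exact: prime_is_ideal | exact: qM].
    by rewrite -mul_polyC qM.
  have [s sr sR] := pCgen _ Rr.
  exists (s%:P * (lead_coef h ^+ scalp z h)%:P).
    by apply: prime_notinM => //; exact: (prime_notinX _ pr hr).
  rewrite -mulrA [_%:P * z]mul_polyC zE mulrDr; apply: ideal_gen_add.
    by rewrite mulrA; apply/ideal_gen_mul/ideal_gen_sub; rewrite inE mem_rcons mem_head.
  apply: ideal_gen_mono sR => l; rewrite !inE mem_rcons inE => ->.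
  by rewrite orbT.
- exists e, (fun i => (y i)%:P); rewrite size_rcons size_map addSn pe; split=> // F.
  by rewrite mmapC' => /yind.
Qed.

End RegularPoly.

(** The number of independent elements modulo [q] bounds the chains below [q]:
    each step down a chain adds one, and there are at most [d] in all. *)
Lemma regular_at_chain (k : fieldType) d (q : {pred {mpoly k[d]}}) :
  is_prime_ideal q -> regular_at (@mpolyC d k) d q ->
  exists p : seq {mpoly k[d]},
    [/\ {subset p <= q}, locally_regular q p & forall e C,
        prime_chain e C -> {subset C e <= q} -> (e <= size p)%N].
Proof.
move=> pq [p [pq' preg _ [e [y [pe yind]]]]]; exists p; split=> // l C chC Cq.
have [y' y'ind] := alg_indep_chain pq yind chC Cq.
have [C0 _ _] := prime_is_ideal (chC.1 0%N (leq0n _)).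
by rewrite -(leq_add2r e) pe addnC; exact: alg_indep_leq C0 y'ind.
Qed.

Lemma regular_at_mpoly (k : fieldType) d (q : {pred {mpoly k[d]}}) :
  is_prime_ideal q -> regular_at (@mpolyC d k) d q.
Proof.
elim: d q => [|d IH] q pq.
  have q0 F : F \in q -> F = 0.
    move=> Fq; have FE : F = (F@_0)%:MP.
      by apply/msize1_polyC; rewrite msizeE; apply/bigmax_leqP_seq => m _ _;
        rewrite mdegE big_ord0.
    apply/eqP; apply: contraT => F0; case: (prime_is_ideal pq) => _ _ qM.
    have F00 : F@_0 != 0 by apply: contraNneq F0 => e; rewrite FE e mpolyC0.
    case/negP: (prime_notin1 pq); rewrite (_ : 1 = ((F@_0)^-1)%:MP * F); first exact: qM.
    by rewrite {2}FE -mpolyCM mulVf.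
  exists [::]; split=> //.
    move=> F /q0->; exists 1; first exact: prime_notin1.
    by rewrite mulr0 ideal_gen0.
  exists 0%N, (fun i : 'I_0 => 0); split=> // F /q0.
  by rewrite (_ : mmap _ _ F = F) //; move: F;
    apply: (mpoly_rmorph_eq (f := mmap (@mpolyC 0 k) _) (g := idfun)) => [c|[]//]; rewrite /= mmapC.
apply: (@regular_at_iso k {poly {mpoly k[d]}} {mpoly k[d.+1]} (polyC \o @mpolyC d k) (@mpolyC d.+1 k)
  (@of_muni k d) (@muni d k) (@of_muniK k d) (@muniK k d)) => [c|].
  by rewrite /= /of_muni map_polyC /= hornerC mwidenC.
apply: (@regular_at_poly k {mpoly k[d]} (@mpolyC d k) d IH).
exact: (@prime_preim {poly {mpoly k[d]}} {mpoly k[d.+1]} (@of_muni k d) q pq).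
Qed.

Lemma noetherian_mpoly (R : comNzRingType) n : noetherian R -> noetherian {mpoly R[n]}.
Proof.
move=> nR; elim: n => [|n IH].
  apply: (noetherian_surj (f := @mpolyC 0 R)) => // F; exists F@_0.
  by apply/esym/msize1_polyC; rewrite msizeE; apply/bigmax_leqP_seq => m _ _;
    rewrite mdegE big_ord0.
apply: (@noetherian_surj {poly {mpoly R[n]}} {mpoly R[n.+1]} (@of_muni R n)
  (noetherian_poly IH)) => F.
by exists (muni F); exact: muniK.
Qed.

Lemma noetherian_field (k : fieldType) : noetherian k.
Proof.
move=> I [I0 I1 IL]; exists [::] => x; apply/idP/idP => [xI|].
  have [->|x0] := eqVneq x 0; first exact: ideal_gen0.
  by case/negP: I1; have := IL x^-1 x 0 xI I0; rewrite addr0 mulVf.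
by apply: ideal_gen_min => //; exact: idealr_is_ideal.
Qed.

(** Every localization of [{mpoly k[d]}] is regular, and it has enough
    independent elements modulo its prime to bound the chains. *)
Theorem free_over_mpoly_cohen_macaulay (k : fieldType) d (A : comNzRingType)
    (f : {rmorphism {mpoly k[d]} -> A}) N (g : 'I_N -> A) :
  (forall a, exists c, a = \sum_l f (c l) * g l) ->
  (forall c, \sum_l f (c l) * g l = 0 -> forall l, c l = 0) ->
  cohen_macaulay A.
Proof.
move=> gspan gfree; apply: (free_cohen_macaulay gspan gfree) => [|q pq]; last first.
  by apply: regular_at_chain => //; exact: regular_at_mpoly.
apply: (noetherian_surj (f := mmap f g)) => [|a].
  exact/noetherian_mpoly/noetherian_mpoly/noetherian_field.
have [c ->] := gspan a; exists (\sum_l (c l)%:MP * 'X_l).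
by rewrite rmorph_sum; apply: eq_bigr => l _; rewrite rmorphM /= mmapC mmapX mmap1U.
Qed.

(** * Modules spanned by a family *)

Section Span.
Variables (P C : comNzRingType) (f : {rmorphism P -> C}).

Inductive span (I : Type) (E : I -> C) (Q : I -> Prop) : C -> Prop :=
| Span0 : span E Q 0
| SpanD p i x : Q i -> span E Q x -> span E Q (f p * E i + x).

Section OneFamily.
Variables (I : Type) (E : I -> C) (Q : I -> Prop).

Lemma span_gen i : Q i -> span E Q (E i).
Proof.
by move=> Qi; rewrite -[E i]addr0 -[E i]mul1r -(rmorph1 f); do 2?constructor.
Qed.

Lemma spanDD x y : span E Q x -> span E Q y -> span E Q (x + y).
Proof.
by move=> + Sy; elim=> [|p i x' Qi _ IH]; rewrite ?add0r // -addrA; constructor.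
Qed.

Lemma spanZ p x : span E Q x -> span E Q (f p * x).
Proof.
elim=> [|p' i x' Qi _ IH]; first by rewrite mulr0; constructor.
by rewrite mulrDr mulrA -rmorphM; constructor.
Qed.

Lemma spanN x : span E Q x -> span E Q (- x).
Proof. by rewrite -mulN1r -(rmorph1 f) -rmorphN; exact: spanZ. Qed.

Lemma spanB x y : span E Q x -> span E Q y -> span E Q (x - y).
Proof. by move=> Sx Sy; apply: spanDD => //; exact: spanN. Qed.

Lemma span_sum (J : eqType) (r : seq J) (F : J -> C) :
  (forall j, j \in r -> span E Q (F j)) -> span E Q (\sum_(j <- r) F j).
Proof.
move=> FS; rewrite big_seq; elim/big_rec: _ => [|j x jr]; first by constructor.
by apply: spanDD; exact: FS.
Qed.

End OneFamily.

Lemma span_le (I J : Type) (E : I -> C) (Q : I -> Prop) (E' : J -> C) (Q' : J -> Prop) x :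
  (forall i, Q i -> span E' Q' (E i)) -> span E Q x -> span E' Q' x.
Proof.
move=> EE'; elim=> [|p i y Qi _ IH]; first by constructor.
by apply: spanDD => //; apply: spanZ; exact: EE'.
Qed.

Lemma span_mulr (I J : Type) (E : I -> C) (Q : I -> Prop) (E' : J -> C) (Q' : J -> Prop) x z :
  (forall i, Q i -> span E' Q' (z * E i)) -> span E Q x -> span E' Q' (z * x).
Proof.
move=> EE'; elim=> [|p i y Qi _ IH]; first by rewrite mulr0; constructor.
by rewrite mulrDr mulrCA; apply: spanDD => //; apply: spanZ; exact: EE'.
Qed.

Section ListFamily.
Variables (I : eqType) (s : seq I).
Hypothesis us : uniq s.

Lemma span_seqP (E : I -> C) x : span E (fun i => i \in s) x ->
  exists c : I -> P, x = \sum_(i <- s) f (c i) * E i.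
Proof.
elim=> [|p i y si _ [c ->]].
  by exists (fun=> 0); rewrite big1 // => i _; rewrite rmorph0 mul0r.
exists (fun l => (if l == i then p else 0) + c l).
under [RHS]eq_bigr do rewrite rmorphD mulrDl.
rewrite big_split /=; congr (_ + _).
rewrite (bigD1_seq i) //= eqxx big1 ?addr0 // => l /negbTE->.
by rewrite rmorph0 mul0r.
Qed.

Definition indep_seq (E : I -> C) : Prop := forall c : I -> P,
  \sum_(i <- s) f (c i) * E i = 0 -> forall i, i \in s -> c i = 0.

(** Two families indexed by the same finite set with the same span are
    independent together, because a one-sided inverse of a square matrix is an
    inverse. *)
Lemma indep_seq_span (E G : I -> C) : indep_seq E ->
  (forall i, i \in s -> span G (fun l => l \in s) (E i)) ->
  (forall i, i \in s -> span E (fun l => l \in s) (G i)) -> indep_seq G.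
Proof.
move=> Ei EG GE c cG i0 i0r.
have {}EG : exists V : I -> I -> P, forall i, i \in s -> E i = \sum_(l <- s) f (V i l) * G l.
  have h i : exists c : I -> P, i \in s -> E i = \sum_(l <- s) f (c l) * G l.
    by have [ir|ir] := boolP (i \in s); [have [d dE] := span_seqP (EG i ir); exists d | exists (fun=> 0)].
  by exists (fun i => projT1 (cid (h i))) => i; case: cid.
have {}GE : exists V : I -> I -> P, forall i, i \in s -> G i = \sum_(l <- s) f (V i l) * E l.
  have h i : exists c : I -> P, i \in s -> G i = \sum_(l <- s) f (c l) * E l.
    by have [ir|ir] := boolP (i \in s); [have [d dE] := span_seqP (GE i ir); exists d | exists (fun=> 0)].
  by exists (fun i => projT1 (cid (h i))) => i; case: cid.
have [V VE] := EG; have [U UE] := GE.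
pose N := size s; pose e (l : 'I_N) := nth i0 s l.
have er (l : 'I_N) : e l \in s by exact: mem_nth.
have sumr (S : nmodType) (F : I -> S) : \sum_(l <- s) F l = \sum_(l < N) F (e l).
  by rewrite (big_nth i0) big_mkord.
pose Vm := \matrix_(a < N, b < N) V (e a) (e b).
pose Um := \matrix_(a < N, b < N) U (e a) (e b).
have VU : Vm *m Um = 1%:M.
  apply/matrixP => a b; rewrite !mxE; under eq_bigr do rewrite !mxE.
  pose d l := (\sum_(x < N) V (e a) (e x) * U (e x) l) - (l == e a)%:R.
  have : d (e b) = 0.
    apply: Ei => //; rewrite /d; under eq_bigr do rewrite rmorphB mulrBl.
    rewrite sumrB [X in _ - X](bigD1_seq (e a)) //= eqxx rmorph1 mul1r.
    rewrite [X in _ - (_ + X)]big1 ?addr0 => [|l /negbTE->]; last by rewrite rmorph0 mul0r.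
    apply/eqP; rewrite subr_eq0; apply/eqP; rewrite [RHS]VE //.
    rewrite [RHS]sumr; under [LHS]eq_bigr do rewrite rmorph_sum mulr_suml.
    rewrite exchange_big /=; apply: eq_bigr => x _; rewrite [in RHS]UE // mulr_sumr.
    by apply: eq_bigr => l _; rewrite rmorphM mulrA.
  move=> /eqP; rewrite subr_eq0 => /eqP->.
  by rewrite /e nth_uniq // eq_sym.
have UV := mulmx1C VU.
pose cm := \row_(a < N) c (e a).
have cU : cm *m Um = 0.
  apply/rowP => b; rewrite !mxE; under eq_bigr do rewrite !mxE.
  apply: (Ei (fun l => \sum_(x < N) c (e x) * U (e x) l)) => //.
  under eq_bigr do rewrite rmorph_sum mulr_suml.
  rewrite exchange_big /= -[RHS]cG [RHS]sumr; apply: eq_bigr => x _.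
  rewrite [in RHS]UE // mulr_sumr; apply: eq_bigr => l _; by rewrite rmorphM mulrA.
have c0 : cm = 0 by rewrite -[cm]mulmx1 -UV mulmxA cU mul0mx.
have ii : (index i0 s < N)%N by rewrite index_mem.
by have /rowP/(_ (Ordinal ii)) := c0; rewrite !mxE /e /= nth_index.
Qed.

End ListFamily.
End Span.

(** * Algebras over the rational normal scroll *)

(** The relations below hold in the coordinate ring of the cone over the scroll
    given by the minors of the matrix with rows [u, z 1, ..., z m] and
    [w, z 0, ..., z (m - 1)], over the base [P], in which [z m = y]. It is a
    free module over the polynomials in [v] and [w], with basis
    [z 0, ..., z (m - 1), 1]. *)
Section Scroll.
Variables (P C : comNzRingType) (f : {rmorphism P -> C}) (m : nat) (y half : P).
Variables (u w : C) (z : nat -> C).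
Hypothesis half2 : half * 2%:R = 1.
Hypothesis zm : z m = f y.
Hypothesis uz : forall j, (j < m)%N -> u * z j = w * z j.+1.
Hypothesis zz : forall j l, (j + l <= m)%N -> z j * z l = z 0%N * z (j + l).
Hypothesis zzm : forall j l, (j <= m)%N -> (l <= m)%N -> (m <= j + l)%N ->
  z j * z l = f y * z (j + l - m).

Local Notation idx := (nat * nat * nat)%type.
Definition eps c : C := if (c < m)%N then z c else 1.
Let v := u + z 0%N.
Let a := v + w.
Let b := v - w.

Definition deg (t : idx) : nat := m * (t.1.2 + t.2) + (m - t.1.1).
Definition idx_le d (t : idx) : bool := (t.1.1 <= m)%N && (deg t <= d)%N.
Definition mon (t : idx) : C := eps t.1.1 * v ^+ t.1.2 * w ^+ t.2.

(** The grading-like filtration in which [v] and [w] have degree [m] and [z j]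
    has degree [m - j], the elements of [P] having degree [0]. *)
Definition fil d : C -> Prop := span f mon (idx_le d).

Lemma fil_mono d d' x : (d <= d')%N -> fil d x -> fil d' x.
Proof.
move=> dd'; apply: span_le => t /andP[tm td]; apply: span_gen.
by rewrite /idx_le tm (leq_trans td).
Qed.

Lemma fil_v d x : fil d x -> fil (d + m) (v * x).
Proof.
apply: span_mulr => -[[c al] be] /andP[/= tm td].
rewrite (_ : v * _ = mon (c, al.+1, be)); last by rewrite /mon /= exprS; ring.
by apply: span_gen; rewrite /idx_le tm /=; move: td; rewrite /deg /=; lia.
Qed.

Lemma fil_w d x : fil d x -> fil (d + m) (w * x).
Proof.
apply: span_mulr => -[[c al] be] /andP[/= tm td].
rewrite (_ : w * _ = mon (c, al, be.+1)); last by rewrite /mon /= exprS; ring.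
by apply: span_gen; rewrite /idx_le tm /=; move: td; rewrite /deg /=; lia.
Qed.

Lemma fil_eps c : (c <= m)%N -> fil (m - c) (eps c).
Proof.
move=> cm; rewrite (_ : eps c = mon (c, 0, 0)%N); last by rewrite /mon /= !expr0 !mulr1.
by apply: span_gen; rewrite /idx_le /deg /=; apply/andP; split; lia.
Qed.

Lemma fil1 d : fil d 1.
Proof.
by apply: (fil_mono (leq0n d)); have := fil_eps (leqnn m); rewrite /eps ltnn subnn.
Qed.

Lemma fil_z j : (j <= m)%N -> fil (m - j) (z j).
Proof.
move=> jm; have := fil_eps jm; rewrite /eps; case: ltnP => // mj _.
have -> : j = m by apply/eqP; rewrite eqn_leq jm.
by rewrite zm -[f y]mulr1; apply: spanZ; exact: fil1.
Qed.

(** The product [z 0 * z j] is not of the form [mon t]; it is rewritten through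
    [v = u + z 0] and [u * z j = w * z (j + 1)]. *)
Lemma fil_z0z j : (j < m)%N -> fil (m + m - j) (z 0%N * z j).
Proof.
move=> jm; rewrite (_ : z 0%N * z j = v * z j - w * z j.+1); last by rewrite -uz // /v; ring.
apply: spanB.
  by apply: fil_mono (fil_v (fil_z (ltnW jm))); lia.
by apply: fil_mono (fil_w (fil_z jm)); lia.
Qed.

Lemma fil_zz j l : (j < m)%N -> (l < m)%N -> fil (m + m - j - l) (z j * z l).
Proof.
move=> jm lm; have [mjl|jlm] := leqP m (j + l).
  rewrite zzm ?(ltnW jm) ?(ltnW lm) //; apply: spanZ.
  by apply: fil_mono (fil_z _); lia.
by rewrite zz ?(ltnW jlm) //; apply: fil_mono (fil_z0z jlm); lia.
Qed.

Lemma filM d d' x x' : fil d x -> fil d' x' -> fil (d + d') (x * x').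
Proof.
move=> xd x'd; rewrite mulrC; move: xd.
apply: span_mulr => -[[c al] be] /andP[/= cm td]; rewrite mulrC; move: x'd.
apply: span_mulr => -[[c' al'] be'] /andP[/= cm' td'].
pose e := eps c * eps c'.
have fe : fil (m + m - c - c') e.
  rewrite /e /eps; case: ltnP => cm1; case: ltnP => cm2.
  - exact: fil_zz.
  - by rewrite mulr1; apply: fil_mono (fil_z cm); lia.
  - by rewrite mul1r; apply: fil_mono (fil_z cm'); lia.
  - by rewrite mulr1; exact: fil1.
rewrite (_ : _ * _ = v ^+ (al + al') * (w ^+ (be + be') * e)); last first.
  by rewrite /mon /= !exprD /e; ring.
have fw n d0 x0 : fil d0 x0 -> fil (d0 + n * m) (w ^+ n * x0).
  elim: n => [|n IH] fx; first by rewrite expr0 mul1r addn0.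
  by rewrite exprS -mulrA mulSnr addnA; apply/fil_w/IH.
have fv n d0 x0 : fil d0 x0 -> fil (d0 + n * m) (v ^+ n * x0).
  elim: n => [|n IH] fx; first by rewrite expr0 mul1r addn0.
  by rewrite exprS -mulrA mulSnr addnA; apply/fil_v/IH.
apply: fil_mono (fv _ _ _ (fw _ _ _ fe)).
by move: td td'; rewrite /deg /=; lia.
Qed.

Lemma fil_scal p : fil 0 (f p).
Proof. by rewrite -[f p]mulr1; apply: spanZ; exact: fil1. Qed.

Lemma fil_vm : fil m v.
Proof. by rewrite -[v]mulr1 -[m]add0n; apply: fil_v; exact: fil1. Qed.

Lemma fil_wm : fil m w.
Proof. by rewrite -[w]mulr1 -[m]add0n; apply: fil_w; exact: fil1. Qed.

Lemma fil_um : fil m u.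
Proof.
rewrite (_ : u = v - z 0%N); last by rewrite /v; ring.
by apply: spanB; [exact: fil_vm | have := fil_z (leq0n m); rewrite subn0].
Qed.

Lemma fil_exp d x n : fil d x -> fil (n * d) (x ^+ n).
Proof.
move=> fx; elim: n => [|n IH]; first by rewrite expr0; exact: fil1.
by rewrite exprS mulSn; exact: filM.
Qed.

Hypothesis m_gt0 : (0 < m)%N.

(** The two quadrics cutting the Rees algebra out of the scroll: with [F_w] and
    [F_u] for the partial derivatives of the form, [m.+2] for its degree minus
    one and [t] for the Rees variable, they express [u * F_w * t] and
    [(m.+2 * u * F_u - w * F_w) * t] through the [z j]. The parameters [thw] and
    [thu] stand for [F_w * t - bet * w] and [F_u * t - 2 * u], and [X m] for the
    variable [x m] minus [gam * z 0]; these shifts give the combinations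
    [quadric_a] and [quadric_b] leading forms proportional to squares. *)
Section Quadrics.
Variables (gam : P) (X : nat -> P) (thw thu : P).

Definition bet : P := - (m.+2 * 2)%:R.

Definition quadric_w : C :=
  u * (f bet * w + f thw) + f bet * w * z 0%N
  - \sum_(1 <= l < m.+1) f (l%:R * X l) * z (m.+1 - l) - f (m%:R * gam) * z 0%N * z 1%N.

Definition quadric_u : C :=
  m.+2%:R * u * (2%:R * u + f thu) - w * (f bet * w + f thw)
  - \sum_(0 <= l < m.+1) f (((m.+2 * (m.+2 - l))%:R - l%:R) * X l) * z (m - l)
  - f bet * z 0%N ^+ 2.

Definition quadric_a : C := quadric_u - 2%:R * quadric_w.
Definition quadric_b : C := quadric_u + 2%:R * quadric_w.

Let S1 := \sum_(1 <= l < m.+1) f (l%:R * X l) * z (m.+1 - l).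
Let S2 := \sum_(0 <= l < m.+1) f (((m.+2 * (m.+2 - l))%:R - l%:R) * X l) * z (m - l).

Lemma fil_lin (p1 p2 p3 p4 : P) :
  fil (m + m).-1 (f p1 * u + f p2 * w + f p3 * S1 + f p4 * S2).
Proof.
apply: (@fil_mono m); first by lia.
have fz j : (j <= m)%N -> fil m (z j) by move=> jm; apply: fil_mono (fil_z jm); lia.
repeat apply: spanDD; apply: spanZ; [exact: fil_um | exact: fil_wm | |];
  apply: span_sum => l; rewrite mem_index_iota => lm; apply: spanZ; apply: fz; lia.
Qed.

Lemma fil_quad (p1 p2 : P) :
  fil (m + m).-1 (f p1 * (w * z 1%N) + f p2 * (z 0%N * z 1%N)).
Proof.
apply: spanDD; apply: spanZ.
  by apply: fil_mono (filM fil_wm (fil_z m_gt0)); lia.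
have [m1|m1] := ltnP 1 m; first by apply: fil_mono (fil_z0z m1); lia.
have -> : z 1%N = f y by rewrite -zm; congr z; lia.
rewrite mulrC; apply: spanZ; apply: fil_mono (fil_z (leq0n m)); lia.
Qed.

Let betE : m.+2%:R * 2%:R = - f bet.
Proof. by rewrite /bet rmorphN opprK rmorph_nat natrM. Qed.

(** The cross terms [u * z 0] of the square are of lower degree, as they equal
    [w * z 1]. *)
Lemma fil_quadric_a : fil (m + m).-1 (quadric_a - f (- bet) * a ^+ 2).
Proof.
have e := uz m_gt0.
rewrite /quadric_a /quadric_u /quadric_w -/S1 -/S2.
have := spanDD (fil_lin (m.+2%:R * thu - 2%:R * thw) (- thw) 2%:R (- 1))
  (fil_quad (2%:R * bet) (2%:R * (m%:R * gam))).
move: betE; move: bet => be beE.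
rewrite !(rmorphB, rmorphN, rmorphM, rmorph_nat, rmorph1) /=.
set x := _ + _; set x' := _ - _ => xF; suff -> : x' = x by [].
have -> : x = x + 2%:R * f be * (u * z 0%N - w * z 1%N)
    + (m.+2%:R * 2%:R + f be) * u ^+ 2.
  by rewrite e beE; ring.
rewrite /x /x' /a /v; ring.
Qed.

Lemma fil_quadric_b : fil (m + m).-1 (quadric_b - f (- bet) * b ^+ 2).
Proof.
have e := uz m_gt0.
rewrite /quadric_b /quadric_u /quadric_w -/S1 -/S2.
have := spanDD (fil_lin (m.+2%:R * thu + 2%:R * thw) (- thw) (- 2%:R) (- 1))
  (fil_quad (2%:R * bet) (- (2%:R * (m%:R * gam)))).
move: betE; move: bet => be beE.
rewrite !(rmorphB, rmorphD, rmorphN, rmorphM, rmorph_nat, rmorph1) /=.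
set x := _ + _; set x' := _ - _ => xF; suff -> : x' = x by [].
have -> : x = x + 2%:R * f be * (u * z 0%N - w * z 1%N)
    + (m.+2%:R * 2%:R + f be) * u ^+ 2.
  by rewrite e beE; ring.
rewrite /x /x' /b /v; ring.
Qed.

End Quadrics.

(** Two elements whose leading forms are multiples of [a ^+ 2] and [b ^+ 2]. *)
Variables (kap kapV : P) (M1 M2 : C).
Hypothesis kapK : kapV * kap = 1.
Hypothesis M1E : fil (m + m).-1 (M1 - f kap * a ^+ 2).
Hypothesis M2E : fil (m + m).-1 (M2 - f kap * b ^+ 2).

(** This basis is adapted to the ideal of [M1] and [M2]; the leading form of
    [gmon t] is a multiple of that of [eps c * a ^+ al * b ^+ be]. *)
Definition gmon (t : idx) : C :=
  eps t.1.1 * (M1 ^+ t.1.2./2 * a ^+ odd t.1.2) * (M2 ^+ t.2./2 * b ^+ odd t.2).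

Let fil_a : fil m a.
Proof. by apply: spanDD; [exact: fil_vm | exact: fil_wm]. Qed.
Let fil_b : fil m b.
Proof. by apply: spanB; [exact: fil_vm | exact: fil_wm]. Qed.

Lemma fil_M1 : fil (m + m) M1.
Proof.
rewrite -[M1](subrK (f kap * a ^+ 2)); apply: spanDD.
  by apply: fil_mono M1E; lia.
by apply: spanZ; rewrite expr2; exact: filM.
Qed.

Lemma fil_M2 : fil (m + m) M2.
Proof.
rewrite -[M2](subrK (f kap * b ^+ 2)); apply: spanDD.
  by apply: fil_mono M2E; lia.
by apply: spanZ; rewrite expr2; exact: filM.
Qed.

Lemma fil_gmon d t : idx_le d t -> fil d (gmon t).
Proof.
move: t => [[c al] be] /andP[/= cm td]; rewrite /gmon /=.
have h (n : nat) : (n = n./2.*2 + odd n)%N by have := odd_double_half n; lia.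
have hM M x n : fil (m + m) M -> fil m x -> fil (m * n) (M ^+ n./2 * x ^+ odd n).
  move=> fM fx; apply: fil_mono (filM (fil_exp n./2 fM) (fil_exp (odd n) fx)).
  by have := h n; lia.
apply: fil_mono (filM (filM (fil_eps cm) (hM _ _ al fil_M1 fil_a)) (hM _ _ be fil_M2 fil_b)).
by move: td; rewrite /deg /=; lia.
Qed.

Lemma span_gmon d x : fil d x -> span f gmon (idx_le d) x.
Proof.
have [n] := ubnP d; elim: n d x => // n IH d x dn.
pose G d := span f gmon (idx_le d).
have G_mono d1 d2 x0 : (d1 <= d2)%N -> G d1 x0 -> G d2 x0.
  move=> dd'; apply: span_le => t /andP[tm td]; apply: span_gen.
  by rewrite /idx_le tm (leq_trans td).
have GM1 d0 x0 : G d0 x0 -> G (d0 + m + m)%N (M1 * x0).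
  apply: span_mulr => -[[c al] be] /andP[/= tm td].
  rewrite (_ : _ * _ = gmon (c, al.+2, be)); last first.
    by rewrite /gmon /= negbK exprS; ring.
  by apply: span_gen; rewrite /idx_le tm /=; move: td; rewrite /deg /=; lia.
have GM2 d0 x0 : G d0 x0 -> G (d0 + m + m)%N (M2 * x0).
  apply: span_mulr => -[[c al] be] /andP[/= tm td].
  rewrite (_ : _ * _ = gmon (c, al, be.+2)); last first.
    by rewrite /gmon /= negbK exprS; ring.
  by apply: span_gen; rewrite /idx_le tm /=; move: td; rewrite /deg /=; lia.
(* A square of [a] or [b] is traded for [M1] or [M2] and lower degree. *)
have Gsq M c x0 : (forall d0 x0, G d0 x0 -> G (d0 + m + m)%N (M * x0)) ->
    fil (m + m).-1 (M - f kap * c ^+ 2) -> fil (d - m - m) x0 -> (m + m <= d)%N ->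
    G d (c ^+ 2 * x0).
  move=> GM ME fx md.
  have -> : c ^+ 2 * x0 = f kapV * (M * x0 - (M - f kap * c ^+ 2) * x0).
    have : f kapV * f kap = 1 by rewrite -rmorphM kapK rmorph1.
    by move=> e; rewrite -[LHS]mul1r -e; ring.
  apply: spanZ; apply: spanB.
    by apply: (@G_mono (d - m - m + m + m)%N); [lia | apply/GM/IH => //; lia].
  apply: (@G_mono d.-1); first by lia.
  by apply: IH; [lia | apply: fil_mono (filM ME fx); lia].
have Gab c al be : (c <= m)%N -> (m * (al + be) + (m - c) <= d)%N ->
    G d (eps c * a ^+ al * b ^+ be).
  move=> cm td.
  have fabx al' be' : fil (m * (al' + be') + (m - c)) (eps c * a ^+ al' * b ^+ be').
    by apply: fil_mono (filM (filM (fil_eps cm) (fil_exp al' fil_a)) (fil_exp be' fil_b)); lia.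
  case: al td => [|[|al]] td.
  - case: be td => [|[|be]] td.
    + rewrite (_ : _ * _ = gmon (c, 0, 0)%N); last by rewrite /gmon /= !expr0 !mul1r.
      by apply: span_gen; rewrite /idx_le cm.
    + rewrite (_ : _ * _ = gmon (c, 0, 1)%N); last by rewrite /gmon /= !expr0 !mul1r.
      by apply: span_gen; rewrite /idx_le cm.
    + rewrite (_ : _ * _ = b ^+ 2 * (eps c * a ^+ 0 * b ^+ be)); last by rewrite -addn2 exprD; ring.
      by apply: Gsq M2E _ _ => //; [apply: fil_mono (fabx _ _); lia | lia].
  - case: be td => [|[|be]] td.
    + rewrite (_ : _ * _ = gmon (c, 1, 0)%N); last by rewrite /gmon /= !expr0 !mul1r.
      by apply: span_gen; rewrite /idx_le cm.
    + rewrite (_ : _ * _ = gmon (c, 1, 1)%N); last by rewrite /gmon /= !expr0 !mul1r.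
      by apply: span_gen; rewrite /idx_le cm.
    + rewrite (_ : _ * _ = b ^+ 2 * (eps c * a ^+ 1 * b ^+ be)); last by rewrite -addn2 exprD; ring.
      by apply: Gsq M2E _ _ => //; [apply: fil_mono (fabx _ _); lia | lia].
  - rewrite (_ : _ * _ = a ^+ 2 * (eps c * a ^+ al * b ^+ be)); last by rewrite -addn2 exprD; ring.
    by apply: Gsq M1E _ _ => //; [apply: fil_mono (fabx _ _); lia | lia].
apply: span_le => -[[c al] be] /andP[/= cm td].
have {td} : (m * (al + be) + (m - c) <= d)%N by [].
rewrite /mon /= => td.
(* [v] and [w] are half the sum and half the difference of [a] and [b]. *)
have : forall i l, (m * (al + be + i + l) + (m - c) <= d)%N ->
    G d (eps c * a ^+ i * b ^+ l * v ^+ al * w ^+ be).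
  elim: al {td} => [|al IHal]; last first.
    move=> i l td; rewrite (_ : _ * _ = f half *
        (eps c * a ^+ i.+1 * b ^+ l * v ^+ al * w ^+ be +
         eps c * a ^+ i * b ^+ l.+1 * v ^+ al * w ^+ be)).
      by apply: spanZ; apply: spanDD; apply: IHal; lia.
    rewrite !exprS; have -> : a = v + w by []; have -> : b = v - w by [].
    have : f half * 2%:R = 1 by rewrite -[2%:R](rmorph_nat f) -rmorphM half2 rmorph1.
    by move=> e; rewrite -[LHS]mul1r -e; ring.
  elim: be => [|be IHbe] i l td.
    by rewrite !expr0 !mulr1; apply: Gab => //; lia.
  rewrite (_ : _ * _ = f half *
      (eps c * a ^+ i.+1 * b ^+ l * v ^+ 0 * w ^+ be -
       eps c * a ^+ i * b ^+ l.+1 * v ^+ 0 * w ^+ be)).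
    by apply: spanZ; apply: spanB; apply: IHbe; lia.
  rewrite !exprS; have -> : a = v + w by []; have -> : b = v - w by [].
  have : f half * 2%:R = 1 by rewrite -[2%:R](rmorph_nat f) -rmorphM half2 rmorph1.
  by move=> e; rewrite -[LHS]mul1r -e; ring.
by move=> /(_ 0%N 0%N); rewrite !expr0 !mulr1 !addn0; apply.
Qed.

Definition idx_list d : seq idx :=
  [seq t <- [seq (p, be) | p <- [seq (c, al) | c <- iota 0 m.+1, al <- iota 0 d.+1],
    be <- iota 0 d.+1] | idx_le d t].

Lemma idx_list_uniq d : uniq (idx_list d).
Proof.
apply/filter_uniq/allpairs_uniq; rewrite ?iota_uniq //; last by move=> [? ?] [? ?].
by apply: allpairs_uniq; rewrite ?iota_uniq // => -[? ?] [? ?].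
Qed.

Lemma mem_idx_list d t : (t \in idx_list d) = idx_le d t.
Proof.
rewrite mem_filter andb_idr // => /andP[]; case: t => [[c al] be] cm td; rewrite /= in cm.
apply/allpairsP; exists ((c, al), be); split=> //.
  by apply/allpairsP; exists (c, al); split=> //; rewrite mem_iota /=;
    move: td; rewrite /deg /=; nia.
by rewrite mem_iota /=; move: td; rewrite /deg /=; nia.
Qed.

(** Modulo [M1] and [M2] the remaining [gmon t] are those of degree at most one
    in [a] and in [b]. *)
Definition reduced (t : idx) : bool := [&& t.1.1 <= m, t.1.2 < 2 & t.2 < 2]%N.

Definition reduced_list : seq idx := [seq t <- idx_list (m + m + m) | reduced t].

Lemma reduced_list_uniq : uniq reduced_list.
Proof. exact/filter_uniq/idx_list_uniq. Qed.

Lemma mem_reduced_list t : (t \in reduced_list) = reduced t.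
Proof.
rewrite mem_filter andb_idr // mem_idx_list /idx_le => /and3P[-> a2 b2].
by rewrite /deg; nia.
Qed.

Lemma gmon_reduced t : reduced t ->
  gmon t = eps t.1.1 * a ^+ t.1.2 * b ^+ t.2.
Proof.
case: t => [[c al] be] /and3P[/= _]; rewrite /gmon /=.
by case: al => [|[|//]]; case: be => [|[|//]] _ _ /=; rewrite !mul1r.
Qed.

(** Every element of the ideal of [M1] and [M2] is a combination of the [gmon t]
    with [t] not reduced, and the [gmon t] of bounded degree are independent,
    having the same span as the independent elements [mon t]. *)
Lemma gmon_reduced_free :
  (forall d s, uniq s -> {in s, forall t, idx_le d t} -> indep_seq f s mon) ->
  forall (r : seq idx) (c : idx -> P) d x x', {in r, forall t, reduced t} -> uniq r ->
  fil d x -> fil d x' -> \sum_(t <- r) f (c t) * gmon t = M1 * x + M2 * x' ->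
  forall t, t \in r -> c t = 0.
Proof.
move=> mfree r c d x x' red_r ur fx fx' rE.
pose D := (d + m + m + m)%N; pose s := idx_list D.
have gfree : indep_seq f s gmon.
  have memP t : (t \in s) <-> idx_le D t by rewrite mem_idx_list.
  have sub (E : idx -> C) x0 : span f E (idx_le D) x0 -> span f E (fun t => t \in s) x0.
    by apply: span_le => t /memP ts; exact: span_gen.
  apply: (indep_seq_span (idx_list_uniq D)) (mfree D _ (idx_list_uniq D) _) _ _.
  - by move=> t /memP.
  - by move=> t /memP ts; apply: sub; apply: span_gmon; exact: span_gen.
  - by move=> t /memP ts; apply: sub; exact: fil_gmon.
pose s' := [seq t <- s | ~~ reduced t].
have [c' c'E] : exists c', M1 * x + M2 * x' = \sum_(t <- s') f (c' t) * gmon t.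
  apply: span_seqP; first exact/filter_uniq/idx_list_uniq.
  apply: spanDD; [move: (span_gmon fx) | move: (span_gmon fx')];
    apply: span_mulr => -[[c1 al] be] /andP[/= tm td].
    rewrite (_ : _ * _ = gmon (c1, al.+2, be)); last by rewrite /gmon /= negbK exprS; ring.
    apply: span_gen; rewrite mem_filter mem_idx_list /reduced /idx_le /= tm andbF /=.
    by move: td; rewrite /deg /=; lia.
  rewrite (_ : _ * _ = gmon (c1, al, be.+2)); last by rewrite /gmon /= negbK exprS; ring.
  apply: span_gen; rewrite mem_filter mem_idx_list /reduced /idx_le /= tm !andbF /=.
  by move: td; rewrite /deg /=; lia.
have rs t : t \in r -> t \in s.
  move=> /red_r; rewrite mem_idx_list /idx_le; case: t => [[c1 al] be] /and3P[/= -> a2 b2].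
  by rewrite /deg /= /D; nia.
pose e t := (if t \in r then c t else 0) - (if ~~ reduced t then c' t else 0).
have e0 : forall t, t \in s -> e t = 0.
  apply: gfree; rewrite /e; under eq_bigr do rewrite rmorphB mulrBl.
  rewrite sumrB; apply/eqP; rewrite subr_eq0; apply/eqP.
  transitivity (\sum_(t <- r) f (c t) * gmon t).
    rewrite (bigID (mem r)) /= [X in _ + X]big1 ?addr0 => [|t /negbTE->]; last first.
      by rewrite rmorph0 mul0r.
    rewrite -big_filter; under eq_big_seq => t.
      rewrite mem_filter => /andP[-> _]; over.
    apply: perm_big; apply: uniq_perm => //; first exact/filter_uniq/idx_list_uniq.
    move=> t.
    by rewrite mem_filter; apply/andP/idP => [[]//|tr]; split=> //; exact: rs.
  rewrite rE c'E big_filter [RHS](bigID (fun t => ~~ reduced t)) /= [X in _ = _ + X]big1 ?addr0.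
    by apply: eq_bigr => t ->.
  by move=> t; rewrite negbK => ->; rewrite rmorph0 mul0r.
move=> t tr; have := e0 t (rs t tr); rewrite /e tr red_r //= subr0.
by [].
Qed.

End Scroll.

(** * The scroll inside a polynomial ring *)

Section ScrollInPoly.
Variables (P : idomainType) (m : nat) (y : P).
Local Notation BB := {poly {poly P}}.

Definition constBB : P -> BB := polyC \o polyC.
HB.instance Definition _ := GRing.RMorphism.on constBB.

(** With [s] for the slope [w / u], the variables are [v = u + y s^m] and [s]. *)
Definition uB : BB := ('X)%:P - constBB y * 'X^m.
Definition wB : BB := uB * 'X.
Definition zB (j : nat) : BB := constBB y * 'X^(m - j).

Lemma zB_m : zB m = constBB y.
Proof. by rewrite /zB subnn expr0 mulr1. Qed.

Lemma zB_u j : (j < m)%N -> uB * zB j = wB * zB j.+1.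
Proof. by move=> jm; rewrite /wB /zB -(subnSK jm) exprS; ring. Qed.

Lemma zB_zz j l : (j + l <= m)%N -> zB j * zB l = zB 0 * zB (j + l).
Proof.
move=> jl; rewrite /zB mulrACA -exprD [RHS]mulrACA -exprD; congr (_ * 'X^_); lia.
Qed.

Lemma zB_zzm j l : (j <= m)%N -> (l <= m)%N -> (m <= j + l)%N ->
  zB j * zB l = constBB y * zB (j + l - m).
Proof.
move=> jm lm jl; rewrite /zB mulrACA -exprD -mulrA; congr (_ * (_ * 'X^_)); lia.
Qed.

Hypotheses (m_gt0 : (0 < m)%N) (y0 : y != 0).

Local Notation mono := (mon m uB wB zB).

Lemma monoE c al be : mono (c, al, be) = eps m zB c * ('X^al)%:P * wB ^+ be.
Proof.
rewrite /mon /= (_ : uB + zB 0 = 'X%:P) ?rmorphXn //.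
by rewrite /uB /zB subn0 subrK.
Qed.

Lemma uB_lead : size uB = m.+1 /\ lead_coef uB = (- y)%:P.
Proof.
have -> : uB = - (y%:P *: 'X^m) + ('X)%:P by rewrite addrC -mul_polyC.
have yX0 : y%:P != 0 :> {poly P} by rewrite polyC_eq0.
have sX : size (- (y%:P *: 'X^m) : BB) = m.+1.
  by rewrite size_polyN size_scale // size_polyXn.
have lt : (size (('X)%:P : BB) < size (- (y%:P *: 'X^m) : BB))%N.
  by rewrite sX size_polyC polyX_eq0.
split; first by rewrite size_polyDl.
by rewrite lead_coefDl // lead_coefN lead_coefZ lead_coefXn mulr1 polyCN.
Qed.

Lemma wB_lead : size wB = m.+2 /\ lead_coef wB = (- y)%:P.
Proof.
have [su lu] := uB_lead; rewrite /wB lead_coefMX lu size_mulX ?su //.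
by rewrite -size_poly_gt0 su.
Qed.

Lemma eps_w_lead c be : (c <= m)%N ->
  exists2 l : P, l != 0 & let g := eps m zB c * wB ^+ be in
    size g = (m.+1 * be + (m - c)).+1 /\ lead_coef g = l%:P.
Proof.
move=> cm; have [sw lw] := wB_lead.
have w0 : wB != 0 by rewrite -size_poly_gt0 sw.
have [e e0 [se le]] : exists2 e : P, e != 0 &
    size (eps m zB c) = (m - c).+1 /\ lead_coef (eps m zB c) = e%:P.
  rewrite /eps; case: ltnP => [cm'|mc].
    exists y => //; rewrite /zB mul_polyC size_scale ?polyC_eq0 // size_polyXn.
    by rewrite lead_coefZ lead_coefXn mulr1.
  exists 1; first exact: oner_neq0.
  by rewrite size_poly1 lead_coef1 (_ : (m - c)%N = 0%N) //; lia.
exists (e * (- y) ^+ be); first by rewrite mulf_neq0 // expf_neq0 // oppr_eq0.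
have eps0 : eps m zB c != 0 by rewrite -size_poly_gt0 se.
split; last by rewrite lead_coefM lead_coef_exp le lw polyCM polyC_exp.
have sz : size (eps m zB c * wB ^+ be) = (size (eps m zB c) + size (wB ^+ be)).-1.
  by apply: size_mul => //; exact: expf_neq0.
have := size_exp wB be; rewrite /= sz se sw /=.
have : (0 < size (wB ^+ be))%N by rewrite size_poly_gt0 expf_neq0.
by move: (size (wB ^+ be)) => x; lia.
Qed.

(** The elements [eps c * w ^+ be] have distinct degrees in [s]. *)
Lemma mono_indep (s : seq (nat * nat * nat)) d :
  uniq s -> {in s, forall t, idx_le m d t} -> indep_seq constBB s mono.
Proof.
move=> us sd c c0 i0 i0s; apply: contrapT => /eqP ci0.
pose D (t : nat * nat * nat) := (m.+1 * t.2 + (m - t.1.1))%N.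
pose N0 := \max_(t <- s) D t.
have exn : exists n, has (fun t => (c t != 0) && (D t == n)) s.
  by exists (D i0); apply/hasP; exists i0 => //; rewrite ci0 eqxx.
have bound n : has (fun t => (c t != 0) && (D t == n)) s -> (n <= N0)%N.
  by move=> /hasP[t ts /andP[_ /eqP<-]]; exact: leq_bigmax_seq.
have [n /hasP[t ts /andP[ct /eqP tn]] nmax] := ex_maxnP exn bound.
have := congr1 (fun p : BB => p`_n`_t.1.2) c0; rewrite !coef0 !coef_sum.
have cE t' : (mono t')`_n = 'X^(t'.1.2) * (eps m zB t'.1.1 * wB ^+ t'.2)`_n.
  by case: t' => [[c' al] be]; rewrite monoE mulrAC mulrC coefCM.
have lead t' : t' \in s -> exists2 l : P, l != 0 &
    (eps m zB t'.1.1 * wB ^+ t'.2)`_(D t') = l%:P /\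
    forall i, (D t' < i)%N -> (eps m zB t'.1.1 * wB ^+ t'.2)`_i = 0.
  move=> ts'; have [l l0 [sz ld]] := eps_w_lead t'.2 (andP (sd t' ts')).1.
  exists l => //; split=> [|i Di]; last by rewrite nth_default // sz.
  by rewrite -ld lead_coefE sz.
have [l l0 [lE _]] := lead t ts.
rewrite (bigD1_seq t) //= big1_seq => [|t' /andP[t't ts']].
  rewrite addr0 coefCM cE -tn lE coefCM coefMC coefXn eqxx mul1r => /eqP.
  by rewrite mulf_eq0 (negbTE ct) (negbTE l0).
have [->|ct'] := eqVneq (c t') 0; first by rewrite rmorph0 mul0r !coef0.
have : (D t' <= n)%N by apply: nmax; apply/hasP; exists t' => //; rewrite ct' eqxx.
have [l' l'0 [lE' lt']] := lead t' ts'; rewrite coefCM cE leq_eqVlt => /orP[/eqP tn'|tn'].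
  rewrite -tn' lE' coefCM coefMC coefXn; case: eqP => [te|]; last by rewrite mul0r mulr0.
  case/eqP: t't; move: tn' te; rewrite -tn /D.
  have := (andP (sd t' ts')).1; have := (andP (sd t ts)).1.
  case: t t' {ts ts' ct ct' tn lE lE' lt'} => [[c1 a1] b1] [[c2 a2] b2] /= cm1 cm2 De ->.
  have eb : b2 = b1 by move: De; nia.
  by move: De; rewrite eb => De; congr (_, _, _); lia.
by rewrite lt' // mulr0 coefCM coef0 mulr0.
Qed.

Local Notation filB := (@fil P BB constBB m uB wB zB).

(** As [y * s] lies in the scroll, a power of [y] brings anything into it. *)
Lemma clear_y (x : BB) : exists e d, filB d (constBB (y ^+ e) * x).
Proof.
have filBM d d' x1 x2 : filB d x1 -> filB d' x2 -> filB (d + d') (x1 * x2).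
  by apply: filM; [exact: zB_m | exact: zB_u | exact: zB_zz | exact: zB_zzm].
have filBD d d' x1 x2 : filB d x1 -> filB d' x2 -> filB (d + d') (x1 + x2).
  by move=> f1 f2; apply: spanDD; [move: f1 | move: f2]; apply: fil_mono; lia.
have filBc p : filB 0 (constBB p) by exact: fil_scal.
have vE : uB + zB 0 = 'X%:P by rewrite /uB /zB subn0 subrK.
have cst (c : {poly P}) : exists d, filB d c%:P.
  elim/poly_ind: c => [|c a [d fd]]; first by exists 0%N; exact: Span0.
  exists (d + m + 0)%N; rewrite polyCD polyCM; apply: filBD; last exact: filBc.
  by apply: filBM => //; rewrite -vE; exact: fil_vm.
elim/poly_ind: x => [|x c [e [d fd]]].
  by exists 0%N, 0%N; rewrite mulr0; exact: Span0.
have [d' fd'] := cst c.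
exists e.+1, (d + (m - m.-1) + (0 + d'))%N; rewrite mulrDr; apply: filBD; last exact: filBM.
rewrite (_ : _ * _ = constBB (y ^+ e) * x * zB m.-1).
  by apply: filBM => //; apply: fil_z; [exact: zB_m | lia].
rewrite /zB (_ : (m - m.-1)%N = 1%N) ?expr1; last by lia.
by rewrite exprSr rmorphM; ring.
Qed.

End ScrollInPoly.

(** * The Rees algebra of the Jacobian ideal *)

Lemma mpoly_closed_ind (R : comNzRingType) n (K : {mpoly R[n]} -> Prop) :
  (forall c, K c%:MP) -> (forall i, K 'X_i) ->
  (forall p q, K p -> K q -> K (p + q)) -> (forall p q, K p -> K q -> K (p * q)) ->
  forall p, K p.
Proof.
move=> KC KX KD KM; apply: mpolyind => [|c x p _ _ Kp]; first by rewrite -[0]mpolyC0.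
apply: KD => //; rewrite -mul_mpolyC mpolyXE_id; apply: (KM) => //.
apply: (big_ind K) => [||i _]; [by rewrite -mpolyC1 | exact: KM |].
by elim: (x i) => [|e IH]; rewrite ?expr0 ?exprS -?mpolyC1 //; exact: KM.
Qed.

Lemma mderivXn n (R : comNzRingType) i (p : {mpoly R[n]}) e :
  mderiv i (p ^+ e) = p ^+ e.-1 * mderiv i p *+ e.
Proof.
elim: e => [|e IH]; first by rewrite expr0 -mpolyC1 mderivC mulr0n.
rewrite exprS mderivM IH /= mulrnAr mulrA.
by case: e IH => [|e] _; rewrite ?mulr0n ?addr0 ?expr0 ?mul1r ?mulr1 // exprS /= [in RHS]mulrS mulrC.
Qed.

Section Jacobian.
Variables (k : fieldType) (m : nat).
Local Notation R := {mpoly k[m.+3]}.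

Definition xR (l : nat) : R := xvar k m.+3 l.+1.
Local Notation wR := (xR m.+1).
Local Notation uR := (xR m.+2).
Local Notation F := (fpoly k m.+3).

Lemma xRE (i : 'I_m.+3) : xR i = 'X_i.
Proof.
rewrite /xR /=; case: insubP => [l _ e|]; last by rewrite ltn_ord.
by congr 'X__; apply/val_inj.
Qed.

Lemma mderiv_xR (i : 'I_m.+3) l : (l < m.+3)%N -> mderiv i (xR l) = (l == i)%:R.
Proof.
move=> lm; rewrite -[(l == i)]/(Ordinal lm == i) -[xR l]/(xR (Ordinal lm)).
rewrite xRE mderivX mnmE.
have [->|_] := eqVneq (Ordinal lm) i; last by rewrite scale0r.
rewrite scale1r (_ : (U_(i) - U_(i))%MM = 0%MM) ?mpolyX0 //.
by apply/mnmP => j; rewrite !mnmE subnn.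
Qed.

Lemma fpolyE : F = 2%:R * wR ^+ m.+2 * uR
  + \sum_(0 <= l < m.+1) xR l * wR ^+ l * uR ^+ (m.+2 - l).
Proof. by rewrite /fpoly big_add1. Qed.

(** The partial derivatives with respect to [w] and [u]. *)
Definition fw : R := (m.+2 * 2)%:R * wR ^+ m.+1 * uR
  + \sum_(0 <= l < m.+1) l%:R * xR l * wR ^+ l.-1 * uR ^+ (m.+2 - l).
Definition fu : R := 2%:R * wR ^+ m.+2
  + \sum_(0 <= l < m.+1) (m.+2 - l)%:R * xR l * wR ^+ l * uR ^+ (m.+1 - l).

Lemma mderiv_fpoly (i : 'I_m.+3) : mderiv i F =
  if (i <= m)%N then wR ^+ i * uR ^+ (m.+2 - i)
  else if i == m.+1 :> nat then fw else fu.
Proof.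
have dsum : mderiv i (\sum_(0 <= l < m.+1) xR l * wR ^+ l * uR ^+ (m.+2 - l)) =
    \sum_(0 <= l < m.+1) ((l == i)%:R * wR ^+ l * uR ^+ (m.+2 - l)
      + (m.+1 == i)%:R * (l%:R * xR l * wR ^+ l.-1 * uR ^+ (m.+2 - l))
      + (m.+2 == i)%:R * ((m.+2 - l)%:R * xR l * wR ^+ l * uR ^+ (m.+1 - l))).
  rewrite raddf_sum /=; apply: eq_big_nat => l /andP[_ lm].
  rewrite !mderivM !mderivXn !mderiv_xR //; last by lia.
  rewrite (_ : (m.+2 - l).-1 = (m.+1 - l)%N); last by lia.
  by rewrite -[_ *+ l]mulr_natl -[_ *+ (m.+2 - l)]mulr_natl; ring.
have d2 : mderiv i (2%:R : R) = 0 by rewrite -[2%:R](rmorph_nat (@mpolyC m.+3 k)) mderivC.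
have := mderivXn i wR m.+2; rewrite fpolyE.
have [W WE] : exists W, W = wR ^+ m.+2 by exists (wR ^+ m.+2).
rewrite -WE => dW.
rewrite mderivD dsum !mderivM dW !mderiv_xR // d2.
rewrite !big_split /= -!mulr_sumr -[_ *+ m.+2]mulr_natl.
have [im|im] := leqP i m.
  rewrite (bigD1_seq (val i)) ?mem_index_iota ?iota_uniq //= eqxx big1 => [|l /negbTE->].
    rewrite (gtn_eqF (_ : i < m.+1)%N) // (gtn_eqF (_ : i < m.+2)%N) //; last by lia.
    by move=> /=; ring.
  by rewrite !mul0r.
rewrite big1_seq => [|l]; last first.
  by rewrite mem_index_iota => /andP[_ lm]; rewrite ltn_eqF ?mul0r //; lia.
have ff : (m.+2 == m.+1) = false by lia.
have [e|ne] := eqVneq m.+1 i.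
  by rewrite -e ff /fw natrM /=; ring.
have -> : nat_of_ord i = m.+2 by have := ltn_ord i; lia.
by rewrite eqxx /fu WE /=; ring.
Qed.

Lemma u_fw : uR * fw = (m.+2 * 2)%:R * wR ^+ m.+1 * uR ^+ 2
  + \sum_(1 <= l < m.+1) l%:R * xR l * (wR ^+ l.-1 * uR ^+ (m.+3 - l)).
Proof.
rewrite /fw mulrDr [in LHS]big_ltn // !mul0r add0r mulr_sumr; congr (_ + _); first by ring.
apply: eq_big_nat => l /andP[l0 lm].
by rewrite (_ : (m.+3 - l)%N = (m.+2 - l).+1) ?exprS; [ring | lia].
Qed.

Lemma u_fu_w_fw : m.+2%:R * uR * fu - wR * fw =
  \sum_(0 <= l < m.+1) ((m.+2 * (m.+2 - l))%:R - l%:R) * xR l * (wR ^+ l * uR ^+ (m.+2 - l)).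
Proof.
rewrite /fw /fu !mulrDr !mulr_sumr natrM opprD addrACA -sumrB.
rewrite (_ : _ - _ = 0 :> R) ?add0r; last by rewrite [wR ^+ m.+2]exprS; ring.
apply: eq_big_nat => l /andP[_ lm]; rewrite natrM.
rewrite (_ : (m.+2 - l)%N = (m.+1 - l).+1); last by lia.
by case: l lm => [|l] lm; rewrite ?exprS /=; ring.
Qed.

End Jacobian.

Section ReesScroll.
Variables (k : fieldType) (m : nat).
Hypothesis char0 : [pchar k] =i pred0.
Hypothesis m_gt0 : (0 < m)%N.
Local Notation R := {mpoly k[m.+3]}.
Local Notation P := {mpoly k[m.+4]}.
Local Notation wR := (xR k m m.+1).
Local Notation uR := (xR k m m.+2).
Local Notation x := (xR k m).

Definition uS : {poly R} := uR%:P.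
Definition wS : {poly R} := wR%:P.
Definition zS (j : nat) : {poly R} := (wR ^+ (m - j) * uR ^+ j.+2)%:P * 'X.
Definition cstS : k -> {poly R} := polyC \o @mpolyC m.+3 k.
HB.instance Definition _ := GRing.RMorphism.on cstS.

Lemma natk_neq0 n : n.+1%:R != 0 :> k.
Proof. by rewrite (pcharf0P _).1 //; exact/pcharf0P. Qed.

(** With this shift of [x m] by [z 0], the coefficient of [z 0 ^+ 2] in the
    second quadric is that of [u ^+ 2] and [w ^+ 2]. *)
Definition gam0 : k := - (m.+2 * 2)%:R / (m + 4)%:R.

(** The parameters: up to corrections by multiples of [w], [u] and [z 0], they
    are the variables other than [u] and [w], the partial derivatives with
    respect to [w] and [u] times ['X], and the generator [zS m]. *)
Definition theta (i : nat) : {poly R} :=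
  if (i < m)%N then (x i)%:P
  else if i == m then (x m)%:P - cstS gam0 * zS 0
  else if i == m.+1 then (fw k m)%:P * 'X + (m.+2 * 2)%:R * wS
  else if i == m.+2 then (fu k m)%:P * 'X - 2%:R * uS
  else zS m.

Definition par : P -> {poly R} := mmap cstS (fun i => theta i).
HB.instance Definition _ := GRing.RMorphism.on par.

Definition XP (l : nat) : P := 'X_(inord l).
Definition gamP : P := gam0%:MP.
Definition halfP : P := (2%:R^-1)%:MP.
Definition yP : P := XP m.+3.

Lemma par_XP l : (l < m.+4)%N -> par (XP l) = theta l.
Proof. by move=> lm; rewrite /par /XP mmapX mmap1U inordK. Qed.

Lemma par_C c : par c%:MP = cstS c.
Proof. exact: mmapC. Qed.

Lemma halfP2 : halfP * 2%:R = 1.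
Proof.
rewrite -[2%:R](rmorph_nat (@mpolyC m.+4 k)) -mpolyCM mulVf ?mpolyC1 //.
exact: natk_neq0.
Qed.

Lemma gamPE : gamP * (m + 4)%:R = bet P m.
Proof.
rewrite -[_%:R](rmorph_nat (@mpolyC m.+4 k)) -mpolyCM divfK ?addnS ?natk_neq0 //.
by rewrite mpolyCN rmorph_nat.
Qed.

Lemma theta_lt l : (l < m)%N -> theta l = (x l)%:P.
Proof. by rewrite /theta => ->. Qed.

Lemma theta_m : theta m = (x m)%:P - cstS gam0 * zS 0.
Proof. by rewrite /theta ltnn eqxx. Qed.

Lemma theta_w : theta m.+1 = (fw k m)%:P * 'X + (m.+2 * 2)%:R * wS.
Proof.
rewrite /theta eqxx; have -> : (m.+1 < m)%N = false by lia.
by have -> : (m.+1 == m) = false by lia.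
Qed.

Lemma theta_u : theta m.+2 = (fu k m)%:P * 'X - 2%:R * uS.
Proof.
rewrite /theta eqxx; have -> : (m.+2 < m)%N = false by lia.
have -> : (m.+2 == m) = false by lia.
by have -> : (m.+2 == m.+1) = false by lia.
Qed.

Lemma theta_y : theta m.+3 = zS m.
Proof.
rewrite /theta; have -> : (m.+3 < m)%N = false by lia.
have -> : (m.+3 == m) = false by lia.
have -> : (m.+3 == m.+1) = false by lia.
by have -> : (m.+3 == m.+2) = false by lia.
Qed.

Lemma par_w : par (XP m.+1) = (fw k m)%:P * 'X + (m.+2 * 2)%:R * wS.
Proof. by rewrite par_XP ?theta_w //; lia. Qed.

Lemma par_u : par (XP m.+2) = (fu k m)%:P * 'X - 2%:R * uS.
Proof. by rewrite par_XP ?theta_u //; lia. Qed.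

Lemma zS_m : zS m = par yP.
Proof. by rewrite /yP par_XP // theta_y. Qed.

Lemma zS_u j : (j < m)%N -> uS * zS j = wS * zS j.+1.
Proof.
move=> jm; rewrite /uS /wS /zS !mulrA -!polyCM -(subnSK jm) !exprS.
by congr (_%:P * _); ring.
Qed.

Lemma zS_zz j l : (j + l <= m)%N -> zS j * zS l = zS 0 * zS (j + l).
Proof.
move=> jl; rewrite /zS [LHS]mulrACA [RHS]mulrACA -!polyCM; congr (_%:P * _).
rewrite [LHS]mulrACA [RHS]mulrACA -!exprD; congr (_ ^+ _ * _ ^+ _); lia.
Qed.

Lemma zS_zzm j l : (j <= m)%N -> (l <= m)%N -> (m <= j + l)%N ->
  zS j * zS l = par yP * zS (j + l - m).
Proof.
move=> jm lm jl; rewrite -zS_m /zS [LHS]mulrACA [RHS]mulrACA -!polyCM; congr (_%:P * _).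
rewrite [LHS]mulrACA [RHS]mulrACA -!exprD; congr (_ ^+ _ * _ ^+ _); lia.
Qed.

(** Trading [XP m] for [x m] in a sum costs one multiple of [z 0]. *)
Lemma par_lin (c : nat -> P) (g : nat -> {poly R}) i0 : (i0 <= m)%N ->
  \sum_(i0 <= l < m.+1) par (c l * XP l) * g l =
  \sum_(i0 <= l < m.+1) par (c l) * (x l)%:P * g l - par (c m * gamP) * zS 0 * g m.
Proof.
move=> im; rewrite !big_nat_recr //= -addrA; congr (_ + _).
  apply: eq_big_nat => l /andP[_ lm].
  by rewrite rmorphM /= par_XP ?theta_lt //; lia.
rewrite !rmorphM /= par_XP; last by lia.
by rewrite theta_m par_C; ring.
Qed.

Let natP n : (n%:R : R)%:P = n%:R := rmorph_nat (@polyC R) n.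

Lemma quadric_wS : quadric_w par m uS wS zS gamP XP (XP m.+1) = 0.
Proof.
rewrite /quadric_w /= par_lin // par_w subSn // subnn.
rewrite [par (bet _ _)]rmorphN rmorph_nat.
rewrite (_ : \sum_(1 <= l < m.+1) _ =
    (\sum_(1 <= l < m.+1) l%:R * x l * (wR ^+ l.-1 * uR ^+ (m.+3 - l)))%:P * 'X); last first.
  rewrite rmorph_sum mulr_suml; apply: eq_big_nat => l /andP[l0 lm].
  rewrite rmorph_nat /zS.
  have -> : (m - (m.+1 - l))%N = l.-1 by lia.
  have -> : (m.+1 - l).+2 = (m.+3 - l)%N by lia.
  move: (wR ^+ l.-1) (uR ^+ (m.+3 - l)) => W U.
  by rewrite /= !polyCM natP; ring.
set S := \sum_(_ <= _ < _) _; set N := (m.+2 * 2)%N.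
rewrite (_ : _ - _ - _ = (uR * fw k m - (N%:R * wR ^+ m.+1 * uR ^+ 2 + S))%:P * 'X).
  by rewrite u_fw subrr polyC0 mul0r.
rewrite /zS /uS /wS subn0 [wR ^+ m.+1]exprS.
move: (wR ^+ m) (uR ^+ 2) (fw k m) wR uR S => W U f w u S'.
by rewrite /= polyCB polyCD !polyCM natP; ring.
Qed.

Lemma quadric_uS : quadric_u par m uS wS zS XP (XP m.+1) (XP m.+2) = 0.
Proof.
rewrite /quadric_u /= par_lin // par_w par_u subnn.
rewrite (_ : par (_ * gamP) = par (bet P m)); last first.
  rewrite -gamPE mulrC; congr (par (_ * _)).
  by rewrite -natrB; [congr (_%:R) | ]; lia.
rewrite [par (bet _ _)]rmorphN rmorph_nat.
rewrite (_ : \sum_(0 <= l < m.+1) _ =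
    (\sum_(0 <= l < m.+1) ((m.+2 * (m.+2 - l))%:R - l%:R) * x l
      * (wR ^+ l * uR ^+ (m.+2 - l)))%:P * 'X); last first.
  rewrite rmorph_sum mulr_suml; apply: eq_big_nat => l /andP[l0 lm].
  rewrite rmorphB !rmorph_nat /zS.
  have -> : (m - (m - l))%N = l by lia.
  have -> : (m - l).+2 = (m.+2 - l)%N by lia.
  move: (wR ^+ l) (uR ^+ (m.+2 - l)) => W U.
  by rewrite /= !polyCM polyCB !natP; ring.
set S := \sum_(_ <= _ < _) _; rewrite natrM.
rewrite (_ : _ - _ - _ = (m.+2%:R * uR * fu k m - wR * fw k m - S)%:P * 'X).
  by rewrite u_fu_w_fw subrr polyC0 mul0r.
rewrite /uS /wS; move: (zS 0) (fw k m) (fu k m) wR uR S => z0 f f' w u S'.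
by rewrite /= !polyCB !polyCM natP; ring.
Qed.

Local Notation filS := (fil par m uS wS zS).

(** The union of the filtration is a subring. It contains the variables and the
    generators of the Jacobian ideal times ['X], so it contains the Rees
    algebra. *)
Definition scrollS (p : {poly R}) : Prop := exists d, filS d p.

Lemma scrollS_add p q : scrollS p -> scrollS q -> scrollS (p + q).
Proof.
move=> [d fp] [d' fq]; exists (d + d')%N.
by apply: spanDD; [move: fp | move: fq]; apply: fil_mono; lia.
Qed.

Lemma scrollS_mul p q : scrollS p -> scrollS q -> scrollS (p * q).
Proof.
by move=> [d fp] [d' fq]; exists (d + d')%N; apply: (filM zS_m zS_u zS_zz zS_zzm).
Qed.

Lemma scrollS_par c : scrollS (par c).
Proof. by exists 0%N; exact: fil_scal. Qed.

Lemma scrollS_z j : (j <= m)%N -> scrollS (zS j).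
Proof. by move=> jm; exists (m - j)%N; apply: fil_z; [exact: zS_m |]. Qed.

Lemma scrollS_w : scrollS wS. Proof. by exists m; exact: fil_wm. Qed.

Lemma scrollS_u : scrollS uS.
Proof. by exists m; apply: fil_um; exact: zS_m. Qed.

Lemma scrollS_cst c : scrollS (cstS c).
Proof. by rewrite -par_C; exact: scrollS_par. Qed.

Lemma scrollS_polyC (p : R) : scrollS p%:P.
Proof.
move: p; apply: mpoly_closed_ind => [c|i|p q|p q].
- exact: scrollS_cst.
- rewrite -xRE; have [im|im] := ltnP i m.
    by rewrite -theta_lt // -par_XP //; [exact: scrollS_par | lia].
  have [->|] := eqVneq (i : nat) m.
    rewrite -(subrK (cstS gam0 * zS 0) (x m)%:P) -theta_m -par_XP; last by lia.
    apply: scrollS_add; first exact: scrollS_par.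
    by apply: scrollS_mul; [exact: scrollS_cst | exact: scrollS_z].
  have [->|] := eqVneq (i : nat) m.+1; first by move=> _; exact: scrollS_w.
  have := ltn_ord i => im3 i1 i0; have -> : nat_of_ord i = m.+2 by lia.
  exact: scrollS_u.
- by rewrite polyCD; exact: scrollS_add.
- by rewrite polyCM; exact: scrollS_mul.
Qed.

Local Notation F := (fpoly k m.+3).

Lemma scrollS_nat n : scrollS n%:R.
Proof. by rewrite -(rmorph_nat cstS); exact: scrollS_cst. Qed.

Lemma scrollS_mderiv i : scrollS ((mderiv i F)%:P * 'X).
Proof.
rewrite mderiv_fpoly; case: leqP => im.
  rewrite (_ : _ * 'X = zS (m - i)); first by apply: scrollS_z; lia.
  rewrite /zS; have -> : (m - (m - i))%N = i by lia.
  by have -> : (m - i).+2 = (m.+2 - i)%N by lia.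
case: eqP => _.
  rewrite (_ : _ * 'X = par (XP m.+1) + (- 1) * ((m.+2 * 2)%:R * wS)).
    apply: scrollS_add; first exact: scrollS_par.
    apply: scrollS_mul; first by rewrite -polyC1 -polyCN; exact: scrollS_polyC.
    by apply: scrollS_mul; [exact: scrollS_nat | exact: scrollS_w].
  by rewrite par_w; ring.
rewrite (_ : _ * 'X = par (XP m.+2) + 2%:R * uS); last by rewrite par_u; ring.
apply: scrollS_add; first exact: scrollS_par.
by apply: scrollS_mul; [exact: scrollS_nat | exact: scrollS_u].
Qed.

Lemma scrollS_exp i p : p \in ideal_exp (jacobian_ideal F) i -> scrollS (p%:P * 'X^i).
Proof.
have sum0 (T : eqType) (r : seq T) (G : T -> R) e :
    (forall t, t \in r -> scrollS ((G t)%:P * 'X^e)) ->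
    scrollS ((\sum_(t <- r) G t)%:P * 'X^e).
  move=> GS; rewrite big_seq rmorph_sum mulr_suml; elim/big_rec: _ => [|t q tr Sq].
    by rewrite -polyC0; exact: scrollS_polyC.
  by apply: scrollS_add => //; exact: GS.
elim: i p => [|i IH] p; first by move=> _; rewrite expr0 mulr1; exact: scrollS_polyC.
move=> /asboolP[s sG ->]; apply: (sum0) => -[a b] /sG/asboolP[q [q' [qJ q'J ->]]] /=.
rewrite (_ : _ * 'X^(i.+1) = a%:P * (q%:P * 'X^1) * (q'%:P * 'X^i)); last first.
  by rewrite !polyCM exprS expr1; ring.
apply: scrollS_mul; last exact: IH.
apply: scrollS_mul; first exact: scrollS_polyC.
move: qJ => /asboolP[t tG ->]; apply: (sum0) => -[c g] /tG; rewrite inE => /existsP[l /eqP->] /=.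
by rewrite polyCM -mulrA; apply: scrollS_mul; [exact: scrollS_polyC | exact: scrollS_mderiv].
Qed.

Lemma scrollS_rees p : p \in in_rees (jacobian_ideal F) -> scrollS p.
Proof.
move=> /asboolP pJ; rewrite -[p]coefK poly_def.
elim/big_rec: _ => [|i q _ Sq]; first by rewrite -polyC0; exact: scrollS_polyC.
by apply: scrollS_add => //; rewrite -mul_polyC; exact: scrollS_exp.
Qed.

(** For reduced [t], these form a basis of the Rees algebra over the
    parameters. *)
Definition gS (t : nat * nat * nat) : {poly R} :=
  eps m zS t.1.1 * (uS + zS 0 + wS) ^+ t.1.2 * (uS + zS 0 - wS) ^+ t.2.

(** The quadrics vanish on the Rees algebra, so in the basis adapted to them only
    the reduced elements survive. *)
Lemma rees_span p : p \in in_rees (jacobian_ideal F) ->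
  exists c, p = \sum_(t <- reduced_list m) par (c t) * gS t.
Proof.
move=> /scrollS_rees[d fp].
pose M1 := quadric_a par m uS wS zS gamP XP (XP m.+1) (XP m.+2).
pose M2 := quadric_b par m uS wS zS gamP XP (XP m.+1) (XP m.+2).
have M10 : M1 = 0 by rewrite /M1 /quadric_a quadric_wS quadric_uS mulr0 subrr.
have M20 : M2 = 0 by rewrite /M2 /quadric_b quadric_wS quadric_uS mulr0 addr0.
have kapK : ((m.+2 * 2)%:R^-1 : k)%:MP * (- bet P m) = 1 :> P.
  rewrite /bet opprK -(rmorph_nat (@mpolyC m.+4 k)) -mpolyCM mulVf ?mpolyC1 //.
  by rewrite muln2 doubleS natk_neq0.
have f1 := fil_quadric_a zS_m zS_u zS_zz zS_zzm m_gt0 gamP XP (XP m.+1) (XP m.+2).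
have f2 := fil_quadric_b zS_m zS_u zS_zz zS_zzm m_gt0 gamP XP (XP m.+1) (XP m.+2).
have := span_gmon halfP2 zS_m zS_u zS_zz zS_zzm m_gt0 kapK f1 f2 fp.
rewrite -/M1 -/M2 => gspan; apply: (span_seqP (reduced_list_uniq m)).
apply: span_le gspan => t tm.
have [tr|tr] := boolP (reduced m t).
  rewrite gmon_reduced // -/(gS t); apply: span_gen.
  by rewrite mem_reduced_list.
rewrite (_ : gmon _ _ _ _ _ _ _ = 0); first exact: Span0.
rewrite /gmon M10 M20; move: tr tm; case: t => [[c al] be].
rewrite /reduced /idx_le => /= tr /andP[cm _].
have half0 n : (1 < n)%N -> 0 ^+ n./2 = 0 :> {poly R}.
  by case: n => [|[|n]] // _; exact: expr0n.
have [al2|al2] := ltnP 1 al; first by rewrite /= half0 // !(mul0r, mulr0).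
have be2 : (1 < be)%N by move: tr; rewrite cm ltnS al2 /= -leqNgt.
by rewrite /= (half0 be) // !(mul0r, mulr0).
Qed.

Local Notation J := (jacobian_ideal F).

Lemma in_rees_polyC (p : R) : p%:P \in in_rees J.
Proof.
apply/asboolP => i; rewrite coefC; case: ifP => [/eqP->//|_]; exact: ideal_exp0.
Qed.

Lemma in_rees_mderiv i : (mderiv i F)%:P * 'X \in in_rees J.
Proof.
apply/asboolP => l; rewrite coefMX coefC; case: l => [|[|l]];
  [exact: (ideal_exp0 J 0) | | exact: (ideal_exp0 J l.+2)].
apply: ideal_gen_sub; apply/asboolP; exists (mderiv i F), 1; rewrite mulr1; split=> //.
by apply: ideal_gen_sub; rewrite inE; apply/existsP; exists i.
Qed.

Lemma in_rees_zS j : (j <= m)%N -> zS j \in in_rees J.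
Proof.
move=> jm; have im : (m - j < m.+3)%N by lia.
have := in_rees_mderiv (Ordinal im); rewrite mderiv_fpoly /= leq_subr /zS.
by have -> : (m.+2 - (m - j))%N = j.+2 by lia.
Qed.

Lemma in_rees_theta i : theta i \in in_rees J.
Proof.
have wm : (m.+1 < m.+3)%N by lia.
have um : (m.+2 < m.+3)%N by lia.
have := in_rees_mderiv (Ordinal wm); have := in_rees_mderiv (Ordinal um).
rewrite !mderiv_fpoly /=; have -> : (m.+2 <= m)%N = false by lia.
have -> : (m.+1 <= m)%N = false by lia.
rewrite eqxx; have -> : (m.+2 == m.+1) = false by lia.
move=> fuJ fwJ; rewrite /theta; case: ifP => _; first exact: in_rees_polyC.
case: ifP => _.
  apply: rpredB; first exact: in_rees_polyC.
  by apply: rpredM; [exact: in_rees_polyC | exact: in_rees_zS].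
have natJ n (p : R) : n%:R * p%:P \in in_rees J.
  by apply: rpredM; [exact: rpred_nat | exact: in_rees_polyC].
case: ifP => _; first by apply: rpredD; [exact: fwJ | exact: natJ].
case: ifP => _; first by apply: rpredB; [exact: fuJ | exact: (natJ 2)].
exact: in_rees_zS.
Qed.

Lemma in_rees_par p : par p \in in_rees J.
Proof.
move: p; apply: mpoly_closed_ind => [c|i|p q pJ qJ|p q pJ qJ].
- rewrite par_C; exact: (in_rees_polyC c%:MP).
- rewrite (_ : 'X_i = XP i) ?par_XP //; first exact: in_rees_theta.
  by rewrite /XP inord_val.
- rewrite [par _](rmorphD par); exact: (rpredD pJ qJ).
- rewrite [par _](rmorphM par); exact: (rpredM pJ qJ).
Qed.

Lemma in_rees_gS t : gS t \in in_rees J.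
Proof.
have uJ : uS + zS 0 \in in_rees J.
  by apply: rpredD; [exact: in_rees_polyC | exact: in_rees_zS].
have wJ : wS \in in_rees J by exact: in_rees_polyC.
apply: rpredM; last by apply: rpredX; exact: rpredB.
apply: rpredM; last by apply: rpredX; exact: rpredD.
by rewrite /eps; case: ltnP => tm; rewrite ?rpred1 ?in_rees_zS // ltnW.
Qed.

Definition parA (p : P) : rees_algebra J := Rees (in_rees_par p).
Lemma parA_zmod : zmod_morphism parA.
Proof. by move=> p q; apply/val_inj; rewrite /= rmorphB. Qed.
HB.instance Definition _ := GRing.isZmodMorphism.Build P (rees_algebra J) parA parA_zmod.
Lemma parA_monoid : monoid_morphism parA.
Proof. by split=> [|p q]; apply/val_inj; rewrite /= ?rmorph1 ?rmorphM. Qed.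
HB.instance Definition _ := GRing.isMonoidMorphism.Build P (rees_algebra J) parA parA_monoid.

Lemma rees_cohen_macaulay :
  (forall c, \sum_(t <- reduced_list m) par (c t) * gS t = 0 ->
    forall t, t \in reduced_list m -> c t = 0) ->
  cohen_macaulay (rees_algebra J).
Proof.
move=> gfree; pose r := reduced_list m; pose t0 := (0, 0, 0)%N.
pose g (l : 'I_(size r)) : rees_algebra J := Rees (in_rees_gS (nth t0 r l)).
have sumE (c : 'I_(size r) -> P) (c' : nat * nat * nat -> P) :
    (forall l, c l = c' (nth t0 r l)) ->
    rees_val (\sum_l parA (c l) * g l) = \sum_(t <- r) par (c' t) * gS t.
  move=> cE; rewrite -[rees_val _]/(val _) rmorph_sum (big_nth t0) big_mkord.
  by apply: eq_bigr => l _; rewrite rmorphM /= cE.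
apply: (@free_over_mpoly_cohen_macaulay k m.+4 _ parA _ g) => [a|c c0 l].
  have [c cE] := rees_span (valP a); exists (fun l : 'I_(size r) => c (nth t0 r l)).
  by apply/val_inj; rewrite [RHS](sumE _ c).
pose c' t := if insub (index t r) is Some l then c l else 0.
have c'E l' : c l' = c' (nth t0 r l').
  rewrite /c' index_uniq ?reduced_list_uniq //; case: insubP => [i _ e|].
    by congr c; apply/val_inj.
  by rewrite ltn_ord.
rewrite c'E; apply: gfree; last exact: mem_nth.
by rewrite -(sumE _ _ c'E) c0.
Qed.

End ReesScroll.

(** * Independence of the basis *)

Lemma sum_eq0_mem (V : zmodType) a b (F : nat -> V) :
  (forall l, (a <= l < b)%N -> F l = 0) -> \sum_(a <= l < b) F l = 0.
Proof. by move=> F0; rewrite big1_seq // => l; rewrite mem_index_iota => /F0. Qed.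

(** The quadrics are affine in the parameters [X l], [thw] and [thu]: two ways
    of evaluating these change them by a linear expression. *)
Section QuadricChange.
Variables (P C : comNzRingType) (m : nat) (u w : C) (z : nat -> C).
Variables (gam : P) (X : nat -> P) (thw thu : P).
Implicit Types f g : {rmorphism P -> C}.

Lemma quadric_w_diff f g : f gam = g gam ->
  quadric_w f m u w z gam X thw - quadric_w g m u w z gam X thw =
  u * (f thw - g thw)
  - \sum_(1 <= l < m.+1) l%:R * (f (X l) - g (X l)) * z (m.+1 - l).
Proof.
move=> fg; have eb : f (bet P m) = g (bet P m) by rewrite !rmorphN !rmorph_nat.
rewrite /quadric_w eb !rmorphM fg !rmorph_nat.
rewrite [X in _ = _ - X](_ : _ =
  \sum_(1 <= l < m.+1) f (l%:R * X l) * z (m.+1 - l)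
  - \sum_(1 <= l < m.+1) g (l%:R * X l) * z (m.+1 - l)); first by ring.
rewrite -sumrB; apply: eq_bigr => l _.
by rewrite !rmorphM !rmorph_nat; ring.
Qed.

Lemma quadric_u_diff f g :
  quadric_u f m u w z X thw thu - quadric_u g m u w z X thw thu =
  m.+2%:R * u * (f thu - g thu) - w * (f thw - g thw)
  - \sum_(0 <= l < m.+1) ((m.+2 * (m.+2 - l))%:R - l%:R) * (f (X l) - g (X l)) * z (m - l).
Proof.
have eb : f (bet P m) = g (bet P m) by rewrite !rmorphN !rmorph_nat.
rewrite /quadric_u eb.
rewrite [X in _ = _ - X](_ : _ =
  \sum_(0 <= l < m.+1) f (((m.+2 * (m.+2 - l))%:R - l%:R) * X l) * z (m - l)
  - \sum_(0 <= l < m.+1) g (((m.+2 * (m.+2 - l))%:R - l%:R) * X l) * z (m - l)); first by ring.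
rewrite -sumrB; apply: eq_bigr => l _.
by rewrite !rmorphM !rmorphB !rmorph_nat; ring.
Qed.

Lemma quadric_w_map (C' : comNzRingType) (h : {rmorphism C -> C'}) f
    (f' : {rmorphism P -> C'}) : (forall p, h (f p) = f' p) ->
  h (quadric_w f m u w z gam X thw) = quadric_w f' m (h u) (h w) (h \o z) gam X thw.
Proof.
move=> hf; rewrite /quadric_w !(rmorphB, rmorphD, rmorphM) rmorph_sum /= !hf.
by congr (_ - _ - _); apply: eq_bigr => l _; rewrite !rmorphM /= !hf.
Qed.

Lemma quadric_u_map (C' : comNzRingType) (h : {rmorphism C -> C'}) f
    (f' : {rmorphism P -> C'}) : (forall p, h (f p) = f' p) ->
  h (quadric_u f m u w z X thw thu) = quadric_u f' m (h u) (h w) (h \o z) X thw thu.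
Proof.
move=> hf; rewrite /quadric_u !(rmorph_nat, rmorphXn, rmorphB, rmorphM, rmorphD) rmorph_sum.
rewrite /= !hf; congr (_ - _ - _ - _).
by apply: eq_bigr => l _; rewrite !rmorphM /= !hf.
Qed.

Lemma eq_quadric_w (z' : nat -> C) f : (0 < m)%N -> (forall j, (j <= m)%N -> z j = z' j) ->
  quadric_w f m u w z gam X thw = quadric_w f m u w z' gam X thw.
Proof.
move=> m0 zz'; rewrite /quadric_w !zz' //; congr (_ - _ - _).
by apply: eq_big_nat => l l1; rewrite zz' //; lia.
Qed.

Lemma eq_quadric_u (z' : nat -> C) f : (forall j, (j <= m)%N -> z j = z' j) ->
  quadric_u f m u w z X thw thu = quadric_u f m u w z' X thw thu.
Proof.
move=> zz'; rewrite /quadric_u !zz' //; congr (_ - _ - _ - _).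
by apply: eq_big_nat => l l1; rewrite zz' //; lia.
Qed.

End QuadricChange.

(** The scroll is now the one inside [{poly {poly P}}], for a domain [P], and
    [LwB] and [LuB] are its two quadrics. *)
Section Specialization.
Variables (P : idomainType) (m : nat).
Hypothesis m_gt0 : (0 < m)%N.
Variables (y gam half sqinv betinv : P) (X : nat -> P) (thw thu : P).
Hypothesis y0 : y != 0.
Hypothesis half2 : half * 2%:R = 1.
Hypothesis sqinvE : sqinv * (m.+2 * m.+2)%:R = 1.
Hypothesis betinvE : betinv * (m.+2 * 2)%:R = 1.
Local Notation BB := {poly {poly P}}.
Local Notation FF := {fraction BB}.
Local Notation uu := (uB m y).
Local Notation ww := (wB m y).
Local Notation zz := (zB m y).
Local Notation cB := (@constBB P).

Definition cF : P -> FF := @tofrac BB \o cB.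
HB.instance Definition _ := GRing.RMorphism.on cF.

Definition uF : FF := tofrac uu.
Definition wF : FF := tofrac ww.
Definition zF (j : nat) : FF := tofrac (zz j).

Definition LwB : BB := @quadric_w P BB cB m uu ww zz gam X thw.
Definition LuB : BB := @quadric_u P BB cB m uu ww zz X thw thu.

Lemma cF_inj : injective cF.
Proof.
move=> p q /eqP; rewrite tofrac_eq => /eqP e.
by apply/polyC_inj/polyC_inj.
Qed.

Lemma cFy_neq0 : cF y != 0.
Proof. by rewrite -(rmorph0 cF) (inj_eq cF_inj). Qed.

Lemma uF_neq0 : uF != 0.
Proof.
rewrite tofrac_eq0 -size_poly_gt0.
by have [-> _] := uB_lead m_gt0 y0.
Qed.

(** Once [y] is inverted, the quadrics can be solved for [X 1] and [X 0], which
    occur there with coefficients [- y] and [- (n-1)^2 y]. The solutions are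
    [X 1 + shift1] and [X 0 + shift0]. *)
Definition shift1 : FF := tofrac LwB / cF y.
Definition shift0 : FF := cF sqinv *
  (tofrac LuB - ((m.+2 * m.+1)%:R - 1) * shift1 * zF m.-1) / cF y.

Definition sol (i : nat) : FF :=
  cF (X i) + (if i is i'.+1 then if i' is 0 then shift1 else 0 else shift0).

Variable sig : {rmorphism P -> FF}.
Hypothesis sig_X : forall i, (i <= m)%N -> sig (X i) = sol i.
Hypothesis sig_gam : sig gam = cF gam.
Hypothesis sig_w : sig thw = cF thw.
Hypothesis sig_u : sig thu = cF thu.

Lemma sig_X2 i : (1 < i <= m)%N -> sig (X i) = cF (X i).
Proof.
by move=> /andP[i1 im]; rewrite sig_X // /sol; case: i i1 im => [|[|i]] // _ _; rewrite addr0.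
Qed.

Lemma sqinvF : cF sqinv * (m.+2 * m.+2)%:R = 1.
Proof. by rewrite -(rmorph_nat cF) -rmorphM sqinvE rmorph1. Qed.

Lemma sig_quadric_w : quadric_w sig m uF wF zF gam X thw = 0.
Proof.
have e := @quadric_w_map P BB m uu ww zz gam X thw FF (@tofrac BB) cB cF (fun=> erefl).
have := @quadric_w_diff P FF m uF wF zF gam X thw sig cF sig_gam.
rewrite -[@quadric_w P FF cF _ _ _ _ _ _ _]e -/LwB => /eqP; rewrite subr_eq => /eqP ->.
rewrite sig_w subrr mulr0 big_ltn // big1_seq => [|l]; last first.
  rewrite mem_index_iota => /andP[_ l2]; rewrite sig_X2; last by lia.
  by rewrite subrr mulr0 mul0r.
rewrite sig_X // /sol subn1 /= /zF zB_m -/(cF y).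
have := divfK cFy_neq0 (tofrac LwB); rewrite -/shift1 => <-.
by ring.
Qed.

Lemma sig_quadric_u : quadric_u sig m uF wF zF X thw thu = 0.
Proof.
have e := @quadric_u_map P BB m uu ww zz X thw thu FF (@tofrac BB) cB cF (fun=> erefl).
have := @quadric_u_diff P FF m uF wF zF X thw thu sig cF.
rewrite -[@quadric_u P FF cF _ _ _ _ _ _ _]e -/LuB => /eqP; rewrite subr_eq => /eqP ->.
rewrite sig_w sig_u !subrr !mulr0 subr0 big_ltn // big_ltn // big1_seq => [|l]; last first.
  rewrite mem_index_iota => /andP[_ l2]; rewrite sig_X2; last by lia.
  by rewrite subrr mulr0 mul0r.
rewrite !sig_X // /sol !subn0 !subn1 /= [zF m]/zF zB_m -/(cF y).
have := divfK cFy_neq0 (cF sqinv * (tofrac LuB - ((m.+2 * m.+1)%:R - 1) * shift1 * zF m.-1)).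
rewrite -/shift0 => s0y.
rewrite mulr0n subr0.
rewrite [X in X + _](_ : _ = - ((m.+2 * m.+2)%:R * (shift0 * cF y)
   + ((m.+2 * m.+1)%:R - 1) * shift1 * zF m.-1)); last by ring.
by rewrite s0y mulrA [_ * cF sqinv]mulrC sqinvF mul1r; ring.
Qed.

Local Notation filB := (@fil P BB cB m uu ww zz).

Definition gB (t : nat * nat * nat) : BB :=
  eps m zz t.1.1 * (uu + zz 0 + ww) ^+ t.1.2 * (uu + zz 0 - ww) ^+ t.2.

(** The fractions that a power of [y] brings into the ideal of the quadrics. *)
Definition in_quadrics (x : FF) : Prop :=
  exists e a b, cF y ^+ e * x = tofrac (LwB * a + LuB * b).

(** Up to powers of [y], the solution [sig] takes values in the polynomial ring
    and is congruent there to the inclusion modulo the quadrics. *)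
Definition sig_close (p : P) : Prop :=
  (exists e b, cF y ^+ e * sig p = tofrac b) /\ in_quadrics (sig p - cF p).

Lemma in_quadricsD x x' : in_quadrics x -> in_quadrics x' -> in_quadrics (x + x').
Proof.
move=> [e [a [b E]]] [e' [a' [b' E']]]; exists (e + e')%N.
exists (cB y ^+ e' * a + cB y ^+ e * a'), (cB y ^+ e' * b + cB y ^+ e * b').
rewrite (_ : LwB * _ + _ = cB y ^+ e' * (LwB * a + LuB * b)
  + cB y ^+ e * (LwB * a' + LuB * b')); last by ring.
by rewrite tofracD ![tofrac (_ ^+ _ * _)]tofracM -E -E' !tofracXn -/(cF y) exprD; ring.
Qed.

Lemma in_quadricsM e b x x' : cF y ^+ e * x = tofrac b -> in_quadrics x' ->
  in_quadrics (x * x').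
Proof.
move=> E [e' [a' [b' E']]]; exists (e + e')%N, (b * a'), (b * b').
rewrite (_ : LwB * _ + _ = b * (LwB * a' + LuB * b')); last by ring.
by rewrite tofracM -E -E' exprD; ring.
Qed.

Lemma sig_closeD p q : sig_close p -> sig_close q -> sig_close (p + q).
Proof.
move=> [[e [b E]] Jp] [[e' [b' E']] Jq]; split.
  exists (e + e')%N, (cB y ^+ e' * b + cB y ^+ e * b').
  by rewrite rmorphD tofracD ![tofrac (_ ^+ _ * _)]tofracM -E -E' !tofracXn -/(cF y) exprD; ring.
rewrite !rmorphD (_ : _ - _ = (sig p - cF p) + (sig q - cF q)); last by ring.
exact: in_quadricsD.
Qed.

Lemma sig_closeM p q : sig_close p -> sig_close q -> sig_close (p * q).
Proof.
move=> [[e [b E]] Jp] [[e' [b' E']] Jq]; split.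
  by exists (e + e')%N, (b * b'); rewrite rmorphM tofracM -E -E' exprD; ring.
rewrite !rmorphM (_ : _ - _ = sig p * (sig q - cF q) + cF q * (sig p - cF p)); last by ring.
apply: in_quadricsD; first exact: in_quadricsM E Jq.
have E0 : cF y ^+ 0 * cF q = tofrac (cB q) by rewrite expr0 mul1r.
exact: in_quadricsM E0 Jp.
Qed.

Lemma sig_close_eq p : sig p = cF p -> sig_close p.
Proof.
move=> e; rewrite /sig_close e; split; first by exists 0%N, (cB p); rewrite expr0 mul1r.
by exists 0%N, 0, 0; rewrite subrr mulr0 !mulr0 addr0 rmorph0.
Qed.

Lemma in_quadrics_shift1 : in_quadrics shift1.
Proof.
exists 1%N, 1, 0; rewrite mulr1 mulr0 addr0 expr1 mulrC.
by rewrite divfK // cFy_neq0.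
Qed.

Lemma in_quadrics_shift0 : in_quadrics shift0.
Proof.
exists 2%N, (cB (- (sqinv * ((m.+2 * m.+1)%:R - 1))) * zz m.-1), (cB (sqinv * y)).
have cE : cF (- (sqinv * ((m.+2 * m.+1)%:R - 1))) = - (cF sqinv * ((m.+2 * m.+1)%:R - 1)).
  by rewrite rmorphN rmorphM rmorphB rmorph_nat rmorph1.
have s0 := divfK cFy_neq0 (cF sqinv * (tofrac LuB - ((m.+2 * m.+1)%:R - 1) * shift1 * zF m.-1)).
have s1 := divfK cFy_neq0 (tofrac LwB).
rewrite -/shift0 in s0; rewrite -/shift1 in s1.
rewrite tofracD !tofracM -s1 -/(zF _) -[tofrac (cB _)]/(cF _) -[tofrac (cB (_ * _))]/(cF _).
rewrite cE [cF (sqinv * y)](rmorphM cF).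
transitivity (cF y * (shift0 * cF y)); first by ring.
by rewrite s0 /zF /zB tofracM; ring.
Qed.

Lemma sig_close_X i : (i <= m)%N -> sig_close (X i).
Proof.
move=> im; have E : sig (X i) = cF (X i) + (sig (X i) - cF (X i)) by ring.
have [Jd [e [b Eb]]] : in_quadrics (sig (X i) - cF (X i)) /\
    exists e b, cF y ^+ e * (sig (X i) - cF (X i)) = tofrac b.
  have h x : in_quadrics x -> in_quadrics x /\ exists e b, cF y ^+ e * x = tofrac b.
    by move=> Jx; split=> //; have [e [a [b Eb]]] := Jx; exists e; eexists; exact: Eb.
  apply: h; rewrite sig_X // /sol addrAC subrr add0r.
  case: i {im E} => [|[|i]]; [exact: in_quadrics_shift0 | exact: in_quadrics_shift1 |].
  by exists 0%N, 0, 0; rewrite !mulr0 addr0 rmorph0.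
split=> //; exists e, (cB y ^+ e * cB (X i) + b).
by rewrite E mulrDr Eb tofracD tofracM tofracXn.
Qed.

(** By closeness, a power of [y] times [\sum_t c t * gB t] lies in the ideal of
    the quadrics, and another power of [y] brings the cofactors into the
    scroll, where [gmon_reduced_free] applies. *)
Lemma sig_free : (forall p, sig_close p) -> forall c : nat * nat * nat -> P,
  \sum_(t <- reduced_list m) sig (c t) * tofrac (gB t) = 0 ->
  forall t, t \in reduced_list m -> c t = 0.
Proof.
move=> close c c0; set r := reduced_list m in c0 *.
have [e [a [b E]]] : in_quadrics (tofrac (\sum_(t <- r) cB (c t) * gB t)).
  have S0 (s : seq (nat * nat * nat)) :
      in_quadrics (\sum_(t <- s) tofrac (- gB t) * (sig (c t) - cF (c t))).
    elim: s => [|t s IH].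
      by exists 0%N, 0, 0; rewrite big_nil !mulr0 addr0 tofrac0.
    rewrite big_cons; apply: in_quadricsD => //.
    have E0 : cF y ^+ 0 * tofrac (- gB t) = tofrac (- gB t) by rewrite expr0 mul1r.
    by apply: in_quadricsM E0 _; have [] := close (c t).
  rewrite (_ : tofrac _ = \sum_(t <- r) tofrac (- gB t) * (sig (c t) - cF (c t))) //.
  rewrite -[LHS]subr0 -[X in _ - X]c0 (raddf_sum (@tofrac BB)) -sumrB.
  by apply: eq_bigr => t _; rewrite /= tofracM -/(cF _) tofracN; ring.
have {E} : cB y ^+ e * (\sum_(t <- r) cB (c t) * gB t) = LwB * a + LuB * b.
  by apply/eqP; rewrite -tofrac_eq tofracM tofracXn -E.
have [e1 [d1 fa]] := clear_y m_gt0 y0 a; have [e2 [d2 fb]] := clear_y m_gt0 y0 b.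
move=> E t tr; pose c' t := y ^+ (e + e1 + e2) * c t.
have y_unl : y ^+ (e + e1 + e2) != 0 by rewrite expf_neq0.
suff : c' t = 0 by move=> /eqP; rewrite mulf_eq0 (negbTE y_unl) => /eqP.
pose a' := cB (y ^+ e2) * (cB (y ^+ e1) * a).
pose b' := cB (y ^+ e1) * (cB (y ^+ e2) * b).
pose x1 := cB half * (b' - cB half * a'); pose x2 := cB half * (b' + cB half * a').
have fil_a' : filB (d1 + d2) a'.
  by apply: spanZ; move: fa; apply: fil_mono; lia.
have fil_b' : filB (d1 + d2) b'.
  by apply: spanZ; move: fb; apply: fil_mono; lia.
have f1 : filB (d1 + d2) x1.
  by apply: spanZ; apply: spanB => //; exact: spanZ.
have f2 : filB (d1 + d2) x2.
  by apply: spanZ; apply: spanDD => //; exact: spanZ.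
have kapK : betinv * (- bet P m) = 1 by rewrite /bet opprK.
have zz1 := @zB_zz P m y; have zz2 := @zB_zzm P m y.
have q1 := @fil_quadric_a P BB cB m y uu ww zz (zB_m m y) (@zB_u P m y) zz1 zz2 m_gt0 gam X thw thu.
have q2 := @fil_quadric_b P BB cB m y uu ww zz (zB_m m y) (@zB_u P m y) zz1 zz2 m_gt0 gam X thw thu.
apply: (@gmon_reduced_free P BB cB m y half uu ww zz half2 (zB_m m y) (@zB_u P m y)
  zz1 zz2 m_gt0 _ _ _ _ kapK q1 q2 _ r c' (d1 + d2)%N x1 x2) tr => //.
- by move=> d s us sd; exact: (mono_indep m_gt0 y0 us sd).
- by move=> t'; rewrite (mem_reduced_list m_gt0).
- exact: reduced_list_uniq.
have half2B : cB half * 2%:R = 1 by rewrite -(rmorph_nat cB) -rmorphM half2 rmorph1.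
rewrite /quadric_a /quadric_b -/LwB -/LuB.
transitivity (LwB * a' + LuB * b'); last first.
  rewrite /x1 /x2.
  transitivity ((cB half * 2%:R) * (LuB * b') + (cB half * 2%:R) * (cB half * 2%:R) * (LwB * a')).
    by rewrite half2B; ring.
  by ring.
transitivity (cB (y ^+ e1) * cB (y ^+ e2) * (cB y ^+ e * (\sum_(t <- r) cB (c t) * gB t))).
  rewrite mulrA mulr_sumr; apply: eq_big_seq => t'; rewrite (mem_reduced_list m_gt0) => tr'.
  rewrite gmon_reduced // -/(gB t') /c' !exprD !rmorphM !rmorphXn; ring.
by rewrite E /a' /b'; ring.
Qed.

End Specialization.

Section ReesIndependence.
Variables (k : fieldType) (m : nat).
Hypothesis char0 : [pchar k] =i pred0.
Hypothesis m_gt0 : (0 < m)%N.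
Local Notation R := {mpoly k[m.+3]}.
(** The parameter ring, with its structure of integral domain. *)
Definition Pd : idomainType := {mpoly k[m.+4]}.
Local Notation y := (yP k m : Pd).
Local Notation X := (@XP k m : nat -> Pd).
Local Notation gam := (gamP k m : Pd).
Local Notation FF := {fraction {poly {poly Pd}}}.

Definition sqinv : Pd := ((m.+2 * m.+2)%:R^-1)%:MP.
Definition betinv : Pd := ((m.+2 * 2)%:R^-1)%:MP.

Definition solP (i : nat) : FF := @sol Pd m y gam sqinv X (X m.+1) (X m.+2) i.
Definition kF : k -> FF := @cF Pd \o @mpolyC m.+4 k.
HB.instance Definition _ := GRing.RMorphism.on kF.

Definition sigP : {mpoly k[m.+4]} -> FF := mmap kF (fun i => solP i).
HB.instance Definition _ := GRing.RMorphism.on sigP.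
Definition sigPd : {rmorphism Pd -> FF} := sigP.

Local Notation uF := (@uF Pd m y).
Local Notation wF := (@wF Pd m y).
Local Notation zF := (@zF Pd m y).
Local Notation cF := (@cF Pd).

Lemma yP_neq0 : y != 0.
Proof.
apply/eqP => /(congr1 (mcoeff U_(inord m.+3))); rewrite mcoeffXU eqxx mcoeff0.
by move/eqP; rewrite oner_eq0.
Qed.

Lemma sigP_X i : (i < m.+4)%N -> sigPd (X i) = solP i.
Proof. by move=> im; rewrite /sigPd /= /sigP /XP mmapX mmap1U inordK. Qed.

Lemma sigP_C c : sigPd c%:MP = cF c%:MP.
Proof. exact: mmapC. Qed.

Lemma sigP_X2 i : (1 < i < m.+4)%N -> sigPd (X i) = cF (X i).
Proof.
move=> /andP[i1 im]; rewrite sigP_X // /solP /sol.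
by case: i i1 im => [|[|i]] // _ _; rewrite addr0.
Qed.

Lemma Pd_inv n : (n.+1%:R^-1 : k)%:MP * n.+1%:R = 1 :> Pd.
Proof. by rewrite -(rmorph_nat (@mpolyC m.+4 k)) -mpolyCM mulVf ?mpolyC1 ?natk_neq0. Qed.

(** The point of the ambient ring [R[t]] over the fraction field that the
    solutions [solP] of the quadrics define. *)
Definition xi (i : nat) : FF :=
  if (i < m)%N then solP i
  else if i == m then solP m + cF gam * zF 0
  else if i == m.+1 then wF else uF.

Definition tauR : R -> FF := mmap kF (fun i => xi i).
HB.instance Definition _ := GRing.RMorphism.on tauR.
(** The Rees variable is sent to [y / u ^+ m.+2], the value for which [zS m]
    becomes [y]. *)
Definition tau : {poly R} -> FF := horner_eval (cF y / uF ^+ m.+2) \o map_poly tauR.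
HB.instance Definition _ := GRing.RMorphism.on tau.

Lemma tauR_x i : (i < m.+3)%N -> tauR (xR k m i) = xi i.
Proof.
move=> im; rewrite (_ : xR k m i = 'X_(Ordinal im)); last first.
  by rewrite -xRE.
by rewrite /tauR mmapX mmap1U.
Qed.

Lemma tau_polyC p : tau p%:P = tauR p.
Proof. by rewrite /tau /= map_polyC /horner_eval hornerC. Qed.

Lemma xi_w : xi m.+1 = wF.
Proof.
rewrite /xi eqxx; have -> : (m.+1 < m)%N = false by lia.
by have -> : (m.+1 == m) = false by lia.
Qed.

Lemma xi_u : xi m.+2 = uF.
Proof.
rewrite /xi; have -> : (m.+2 < m)%N = false by lia.
have -> : (m.+2 == m) = false by lia.
by have -> : (m.+2 == m.+1) = false by lia.
Qed.

Lemma tau_u : tau (uS k m) = uF.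
Proof. by rewrite tau_polyC tauR_x ?xi_u //; lia. Qed.

Lemma tau_w : tau (wS k m) = wF.
Proof. by rewrite tau_polyC tauR_x ?xi_w //; lia. Qed.

Lemma uFn0 : uF != 0.
Proof. exact: (uF_neq0 m_gt0 yP_neq0). Qed.

Lemma tau_z j : (j <= m)%N -> tau (zS k m j) = zF j.
Proof.
move=> jm; have un0 : uF ^+ m.+2 != 0 by rewrite expf_neq0 ?uFn0.
rewrite /zS rmorphM /= tau_polyC {1}/tau /= map_polyX /horner_eval hornerX.
rewrite rmorphM !rmorphXn /= !tauR_x; [|lia|lia].
rewrite xi_w xi_u.
have -> : wF = uF * tofrac 'X by rewrite /wF /wB tofracM.
rewrite exprMn [X in X * (_ / _)](_ : _ = uF ^+ m.+2 * tofrac 'X ^+ (m - j)); last first.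
  by rewrite (_ : m.+2 = (m - j) + j.+2)%N ?exprD; [rewrite mulrAC | lia].
rewrite [LHS]mulrC mulrA divfK // /zF /zB tofracM tofracXn.
by [].
Qed.

Local Notation theta := (theta k m).

Lemma tau_cstS c : tau (cstS m c) = kF c.
Proof. by rewrite /cstS /= tau_polyC /tauR mmapC. Qed.

Lemma tau_par_X l : (l <= m)%N -> tau (par (XP k m l)) = solP l.
Proof.
rewrite leq_eqVlt => /orP[/eqP->|lm]; rewrite par_XP; try lia.
  rewrite theta_m rmorphB rmorphM /= tau_polyC tau_z // tau_cstS tauR_x; last by lia.
  by rewrite /xi ltnn eqxx addrK.
by rewrite theta_lt // tau_polyC tauR_x /xi ?lm //; lia.
Qed.

Definition tauP : Pd -> FF := tau \o @par k m.
HB.instance Definition _ := GRing.RMorphism.on tauP.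
Definition tauPd : {rmorphism Pd -> FF} := tauP.

Lemma tauP_C c : tauPd c%:MP = sigPd c%:MP.
Proof. by rewrite sigP_C; rewrite /= /tauP /= par_C tau_cstS. Qed.

Lemma tauP_X l : (l <= m)%N -> tauPd (X l) = sigPd (X l).
Proof. by move=> lm; rewrite sigP_X; [exact: tau_par_X | lia]. Qed.

Lemma tauP_quadric_w : @quadric_w Pd FF tauPd m uF wF zF gam X (X m.+1) = 0.
Proof.
have e := @quadric_w_map Pd {poly R} m (uS k m) (wS k m) (@zS k m) gam X (X m.+1) FF
  tau (@par k m) tauPd (fun=> erefl).
rewrite -(eq_quadric_w _ _ _ _ _ _ m_gt0 tau_z) -tau_u -tau_w.
by rewrite -[LHS]e quadric_wS ?(rmorph0 tau).
Qed.

Lemma tauP_quadric_u : @quadric_u Pd FF tauPd m uF wF zF X (X m.+1) (X m.+2) = 0.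
Proof.
have e := @quadric_u_map Pd {poly R} m (uS k m) (wS k m) (@zS k m) X (X m.+1) (X m.+2) FF
  tau (@par k m) tauPd (fun=> erefl).
rewrite -(eq_quadric_u _ _ _ _ _ _ tau_z) -tau_u -tau_w.
by rewrite -[LHS]e quadric_uS ?(rmorph0 tau).
Qed.

Lemma sqinvE : sqinv * (m.+2 * m.+2)%:R = 1.
Proof. by rewrite /sqinv mulSn addSn Pd_inv. Qed.

Lemma betinvE : betinv * (m.+2 * 2)%:R = 1.
Proof. by rewrite /betinv mulSn addSn Pd_inv. Qed.

Lemma sigP_sol i : (i <= m)%N -> sigPd (X i) = @sol Pd m y gam sqinv X (X m.+1) (X m.+2) i.
Proof. by move=> im; rewrite sigP_X //; lia. Qed.

Lemma sigP_w : sigPd (X m.+1) = cF (X m.+1).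
Proof. by apply: sigP_X2; lia. Qed.

Lemma sigP_u : sigPd (X m.+2) = cF (X m.+2).
Proof. by apply: sigP_X2; lia. Qed.

(** Both maps satisfy the two quadrics and they agree on the [X l], so they
    agree on the two parameters that occur in the quadrics with the nonzero
    coefficients [u] and [(n-1) u]. *)
Lemma tauP_w : tauPd (X m.+1) = sigPd (X m.+1).
Proof.
have := @quadric_w_diff Pd FF m uF wF zF gam X (X m.+1) tauPd sigPd (tauP_C _).
rewrite tauP_quadric_w.
rewrite (sig_quadric_w m_gt0 yP_neq0 sigP_sol (sigP_C _) sigP_w) subrr.
rewrite sum_eq0_mem => [|l /andP[_ lm]]; last by rewrite tauP_X // subrr mulr0 mul0r.
rewrite subr0 => /esym/eqP; rewrite mulf_eq0 (negbTE uFn0) /= subr_eq0 => /eqP //.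
Qed.

Lemma tauP_u : tauPd (X m.+2) = sigPd (X m.+2).
Proof.
have := @quadric_u_diff Pd FF m uF wF zF X (X m.+1) (X m.+2) tauPd sigPd.
rewrite tauP_quadric_u tauP_w.
rewrite (sig_quadric_u m_gt0 yP_neq0 sqinvE sigP_sol sigP_w sigP_u) !subrr mulr0 subr0.
rewrite sum_eq0_mem => [|l /andP[_ lm]]; last by rewrite tauP_X // subrr mulr0 mul0r.
have n0 : m.+2%:R != 0 :> FF.
  apply/eqP => n0; have := congr1 cF (Pd_inv m.+1).
  by rewrite rmorphM rmorph_nat n0 mulr0 rmorph1 => /esym/eqP; rewrite oner_eq0.
rewrite subr0 => /esym/eqP.
by rewrite !mulf_eq0 (negbTE uFn0) (negbTE n0) /= subr_eq0 => /eqP.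
Qed.

Lemma tauP_y : tauPd (X m.+3) = sigPd (X m.+3).
Proof.
rewrite sigP_X2; last by lia.
transitivity (tau (zS k m m)); first by rewrite zS_m.
by rewrite tau_z // /zF zB_m.
Qed.

Lemma X_ord (i : 'I_m.+4) : 'X_i = X i.
Proof. by rewrite /XP inord_val. Qed.

Lemma tau_par c : tau (par c) = sigPd c.
Proof.
rewrite -[LHS]/(tauPd c); move: c; apply: mpoly_closed_ind => [c|i|p q tp tq|p q tp tq].
- exact: tauP_C.
- rewrite X_ord; have [im|im] := leqP i m; first exact: tauP_X.
  have [->|i1] := eqVneq (i : nat) m.+1; first exact: tauP_w.
  have [->|i2] := eqVneq (i : nat) m.+2; first exact: tauP_u.
  have im4 := ltn_ord i; have -> : nat_of_ord i = m.+3 by lia.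
  exact: tauP_y.
- by rewrite (rmorphD tauPd) tp tq (rmorphD sigPd).
- by rewrite (rmorphM tauPd) tp tq (rmorphM sigPd).
Qed.

Lemma sigP_close p : @sig_close Pd m y gam X (X m.+1) (X m.+2) sigPd p.
Proof.
move: p; apply: mpoly_closed_ind => [c|i|p q|p q].
- by apply: sig_close_eq; exact: sigP_C.
- rewrite X_ord; have [im|im] := leqP i m.
    exact: (sig_close_X yP_neq0 sigP_sol im).
  by apply: sig_close_eq; apply: sigP_X2; rewrite ltn_ord andbT; lia.
- exact: sig_closeD.
- exact: sig_closeM.
Qed.

Lemma tau_gS t : t \in reduced_list m -> tau (gS k m t) = tofrac (@gB Pd m y t).
Proof.
rewrite (mem_reduced_list m_gt0) => /and3P[tm _ _].
have epsE : tau (eps m (@zS k m) t.1.1) = tofrac (eps m (@zB Pd m y) t.1.1).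
  by rewrite /eps; case: ltnP => _; [exact: tau_z | rewrite rmorph1 tofrac1].
have uzE : tau (uS k m + zS k m 0) = tofrac (@uB Pd m y + @zB Pd m y 0).
  by rewrite (rmorphD tau) /= tau_u tau_z // [RHS]tofracD.
rewrite /gS /gB !tofracM !tofracXn !(rmorphM tau) !(rmorphXn tau) /= epsE.
by rewrite (rmorphB tau) (rmorphD tau) /= uzE tau_w tofracB [tofrac (_ + wB _ _)]tofracD.
Qed.

(** On the parameters [tau] is [sigPd], and on the basis it is the inclusion of
    the scroll in the field of fractions; so [sig_free] applies. *)
Lemma gS_free c : \sum_(t <- reduced_list m) par (c t) * gS k m t = 0 ->
  forall t, t \in reduced_list m -> c t = 0.
Proof.
move=> /(congr1 tau); rewrite rmorph0 rmorph_sum /= => c0.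
apply: (@sig_free Pd m m_gt0 y gam (halfP k m) betinv X (X m.+1) (X m.+2) yP_neq0
  (halfP2 m char0) betinvE sigPd sigP_close c).
rewrite -[RHS]c0; apply: eq_big_seq => t tr.
by rewrite [RHS](rmorphM tau) /= tau_par tau_gS.
Qed.

End ReesIndependence.

Theorem theorem2p5 (k : fieldType) (hk : [pchar k]%R =i pred0)
    (n : nat) (hn : (4 <= n)%N) :
  cohen_macaulay (rees_algebra (jacobian_ideal (fpoly k n))).
Proof.
case: n hn => [|[|[|m]]] // m_gt0.
by apply: rees_cohen_macaulay => // c; exact: gS_free.
Qed.
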